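(* Let $\Phi=\exp(\phi)\in KV_3$ satisfy the pentagon equation $\Phi^{12,3,4}\Phi^{1,2,34}=\Phi^{1,2,3}\Phi^{1,23,4}\Phi^{2,3,4}$, let $\lambda=\pi(\phi_2)$, and let $s\in k$ satisfy $s^2/8=\lambda$. Then there is a unique $F\in\mathrm{Sol}_s(\widehat{KV})$ of the form $F=\exp(u)\exp(sr/2)$, with $u\in\mathfrak{tder}_2$ having all homogeneous components of degree $\ge2$, such that $\Phi=(F^{12,3})^{-1}(F^{1,2})^{-1}F^{2,3}F^{1,23}$.
   Context: $k$ is a field of characteristic zero; $\mathfrak{lie}_n$, $\mathrm{Ass}_n$ are the degree completions of the free Lie and free associative algebras over $k$ on $x_1,\dots,x_n$ (written $x,y$; $x,y,z$; $x,y,z,w$), graded by word length. $a=a_0+\sum_k(\partial_ka)x_k$ is the unique decomposition in $\mathrm{Ass}_n$; $\mathfrak{tr}_n=\mathrm{Ass}_n^+/\langle ab-ba\rangle$ with projection $\mathrm{Tr}$; $\mathrm{Tr}(f(x))=\sum f_m\mathrm{Tr}(x^m)$. $\mathrm{ch}(x,y)=\ln(e^xe^y)$; $\mathrm{ch}_s$ multiplies the degree-$m$ part of $\mathrm{ch}$ by $s^{m-1}$. $\mathfrak{tder}_n$: derivations with $u(x_i)=[x_i,a_i]$, written $(a_1,\dots,a_n)$ ($a_i$ with zero coefficient of $x_i$ in degree one); $\mathfrak{sder}_n$: those with $u(\sum x_i)=0$; $\mathrm{div}(u)=\sum_k\mathrm{Tr}(x_k\partial_ka_k)$; $\mathfrak{kv}_n=\{u\in\mathfrak{sder}_n:\mathrm{div}\,u=0\}$;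 $r=(y,0)\in\mathfrak{tder}_2$. $\mathrm{TAut}_n=\exp(\mathfrak{tder}_n)$, $KV_n=\exp(\mathfrak{kv}_n)$. $j(\exp u)=\sum_{m\ge0}\frac{u^m}{(m+1)!}\cdot\mathrm{div}(u)$; $\tilde\delta_sg=g(x)-g(\mathrm{ch}_s(x,y))+g(y)$; $\mathrm{Sol}_s(\widehat{KV})=\{F\in\mathrm{TAut}_2:F(x+y)=\mathrm{ch}_s(x,y),\ j(F)\in\tilde\delta_s(\mathfrak{tr}_1)\}$. For $u=(a,b)\in\mathfrak{tder}_2$: $u^{1,2}=(a(x,y),b(x,y),0)$, $u^{2,3}=(0,a(y,z),b(y,z))$, $u^{12,3}=(a,a,b)(x+y,z)$, $u^{1,23}=(a,b,b)(x,y+z)$. For $u=(a,b,c)\in\mathfrak{tder}_3$: $u^{1,2,3}=(a,b,c,0)$, $u^{2,3,4}=(0,a,b,c)(y,z,w)$, $u^{12,3,4}=(a,a,b,c)(x+y,z,w)$, $u^{1,23,4}=(a,b,b,c)(x,y+z,w)$, $u^{1,2,34}=(a,b,c,c)(x,y,z+w)$. For group elements $\exp(u)^{\dots}=\exp(u^{\dots})$. For $\Phi=\exp(\phi)$ satisfying the pentagon equation, the degree-two component $\phi_2$ of $\phi$ is of the form $(\alpha[y,z],\beta[z,x],\gamma[x,y])$, $\alpha,\beta,\gamma\in k$, and $\pi(\phi_2):=\alpha+\beta+\gamma$. *)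

(* Defs.v *)
(* Completed free associative algebra Ass_n over a field k,
   represented as coefficient functions on words (seq 'I_n). *)
From HB Require Import structures.
From mathcomp Require Import all_boot all_algebra.
Set Implicit Arguments. Unset Strict Implicit. Unset Printing Implicit Defensive.
Import GRing.Theory.
Local Open Scope ring_scope.

Section KV.
Variable k : fieldType.

Definition series (n : nat) := seq 'I_n -> k.

Definition szero n : series n := fun _ => 0.
Definition sone n : series n := fun w => (w == [::])%:R.
Definition sadd n (f g : series n) : series n := fun w => f w + g w.
Definition sopp n (f : series n) : series n := fun w => - f w.
Definition ssub n (f g : series n) : series n := fun w => f w - g w.
Definition sscale n (c : k) (f : series n) : series n := fun w => c * f w.
Definition xvar n (i : 'I_n) : series n := fun w => (w == [:: i])%:R.
Definition smul n (f g : series n) : series n :=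
  fun w => \sum_(i < (size w).+1) f (take i w) * g (drop i w).
Definition spow n (f : series n) (m : nat) : series n := iter m (smul f) (@sone n).
Definition shom n (d : nat) (f : series n) : series n :=
  fun w => if size w == d then f w else 0.

Inductive lie_poly n : series n -> Prop :=
| LP0 : lie_poly (@szero n)
| LPx i : lie_poly (xvar i)
| LPadd f g : lie_poly f -> lie_poly g -> lie_poly (sadd f g)
| LPscale c f : lie_poly f -> lie_poly (sscale c f)
| LPbr f g : lie_poly f -> lie_poly g -> lie_poly (ssub (smul f g) (smul g f))
| LPext f g : lie_poly f -> (forall w, f w = g w) -> lie_poly g.

Definition lie_series n (f : series n) : Prop := forall d, lie_poly (shom d f).

(* tangential derivations u = (a_1,...,a_n), u(x_i) = [x_i, a_i] *)
Definition tder_el n := 'I_n -> series n.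
Definition tder n (u : tder_el n) : Prop :=
  (forall i, lie_series (u i)) /\ (forall i, u i [:: i] = 0).

(* action of the derivation u on Ass_n (coefficientwise, finite sums).
   Coefficient of w in u(f): sum over splittings w = p ++ m ++ r with
   m = x_c t (term f(p x_c r) a_c(t)) or m = t x_c (term -f(p x_c r) a_c(t)).
   Only |m| >= 2 is kept: terms with t empty carry a_c(empty) = 0 for
   Lie series. *)
Definition der n (u : tder_el n) (f : series n) : series n := fun w =>
  \sum_(i < size w) \sum_(j < (size w).+1 | (i.+1 < j)%N)
    let p := take i w in let r := drop j w in
    match drop i (take j w) with
    | c :: t => f (p ++ c :: r) * u c t
                - f (p ++ last c t :: r) * u (last c t) (belast c t)
    | [::] => 0
    end.

(* exp(u) as an automorphism of Ass_n (the sum is finite coefficientwise) *)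
Definition expD n (u : tder_el n) (f : series n) : series n := fun w =>
  \sum_(m < (size w).+1) iter m (der u) f w / (m`!)%:R.

Definition tneg n (u : tder_el n) : tder_el n := fun i w => - u i w.
Definition tscale n (c : k) (u : tder_el n) : tder_el n := fun i w => c * u i w.

(* trace: Tr a = Tr b iff each homogeneous component of positive degree of
   a - b lies in the span of commutators [A,A] *)
Inductive comm_span n : series n -> Prop :=
| CS0 : comm_span (@szero n)
| CSc (v v' : seq 'I_n) :
    comm_span (fun w => (w == v ++ v')%:R - (w == v' ++ v)%:R)
| CSadd f g : comm_span f -> comm_span g -> comm_span (sadd f g)
| CSscale c f : comm_span f -> comm_span (sscale c f)
| CSext f g : comm_span f -> (forall w, f w = g w) -> comm_span g.

Definition tr_eq n (a b : series n) : Prop :=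
  forall d, (0 < d)%N -> comm_span (shom d (ssub a b)).

(* sum_k x_k (d_k a_k), whose trace is div(u) *)
Definition divS n (u : tder_el n) : series n := fun w =>
  match w with c :: v => u c (rcons v c) | [::] => 0 end.

Definition sder n (u : tder_el n) : Prop :=
  forall w, der u (fun w' => \sum_(i < n) xvar i w') w = 0.

Definition kv n (u : tder_el n) : Prop :=
  tder u /\ sder u /\ tr_eq (divS u) (@szero n).

(* j(exp u) = sum_m u^m/(m+1)! . div(u), as a representative in Ass_n *)
Definition Jser n (u : tder_el n) : series n := fun t =>
  \sum_(m < (size t).+1) iter m (der u) (divS u) t / ((m.+1)`!)%:R.

(* exp and log of series with zero constant term; BCH series *)
Definition sexp n (f : series n) : series n := fun w =>
  \sum_(m < (size w).+1) spow f m w / (m`!)%:R.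
Definition slog n (g : series n) : series n := fun w =>
  \sum_(m < size w) (-1) ^+ m * spow (ssub g (@sone n)) m.+1 w / (m.+1)%:R.

Definition vx : 'I_2 := inord 0.
Definition vy : 'I_2 := inord 1.

Definition ch : series 2 := slog (smul (sexp (xvar vx)) (sexp (xvar vy))).
Definition ch_s (s : k) : series 2 := fun w => s ^+ (size w).-1 * ch w.

(* tilde-delta_s g for g = sum_{m>=1} g_m Tr(x^m) in tr_1 *)
Definition delta_s (s : k) (g : nat -> k) : series 2 := fun w =>
  (if (0 < size w)%N && all (fun c => c == vx) w then g (size w) else 0)
  - \sum_(1 <= m < (size w).+1) g m * spow (ch_s s) m w
  + (if (0 < size w)%N && all (fun c => c == vy) w then g (size w) else 0).

Definition SolKV (s : k) (F : series 2 -> series 2) : Prop :=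
  exists w : tder_el 2, tder w /\ F = expD w /\
    (forall t, F (sadd (xvar vx) (xvar vy)) t = ch_s s t) /\
    exists g : nat -> k, tr_eq (Jser w) (delta_s s g).

Definition rder : tder_el 2 := fun i => if i == vx then xvar vy else @szero 2.

(* coface maps: p j = Some i means new variable j belongs to the block of old
   variable i; a(...) is substituted x_i |-> sum of x_j in block i, and new
   component j is (component p j) substituted, or 0 if p j = None. *)
Definition subst n m (p : 'I_m -> option 'I_n) (f : series n) : series m :=
  fun w => \sum_(v : (size w).-tuple 'I_n)
     f v * \prod_(j < size w) (p (tnth (in_tuple w) j) == Some (tnth v j))%:R.

Definition coface n m (p : 'I_m -> option 'I_n) (u : tder_el n) : tder_el m :=
  fun j => match p j with Some i => subst p (u i) | None => @szero m end.

Definition blk n m (l : seq nat) (j : 'I_m) : option 'I_n := insub (nth n l j).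

Definition p1_2   : 'I_3 -> option 'I_2 := blk 2 [:: 0; 1; 2]%N.
Definition p2_3   : 'I_3 -> option 'I_2 := blk 2 [:: 2; 0; 1]%N.
Definition p12_3  : 'I_3 -> option 'I_2 := blk 2 [:: 0; 0; 1]%N.
Definition p1_23  : 'I_3 -> option 'I_2 := blk 2 [:: 0; 1; 1]%N.
Definition p1_2_3  : 'I_4 -> option 'I_3 := blk 3 [:: 0; 1; 2; 3]%N.
Definition p2_3_4  : 'I_4 -> option 'I_3 := blk 3 [:: 3; 0; 1; 2]%N.
Definition p12_3_4 : 'I_4 -> option 'I_3 := blk 3 [:: 0; 0; 1; 2]%N.
Definition p1_23_4 : 'I_4 -> option 'I_3 := blk 3 [:: 0; 1; 1; 2]%N.
Definition p1_2_34 : 'I_4 -> option 'I_3 := blk 3 [:: 0; 1; 2; 2]%N.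

Definition pentagon (phi : tder_el 3) : Prop :=
  forall f t,
    expD (coface p12_3_4 phi) (expD (coface p1_2_34 phi) f) t =
    expD (coface p1_2_3 phi) (expD (coface p1_23_4 phi)
       (expD (coface p2_3_4 phi) f)) t.

(* pi(phi_2) = alpha + beta + gamma for phi_2 = (a[y,z], b[z,x], c[x,y]) *)
Definition v3 (i : nat) : 'I_3 := inord i.
Definition pi2 (phi : tder_el 3) : k :=
  phi (v3 0) [:: v3 1; v3 2] + phi (v3 1) [:: v3 2; v3 0]
  + phi (v3 2) [:: v3 0; v3 1].

Definition assoc_eq (phi : tder_el 3) (F : series 2 -> series 2) : Prop :=
  exists w : tder_el 2, tder w /\ F = expD w /\
    forall f t,
      expD phi f t =
      expD (tneg (coface p12_3 w)) (expD (tneg (coface p1_2 w))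
        (expD (coface p2_3 w) (expD (coface p1_23 w) f))) t.

End KV.

(* Main.v *)
(* A twist F = exp(w) of Phi is built degree by degree: the pentagon makes the
   degree-d defect of the equation F^{1,2} F^{12,3} Phi = F^{2,3} F^{1,23} a
   cocycle of the simplicial complex tder_2 -> tder_3 -> tder_4, which is exact
   at tder_3 in degree d >= 3, while in degree 2 the only obstruction is pi; the
   start w = s r / 2 + ... has obstruction s^2/8, whence the condition on s. The
   first differential is injective in degree >= 2, which gives uniqueness.

   Applied to x + y + z, which Phi fixes, the twist equation says that
   c = F(x+y) satisfies c(c(x,y),z) = c(x,c(y,z)). So does ch_s, both are Lie
   series with the same terms of degree at most 2, and the analogous complex of
   Lie series is acyclic in degree >= 3, so c = ch_s. Finally, since div Phi = 0,
   the cocycle j turns the twist equation into an equation for j(F) modulo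
   commutators; its lowest-degree part is a 2-cocycle on cyclic words, hence
   constant on the words containing both letters, and it is removed by
   subtracting a multiple of the tilde-delta_s of a power of x. *)
From HB Require Import structures.
From mathcomp Require Import all_boot all_algebra.
From mathcomp Require Import boolp.
From mathcomp Require Import ring zify.
Require Import Defs.
Set Implicit Arguments. Unset Strict Implicit. Unset Printing Implicit Defensive.
Import GRing.Theory.
Local Open Scope ring_scope.

(** * Noncommutative power series *)

(** A tangential derivation is stored by its components, so $\ln(e^ue^v)$ cannot be formed by
    multiplying in an associative algebra. Instead, power series are evaluated at operators that
    raise degree ([ev]): $\mathfrak{tder}_n$ acts on series through [der] and [Mop], and on series
    modulo commutators through [Dop]. Evaluating [ch] in [Mop] and applying the result to $1$ gives
    the components of the product, which are Lie because [ch] is. [Mop] is faithful, whence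
    associativity; [der] gives composition of automorphisms, and [Dop] the cocycle $j$.

    Comparing group elements through their logarithms makes the defect of the twist equation an
    element of $\mathfrak{tder}_3$, to which linear algebra applies. The constant $s^2/8$ is half of
    $(s/2)^2$: the cofaces of $r$ satisfy the linear equation, and only their brackets, with the
    factor $1/2$ of the Campbell-Hausdorff series, reach $\pi$. Limits are taken along the degree
    filtration [vanish]. Characteristic zero enters through $\exp$ and $\ln$, through cyclic sums as
    a test for traces, and through division by the degree in [lie_H2]. *)

Section SeriesAlgebra.
Context (k : fieldType).
Section Fixed.
Context (n : nat).
Implicit Types f g h : series k n.

HB.instance Definition _ := gen_eqMixin (series k n).
HB.instance Definition _ := gen_choiceMixin (series k n).

Let saddA : associative (@sadd k n).
Proof. by move=> f g h; apply/funext=> w; rewrite /sadd addrA. Qed.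
Let saddC : commutative (@sadd k n).
Proof. by move=> f g; apply/funext=> w; rewrite /sadd addrC. Qed.
Let sadd0 : left_id (@szero k n) (@sadd k n).
Proof. by move=> f; apply/funext=> w; rewrite /sadd add0r. Qed.
Let saddN : left_inverse (@szero k n) (@sopp k n) (@sadd k n).
Proof. by move=> f; apply/funext=> w; rewrite /sadd /sopp addNr. Qed.
HB.instance Definition _ :=
  GRing.isZmodule.Build (series k n) saddA saddC sadd0 saddN.

Let sscaleA (a b : k) f : sscale a (sscale b f) = sscale (a * b) f.
Proof. by apply/funext=> w; rewrite /sscale mulrA. Qed.
Let sscale1 : left_id 1 (@sscale k n).
Proof. by move=> f; apply/funext=> w; rewrite /sscale mul1r. Qed.
Let sscaleDr : right_distributive (@sscale k n) +%R.
Proof. by move=> a f g; apply/funext=> w; rewrite /sscale [LHS]mulrDr. Qed.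
Let sscaleDl f : {morph (@sscale k n)^~ f : a b / a + b}.
Proof. by move=> a b; apply/funext=> w; rewrite /sscale mulrDl. Qed.
HB.instance Definition _ :=
  GRing.Zmodule_isLmodule.Build k (series k n) sscaleA sscale1 sscaleDr sscaleDl.

Lemma addsE f g w : (f + g) w = f w + g w. Proof. by []. Qed.
Lemma oppsE f w : (- f) w = - f w. Proof. by []. Qed.
Lemma scalesE (a : k) f w : (a *: f) w = a * f w. Proof. by []. Qed.
Lemma zerosE w : (0 : series k n) w = 0. Proof. by []. Qed.
Lemma sumsE I (r : seq I) (P : pred I) (F : I -> series k n) w :
  (\sum_(i <- r | P i) F i) w = \sum_(i <- r | P i) F i w.
Proof. by elim/big_rec2: _ => // i x y _ <-. Qed.

(** Left quotient by a letter. Words are lists, so identities of series are proved by peeling first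
    letters with [lq], and [series_dec] reassembles the series. *)
Definition lq (i : 'I_n) f : series k n := fun w => f (i :: w).

Lemma lqD i f g : lq i (f + g) = lq i f + lq i g. Proof. by []. Qed.
Lemma lqZ i a f : lq i (a *: f) = a *: lq i f. Proof. by []. Qed.

Lemma smul_nil f g : smul f g [::] = f [::] * g [::].
Proof. by rewrite /smul big_ord_recl big_ord0 addr0. Qed.

Lemma smul_cons f g i w :
  smul f g (i :: w) = f [::] * g (i :: w) + smul (lq i f) g w.
Proof. by rewrite /smul big_ord_recl /=. Qed.

Let smulDl : left_distributive (@smul k n) +%R.
Proof.
move=> f g h; apply/funext=> w; rewrite addsE /smul -big_split /=.
by apply: eq_bigr => i _; rewrite mulrDl.
Qed.
Let smulDr : right_distributive (@smul k n) +%R.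
Proof.
move=> f g h; apply/funext=> w; rewrite addsE /smul -big_split /=.
by apply: eq_bigr => i _; rewrite mulrDr.
Qed.
Let smulZl a f g : a *: smul f g = smul (a *: f) g.
Proof.
apply/funext=> w; rewrite scalesE /smul big_distrr /=.
by apply: eq_bigr => i _; rewrite mulrA.
Qed.
Let smulZr a f g : a *: smul f g = smul f (a *: g).
Proof.
apply/funext=> w; rewrite scalesE /smul big_distrr /=.
by apply: eq_bigr => i _; rewrite mulrCA.
Qed.
Let lq_smul i f g : lq i (smul f g) = f [::] *: lq i g + smul (lq i f) g.
Proof. by apply/funext=> w; rewrite /lq smul_cons. Qed.
Let smulA : associative (@smul k n).
Proof.
move=> f g h; apply/funext=> w; elim: w f g h => [|i w IH] f g h.
  by rewrite !smul_nil mulrA.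
rewrite !smul_cons lq_smul smulDl addsE -smulZl scalesE IH smul_nil.
by rewrite mulrDr mulrA addrA.
Qed.
Let smul0 (f : series k n) : smul 0 f = 0.
Proof. by apply/funext=> w; rewrite /smul big1 // => i _; rewrite mul0r. Qed.
Let sone_cons i : lq i (@sone k n) = 0.
Proof. by []. Qed.
Let smul1 : left_id (@sone k n) (@smul k n).
Proof.
move=> f; apply/funext=> -[|i w]; first by rewrite smul_nil mul1r.
by rewrite smul_cons sone_cons smul0 zerosE addr0 mul1r.
Qed.
Let smulr1 : right_id (@sone k n) (@smul k n).
Proof.
move=> f; apply/funext=> w; elim: w f => [|i w IH] f; first by rewrite smul_nil mulr1.
by rewrite smul_cons IH mulr0 add0r.
Qed.
Let sone_neq0 : (@sone k n) != 0.
Proof. by apply/eqP => /(congr1 (fun f => f [::])) /eqP; rewrite oner_eq0. Qed.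
HB.instance Definition _ := GRing.Zmodule_isNzRing.Build (series k n)
  smulA smul1 smulr1 smulDl smulDr sone_neq0.
HB.instance Definition _ := GRing.Lmodule_isLalgebra.Build k (series k n) smulZl.
HB.instance Definition _ := GRing.Lalgebra_isAlgebra.Build k (series k n) smulZr.

Lemma mul_nil f g : (f * g) [::] = f [::] * g [::].
Proof. exact: smul_nil. Qed.
Lemma mul_cons f g i w :
  (f * g) (i :: w) = f [::] * g (i :: w) + (lq i f * g) w.
Proof. exact: smul_cons. Qed.
Lemma one_nil : (1 : series k n) [::] = 1. Proof. by []. Qed.
Lemma lq_mul i f g : lq i (f * g) = f [::] *: lq i g + lq i f * g.
Proof. exact: lq_smul. Qed.
Lemma lq1 i : lq i 1 = 0. Proof. by []. Qed.

Definition var (i : 'I_n) : series k n := xvar k i.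
Lemma var_nil i : var i [::] = 0. Proof. by []. Qed.
Lemma lq_var i j : lq i (var j) = (i == j)%:R.
Proof.
apply/funext=> w; rewrite /lq /var /xvar eqseq_cons.
by case: (i == j) => //=; case: w.
Qed.

Lemma series_eq f g :
  f [::] = g [::] -> (forall i, lq i f = lq i g) -> f = g.
Proof. by move=> H0 H; apply/funext=> -[|i w] //; have := congr1 (@^~ w) (H i). Qed.

Lemma lq_sum i I (r : seq I) (P : pred I) (F : I -> series k n) :
  lq i (\sum_(j <- r | P j) F j) = \sum_(j <- r | P j) lq i (F j).
Proof. by apply/funext=> w; rewrite /lq !sumsE. Qed.

Lemma series_dec f : f = f [::] *: 1 + \sum_i var i * lq i f.
Proof.
apply: series_eq => [|i].
  by rewrite addsE sumsE big1 ?addr0 ?scalesE ?mulr1// => i _; rewrite mul_nil var_nil mul0r.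
rewrite lqD lqZ lq1 scaler0 add0r lq_sum (bigD1 i)//= big1 => [|j ji].
  by rewrite addr0 lq_mul var_nil scale0r add0r lq_var eqxx mul1r.
by rewrite lq_mul var_nil scale0r add0r lq_var eq_sym (negPf ji) mul0r.
Qed.

Lemma spowE f m : spow f m = f ^+ m.
Proof. by elim: m => [|m IH] //=; rewrite exprS -IH. Qed.

(** The degree filtration. It separates series ([eq_vanish]), so equalities of infinite sums are
    proved modulo degree [d] for every [d]. *)
Definition vanish (d : nat) f := forall w, (size w < d)%N -> f w = 0.

Lemma vanish0 f : vanish 0 f. Proof. by []. Qed.
Lemma vanishW d e f : (d <= e)%N -> vanish e f -> vanish d f.
Proof. by move=> de H w /leq_trans wd; apply/H/wd. Qed.
Lemma vanish_0 d : vanish d (0 : series k n). Proof. by []. Qed.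
Lemma vanishD d f g : vanish d f -> vanish d g -> vanish d (f + g).
Proof. by move=> Hf Hg w Hw; rewrite addsE Hf ?Hg ?addr0. Qed.
Lemma vanishN d f : vanish d f -> vanish d (- f).
Proof. by move=> Hf w Hw; rewrite oppsE Hf ?oppr0. Qed.
Lemma vanishB d f g : vanish d f -> vanish d g -> vanish d (f - g).
Proof. by move=> Hf Hg; apply/vanishD/vanishN. Qed.
Lemma vanishZ d a f : vanish d f -> vanish d (a *: f).
Proof. by move=> Hf w Hw; rewrite scalesE Hf ?mulr0. Qed.
Lemma vanish_sum d I (r : seq I) (P : pred I) (F : I -> series k n) :
  (forall i, P i -> vanish d (F i)) -> vanish d (\sum_(i <- r | P i) F i).
Proof. by move=> H w Hw; rewrite sumsE big1 // => i Pi; apply: H. Qed.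
Lemma vanish1P f : f [::] = 0 -> vanish 1 f.
Proof. by move=> H [|]. Qed.
Lemma vanish_nil d f : vanish d.+1 f -> f [::] = 0.
Proof. by apply. Qed.
Lemma vanish_var i : vanish 1 (var i).
Proof. exact: vanish1P. Qed.
Lemma vanish_lq d i f : vanish d.+1 f -> vanish d (lq i f).
Proof. by move=> H w Hw; apply: H. Qed.

Lemma vanish_mul d e f g : vanish d f -> vanish e g -> vanish (d + e) (f * g).
Proof.
move=> Hf Hg w Hw; rewrite [LHS](_ : _ = smul f g w)// /smul big1 // => -[i /= iw] _.
case: (ltnP i d) => id; first by rewrite Hf ?mul0r // size_takel.
by rewrite Hg ?mulr0 // size_drop; lia.
Qed.
Lemma vanish_exp d f : vanish 1 f -> vanish d (f ^+ d).
Proof.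
move=> Hf; elim: d => [|d IH]; first exact: vanish0.
by rewrite exprS -add1n; apply: vanish_mul.
Qed.

Lemma eq_vanish f g : (forall d, vanish d (f - g)) -> f = g.
Proof.
move=> H; apply/funext=> w; apply/eqP; rewrite -subr_eq0.
by apply/eqP; apply: (H (size w).+1 w).
Qed.
Lemma vanish_eq d f g w : vanish d (f - g) -> (size w < d)%N -> f w = g w.
Proof. by move=> H /H /eqP; rewrite addsE oppsE subr_eq0 => /eqP. Qed.

Lemma sum_shom e f w : (size w < e)%N -> (\sum_(i < e) shom i f) w = f w.
Proof.
move=> we; rewrite sumsE (bigD1 (Ordinal we))//= /shom eqxx.
by rewrite big1 ?addr0 // => i /eqP H; case: eqP => // E; case: H; apply: ord_inj.
Qed.
End Fixed.
End SeriesAlgebra.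
Arguments vanish {k n}.
Arguments var {k n}.

(* [ring] does not terminate on goals with atoms of the form [f w] whose type
   is only convertible to the scalar field, so the atoms are generalized. *)
Ltac sring :=
  let w := fresh "w" in
  apply/funext=> w;
  rewrite ?sumsE ?(addsE, oppsE, scalesE, zerosE);
  repeat match goal with
  | |- context [?f w] => let a := fresh "a" in set a : GRing.Field.sort _ := f w; move: a => a
  end; ring.

(** * Power series in degree-raising operators *)

Section Operators.
Context (k : fieldType).

(* Power series in such operators converge coefficientwise. *)
Definition raising m (P : series k m -> series k m) : Prop :=
  linear P /\ forall d f, vanish d f -> vanish d.+1 (P f).

Section OneOperator.
Context (m : nat) (P : series k m -> series k m).
Hypothesis HP : raising P.
Lemma raisD f g : P (f + g) = P f + P g.
Proof. by have := HP.1 1 f g; rewrite !scale1r. Qed.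
Lemma rais0 : P 0 = 0.
Proof. by apply: (addrI (P 0)); rewrite -raisD !addr0. Qed.
Lemma raisZ a f : P (a *: f) = a *: P f.
Proof. by have := HP.1 a f 0; rewrite !addr0 rais0 addr0. Qed.
Lemma raisN f : P (- f) = - P f.
Proof. by rewrite -scaleN1r raisZ scaleN1r. Qed.
Lemma raisB f g : P (f - g) = P f - P g.
Proof. by rewrite raisD raisN. Qed.
Lemma rais_sum I (r : seq I) (Q : pred I) (F : I -> series k m) :
  P (\sum_(i <- r | Q i) F i) = \sum_(i <- r | Q i) P (F i).
Proof. by elim/big_rec2: _ => [|i x y _ <-]; rewrite ?rais0 ?raisD. Qed.
Lemma rais_van d f : vanish d f -> vanish d.+1 (P f).
Proof. exact: HP.2. Qed.
Lemma rais_vanW d f : vanish d f -> vanish d (P f).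
Proof. by move=> /rais_van; apply: vanishW. Qed.
Lemma rais_iter j d f : vanish d f -> vanish (d + j) (iter j P f).
Proof. by elim: j => [|j IH] Hf; rewrite ?addn0 // addnS; apply/rais_van/IH. Qed.
End OneOperator.

Lemma raising_mull m (a : series k m) : a [::] = 0 -> raising (GRing.mul a).
Proof.
move=> a0; split=> [c f g|d f Hf]; first by rewrite mulrDr scalerAr.
by rewrite -add1n; apply: vanish_mul => //; apply: vanish1P.
Qed.
Lemma raising_add m (P Q : series k m -> series k m) :
  raising P -> raising Q -> raising (fun f => P f + Q f).
Proof.
move=> HP HQ; split=> [a f g|d f Hf]; last by apply: vanishD; exact: rais_van.
by rewrite HP.1 HQ.1 scalerDr addrACA.
Qed.

Section Eval.
Context (n m : nat).
Implicit Types (P Q : 'I_n -> series k m -> series k m) (f g : series k n)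
  (h : series k m).

Fixpoint evN N P f h : series k m :=
  f [::] *: h + if N is N'.+1 then \sum_i P i (evN N' P (lq i f) h) else 0.

(* The value of the power series [f] at the noncommuting operators [P i],
   applied to [h]. *)
Definition ev P f h : series k m := fun w => evN (size w) P f h w.

Lemma evN0 P f h : evN 0 P f h = f [::] *: h. Proof. by rewrite /= addr0. Qed.
Lemma evNS N P f h :
  evN N.+1 P f h = f [::] *: h + \sum_i P i (evN N P (lq i f) h).
Proof. by []. Qed.

Lemma evN_step P f h N : (forall i, raising (P i)) ->
  vanish N.+1 (evN N.+1 P f h - evN N P f h).
Proof.
move=> HP; elim: N f => [|N IH] f.
  rewrite evNS evN0 addrC addrA addNr add0r; apply/vanish_sum => i _.
  by apply: rais_van => //; exact: vanish0.
rewrite evNS [evN N.+1 _ _ _]evNS opprD addrACA subrr add0r -sumrB.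
apply: vanish_sum => i _; rewrite -raisB //; apply: rais_van => //; exact: (IH (lq i f)).
Qed.

(** Words longer than [N] apply more than [N] raising operators and land in degree above [N]; hence
    the depth [size w] chosen in [ev] loses nothing at [w]. *)
Lemma evN_ev P f h N : (forall i, raising (P i)) ->
  vanish N.+1 (ev P f h - evN N P f h).
Proof.
move=> HP w wN; rewrite addsE oppsE /ev.
rewrite -(subnKC (m := size w) (n := N)); last by rewrite -ltnS.
elim: (N - size w)%N => [|e IH]; first by rewrite addn0 subrr.
have := @evN_step P f h (size w + e) HP w; rewrite ltnS leq_addr addsE oppsE.
by move=> /(_ isT) /eqP; rewrite subr_eq0 addnS => /eqP ->.
Qed.

Lemma ev_rec P f h : (forall i, raising (P i)) ->
  ev P f h = f [::] *: h + \sum_i P i (ev P (lq i f) h).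
Proof.
move=> HP; apply: eq_vanish => d; apply: (@vanishW _ _ _ d.+2); first by lia.
rewrite -[ev P f h](subrK (evN d.+1 P f h)) -addrA.
apply: vanishD; first exact: (@evN_ev P f h d.+1 HP).
rewrite evNS opprD addrACA subrr add0r -sumrB; apply: vanish_sum => i _.
rewrite -raisB //; apply: rais_van => //; rewrite -opprB.
exact/vanishN/(@evN_ev P (lq i f) h d HP).
Qed.

(** The recursion determines the values because each unfolding gains one degree. Linearity in [h],
    multiplicativity and intertwining are all read off from it. *)
Lemma ev_uniq P (G : series k n -> series k m) h :
  (forall i, raising (P i)) ->
  (forall f, G f = f [::] *: h + \sum_i P i (G (lq i f))) ->
  forall f, G f = ev P f h.
Proof.
move=> HP HG f; apply: eq_vanish => d; elim: d f => [|d IH] f; first exact: vanish0.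
rewrite HG ev_rec // opprD addrACA subrr add0r -sumrB; apply: vanish_sum => i _.
by rewrite -raisB //; apply: rais_van.
Qed.

Lemma ev_linl P a f g h : (forall i, raising (P i)) ->
  ev P (a *: f + g) h = a *: ev P f h + ev P g h.
Proof.
move=> HP; apply/funext=> w.
suff H N f' g' : evN N P (a *: f' + g') h = a *: evN N P f' h + evN N P g' h.
  by rewrite addsE scalesE /ev H.
elim: N f' g' => [|N IH] f' g'; first by rewrite !evN0 addsE scalesE scalerDl scalerA.
rewrite !evNS addsE scalesE scalerDl scalerDr scalerA addrACA; congr (_ + _).
rewrite scaler_sumr -big_split /=; apply: eq_bigr => i _.
by rewrite -raisZ // -raisD // -IH.
Qed.
Lemma evDl P f g h : (forall i, raising (P i)) ->
  ev P (f + g) h = ev P f h + ev P g h.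
Proof. by move=> HP; have := ev_linl 1 f g h HP; rewrite !scale1r. Qed.
Lemma ev0l P h : (forall i, raising (P i)) -> ev P 0 h = 0.
Proof. by move=> HP; apply: (addrI (ev P 0 h)); rewrite -evDl // !addr0. Qed.
Lemma evZl P a f h : (forall i, raising (P i)) -> ev P (a *: f) h = a *: ev P f h.
Proof. by move=> HP; have := ev_linl a f 0 h HP; rewrite ev0l // !addr0. Qed.
Lemma evNl P f h : (forall i, raising (P i)) -> ev P (- f) h = - ev P f h.
Proof. by move=> HP; rewrite -scaleN1r evZl // scaleN1r. Qed.
Lemma evBl P f g h : (forall i, raising (P i)) ->
  ev P (f - g) h = ev P f h - ev P g h.
Proof. by move=> HP; rewrite evDl // evNl. Qed.
Lemma ev_suml P I (r : seq I) (Q : pred I) (F : I -> series k n) h :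
  (forall i, raising (P i)) ->
  ev P (\sum_(i <- r | Q i) F i) h = \sum_(i <- r | Q i) ev P (F i) h.
Proof. by move=> HP; elim/big_rec2: _ => [|i x y _ <-]; rewrite ?ev0l ?evDl. Qed.

Lemma ev_linr P a f h h' : (forall i, raising (P i)) ->
  ev P f (a *: h + h') = a *: ev P f h + ev P f h'.
Proof.
move=> HP; symmetry; apply: (ev_uniq (G := fun f => a *: ev P f h + ev P f h')) => // g.
rewrite {1}[ev P g h]ev_rec // {1}[ev P g h']ev_rec // !scalerDr.
rewrite addrACA !scalerA mulrC; congr (_ + _).
rewrite scaler_sumr -big_split /=; apply: eq_bigr => i _.
by rewrite raisD // raisZ.
Qed.

Lemma ev_van P f h d e : (forall i, raising (P i)) ->
  vanish d h -> vanish e f -> vanish (d + e) (ev P f h).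
Proof.
move=> HP; elim: e f => [|e IH] f Hh Hf.
  rewrite addn0; elim: d h Hh => [|d IH] h Hh; first exact: vanish0.
  suff H: forall N g, vanish d.+1 (evN N P g h) by move=> w; apply: H.
  elim=> [|N IHN] g /=; first by rewrite addr0; apply: vanishZ.
  apply: vanishD; [exact: vanishZ | apply: vanish_sum => i _].
  by apply: rais_vanW.
rewrite ev_rec // (vanish_nil Hf) scale0r add0r addnS; apply: vanish_sum => i _.
by apply: rais_van => //; apply: IH => //; apply: vanish_lq.
Qed.

Lemma raising_ev P f : (forall i, raising (P i)) -> f [::] = 0 -> raising (ev P f).
Proof.
move=> HP f0; split=> [a h h'|d h Hh]; first exact: ev_linr.
by rewrite -addn1; apply: ev_van => //; apply: vanish1P.
Qed.

Lemma ev_var P i h : (forall i, raising (P i)) -> ev P (var i) h = P i h.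
Proof.
move=> HP; rewrite ev_rec // var_nil scale0r add0r (bigD1 i) //= big1 => [|j ji].
  rewrite addr0 lq_var eqxx mulr1n ev_rec // one_nil scale1r big1 ?addr0// => j _.
  by rewrite lq1 ev0l // rais0.
by rewrite lq_var (negPf ji) mulr0n ev0l // rais0.
Qed.

Lemma ev_mul P f g h : (forall i, raising (P i)) ->
  ev P (f * g) h = ev P f (ev P g h).
Proof.
move=> HP; apply: (ev_uniq (G := fun f => ev P (f * g) h)) => // f'.
rewrite ev_rec // mul_nil -scalerA [ev P g h in RHS](ev_rec g h HP) // scalerDr -addrA.
congr (_ + _); rewrite scaler_sumr -big_split /=; apply: eq_bigr => i _.
by rewrite lq_mul evDl // evZl // raisD // raisZ.
Qed.

Lemma ev1 P h : (forall i, raising (P i)) -> ev P 1 h = h.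
Proof.
move=> HP; rewrite ev_rec // one_nil scale1r big1 ?addr0 // => i _.
by rewrite lq1 ev0l // rais0.
Qed.

Lemma ev_exp P f h j : (forall i, raising (P i)) ->
  ev P (f ^+ j) h = iter j (ev P f) h.
Proof.
move=> HP; elim: j => [|j IH]; first by rewrite expr0 ev1.
by rewrite exprS ev_mul // IH.
Qed.

Lemma ev_pert_weak P Q f h d e : (forall i, raising (P i)) -> (forall i, raising (Q i)) ->
  (forall i c h, vanish c h -> vanish (c + e) (P i h - Q i h)) ->
  vanish d h -> vanish (d + e) (ev P f h - ev Q f h).
Proof.
move=> HP HQ HPQ Hh; suff: forall c, (c <= d + e)%N -> vanish c (ev P f h - ev Q f h).
  by move=> /(_ (d + e)%N); apply.
move=> c; elim: c f => [|c IH] f Hc; first exact: vanish0.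
rewrite !ev_rec // opprD addrACA subrr add0r -sumrB; apply: vanish_sum => i _.
rewrite -[P i _](subrK (Q i (ev P (lq i f) h))) -addrA -raisB //.
apply: vanishD.
  by apply: (vanishW Hc); apply: HPQ; rewrite -[d]addn0; apply: ev_van.
by apply: rais_van => //; apply: IH; apply: ltnW.
Qed.

(** A word of length at least two contains, besides the letter at which [P] is replaced by [Q],
    another operator that raises degree. So to leading order only the linear terms of [f] see the
    change. *)
Lemma ev_pert P Q f h d e : (forall i, raising (P i)) -> (forall i, raising (Q i)) ->
  (forall i c h, vanish c h -> vanish (c + e) (P i h - Q i h)) ->
  vanish d h ->
  vanish (d + e).+1 (ev P f h - ev Q f h - \sum_i f [:: i] *: (P i h - Q i h)).
Proof.
move=> HP HQ HPQ Hh; rewrite [ev P f h]ev_rec // [ev Q f h]ev_rec //.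
rewrite opprD addrACA subrr add0r -!sumrB; apply: vanish_sum => i _.
set X := ev P _ h; set Y := ev Q _ h.
have -> : P i X - Q i Y - f [:: i] *: (P i h - Q i h)
   = (P i (X - f [:: i] *: h) - Q i (X - f [:: i] *: h)) + Q i (X - Y).
  by rewrite !(raisB (HP i)) !(raisB (HQ i)) (raisZ (HP i)) (raisZ (HQ i)); sring.
apply: vanishD.
  rewrite -addSn; apply: HPQ; rewrite /X ev_rec // addrC addrA addNr add0r.
  apply: vanish_sum => j _; apply: rais_van => //.
  by rewrite -[d]addn0; apply: ev_van.
by apply: rais_van => //; apply: ev_pert_weak.
Qed.
End Eval.

Lemma ev_intertwine n m m' (P : 'I_n -> series k m -> series k m)
  (P' : 'I_n -> series k m' -> series k m') (S : series k m -> series k m') f h :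
  (forall i, raising (P i)) -> (forall i, raising (P' i)) ->
  linear S ->
  (forall i g, S (P i g) = P' i (S g)) ->
  S (ev P f h) = ev P' f (S h).
Proof.
move=> HP HP' HS HPS; apply: (ev_uniq (G := fun f => S (ev P f h))) => // g.
have SD x y : S (x + y) = S x + S y by have := HS 1 x y; rewrite !scale1r.
have S0 : S 0 = 0 by apply: (addrI (S 0)); rewrite -SD !addr0.
have SZ a x : S (a *: x) = a *: S x by have := HS a x 0; rewrite S0 !addr0.
rewrite ev_rec // SD SZ; congr (_ + _).
elim/big_rec2: _ => [//|i x y _ <-]; by rewrite SD HPS.
Qed.

End Operators.

(** * Exponentials of degree-raising operators *)

Section Exponential.
Context (k : fieldType).

(* When [P] raises degrees the terms with [j > size w] vanish at [w], so this is
   the full sum of the [c j P^j h]. *)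
Definition oser m (c : nat -> k) (P : series k m -> series k m) h : series k m :=
  fun w => \sum_(j < (size w).+1) c j * iter j P h w.

Lemma oser_trunc m c (P : series k m -> series k m) h N : raising P ->
  vanish N.+1 (oser c P h - \sum_(j < N.+1) c j *: iter j P h).
Proof.
move=> HP w wN; rewrite addsE oppsE sumsE /oser; apply/eqP; rewrite subr_eq0; apply/eqP.
rewrite (big_ord_widen N.+1 (fun j => c j * iter j P h w)) // big_mkcond /=.
apply: eq_bigr => j _; case: ifP => // /negbT; rewrite -leqNgt scalesE => wj.
rewrite (_ : iter j P h w = 0) ?mulr0 //.
by have := rais_iter HP (j:=j) (@vanish0 k m h); apply.
Qed.

(** A series in one operator is the evaluation of a series in one letter, whose words are just
    lengths. This brings the lemmas on [ev] to bear on exponentials. *)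
Lemma oser_ev m c (P : series k m -> series k m) h : raising P ->
  oser c P h = ev (fun _ : 'I_1 => P) (fun w => c (size w)) h.
Proof.
move=> HP.
have H N a : evN N (fun _ : 'I_1 => P) (fun w => c (size w + a)%N) h
    = \sum_(j < N.+1) c (j + a)%N *: iter j P h.
  elim: N a => [|N IH] a; first by rewrite evN0 big_ord_recl big_ord0 addr0.
  rewrite evNS [RHS]big_ord_recl big_ord1; congr (_ + _).
  have -> : lq ord0 (fun w => c (size w + a)%N) = (fun w => c (size w + a.+1)%N) :> series k 1.
    by apply/funext=> w; rewrite /lq /= addSnnS.
  rewrite IH rais_sum //; apply: eq_bigr => j _.
  by rewrite raisZ // lift0 addSnnS.
apply/funext=> w; rewrite /ev.
have <- : (fun w => c (size w + 0)%N) = (fun w => c (size w)) :> series k 1.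
  by apply/funext=> v; rewrite addn0.
by rewrite H sumsE /oser; apply: eq_bigr => j _; rewrite addn0 scalesE.
Qed.

Definition ifact (j : nat) : k := (j`!%:R)^-1.
Definition oexp m (P : series k m -> series k m) h := oser ifact P h.

Lemma oexp_pert m (P Q : series k m -> series k m) h d e : raising P -> raising Q ->
  (forall c g, vanish c g -> vanish (c + e) (P g - Q g)) -> vanish d h ->
  vanish (d + e).+1 (oexp P h - oexp Q h - (P h - Q h)).
Proof.
move=> HP HQ H Hh; rewrite /oexp !oser_ev //.
have := @ev_pert k 1 m (fun=> P) (fun=> Q) (fun w => ifact (size w)) h d e
  (fun=> HP) (fun=> HQ) (fun=> H) Hh.
by rewrite big_ord1 /ifact /= invr1 scale1r.
Qed.

Lemma oexp_nil m (P : series k m -> series k m) h : oexp P h [::] = h [::].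
Proof. by rewrite /oexp /oser big_ord1 /ifact fact0 invr1 mul1r. Qed.

Lemma linear_oexp m (P : series k m -> series k m) : raising P -> linear (oexp P).
Proof. by move=> HP a f g; rewrite /oexp !oser_ev // ev_linr. Qed.

Lemma oexp_lead m (P : series k m -> series k m) h d : raising P ->
  vanish d h -> vanish d.+1 (oexp P h - h).
Proof.
move=> HP Hh; rewrite /oexp oser_ev // ev_rec // {1}/ifact fact0 invr1 scale1r.
rewrite addrC addrA addNr add0r; apply: vanish_sum => i _; apply: rais_van => //.
by rewrite -[d]addn0; apply: ev_van.
Qed.

Lemma oexp_id m (P : series k m -> series k m) h : raising P -> P h = 0 -> oexp P h = h.
Proof.
move=> HP H; apply/funext=> w; rewrite /oexp /oser big_ord_recl big1 => [|j _].
  by rewrite addr0 /ifact fact0 invr1 mul1r.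
have -> : iter (lift ord0 j) P h = 0; last by rewrite mulr0.
by rewrite lift0 iterSr H; elim: (j : nat) => //= i ->; exact: rais0.
Qed.

Lemma sexp_oexp m (f : series k m) : sexp f = oexp (GRing.mul f) 1.
Proof. by apply/funext=> w; apply: eq_bigr => j _; rewrite mulrC. Qed.

Lemma expD_oexp m (u : tder_el k m) f : expD u f = oexp (der u) f.
Proof. by apply/funext=> w; apply: eq_bigr => j _; rewrite mulrC. Qed.

Lemma iter_mull m (f : series k m) j h : iter j (GRing.mul f) h = f ^+ j * h.
Proof. by elim: j => [|j IH]; rewrite ?expr0 ?mul1r //= IH exprS mulrA. Qed.

Lemma sexp_trunc m (f : series k m) N : f [::] = 0 ->
  vanish N.+1 (sexp f - \sum_(j < N.+1) ifact j *: f ^+ j).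
Proof.
move=> f0; rewrite sexp_oexp; have := oser_trunc ifact 1 (N := N) (raising_mull f0).
by congr (vanish _ (_ - _)); apply: eq_bigr => j _; rewrite iter_mull mulr1.
Qed.

Lemma sexp_nil m (f : series k m) : sexp f [::] = 1.
Proof. by rewrite sexp_oexp oexp_nil. Qed.

Lemma ev_sexp n m (P : 'I_n -> series k m -> series k m) (f : series k n) h :
  (forall i, raising (P i)) -> f [::] = 0 ->
  ev P (sexp f) h = oexp (ev P f) h.
Proof.
move=> HP f0; apply: eq_vanish => d; apply: (vanishW (leqnSn d)).
rewrite -[ev P (sexp f) h](subrK (ev P (\sum_(j < d.+1) ifact j *: f ^+ j) h)) -addrA.
apply: vanishD.
  by rewrite -evBl // -[d.+1]add0n; apply: ev_van => //; exact: sexp_trunc.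
rewrite ev_suml // -opprB; apply: vanishN.
have := oser_trunc ifact h (N := d) (raising_ev HP f0).
by congr (vanish _ (_ - _)); apply: eq_bigr => j _; rewrite evZl // ev_exp.
Qed.

Lemma vanish_expB m (a b : series k m) d j : vanish d (a - b) -> vanish d (a ^+ j - b ^+ j).
Proof.
move=> H; elim: j => [|j IH]; first by rewrite subrr.
have -> : a ^+ j.+1 - b ^+ j.+1 = a * (a ^+ j - b ^+ j) + (a - b) * b ^+ j.
  by rewrite !exprS mulrBr mulrBl addrA subrK.
apply: vanishD; first by rewrite -[d]add0n; apply: vanish_mul.
by rewrite -[d]addn0; apply: vanish_mul.
Qed.

Lemma sexp_inj m (a b : series k m) : a [::] = 0 -> b [::] = 0 -> sexp a = sexp b -> a = b.
Proof.
move=> a0 b0 E; apply: eq_vanish; elim=> [|d IH]; first exact: vanish0.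
case: d IH => [|d] IH; first by apply: vanish1P; rewrite addsE oppsE a0 b0 subrr.
have := @oexp_pert m _ _ 1 0 d.+1 (raising_mull a0) (raising_mull b0) _ (vanish0 (1 : series k m)).
rewrite -!sexp_oexp E subrr sub0r !mulr1 => H; rewrite -[a - b]opprK; apply/vanishN/H.
by move=> c g Hg; rewrite -mulrBl addnC; apply: vanish_mul.
Qed.
End Exponential.

(** * Exponential and logarithm in characteristic zero *)

Section CharZero.
Context (k : fieldType) (hk : [pchar k] =i pred0).

Lemma natS_neq0 n : n.+1%:R != 0 :> k.
Proof. by have /pcharf0P -> := hk. Qed.
Lemma fact_neq0 n : n`!%:R != 0 :> k.
Proof. by case: n`! (fact_gt0 n) => // m _; exact: natS_neq0. Qed.

Lemma ifactS j : j.+1%:R * ifact k j.+1 = ifact k j.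
Proof. by rewrite /ifact factS natrM invfM mulrA mulfV ?mul1r // natS_neq0. Qed.

Definition eP N : {poly k} := \sum_(j < N.+1) ifact k j *: 'X^j.
Definition lP N : {poly k} := \sum_(j < N) ((-1) ^+ j / j.+1%:R) *: 'X^(j.+1).

Lemma deriv_eP N : (eP N)^`() = eP N - ifact k N *: 'X^N.
Proof.
rewrite /eP [in LHS]big_ord_recl /= derivD linear_sum /= derivZ derivXn scaler0 add0r.
rewrite [in RHS]big_ord_recr /= addrK; apply: eq_bigr => j _.
by rewrite derivZ derivXn /= -scaler_nat scalerA mulrC ifactS.
Qed.

Lemma deriv_lP N : (1 + 'X) * (lP N)^`() = 1 - (- 'X) ^+ N.
Proof.
elim: N => [|N IH]; first by rewrite /lP big_ord0 deriv0 mulr0 expr0 subrr.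
rewrite /lP big_ord_recr /= derivD mulrDr [X in X + _]IH derivZ derivXn /=.
rewrite -scaler_nat scalerA divfK ?natS_neq0 // -mul_polyC rmorphXn rmorphN1.
rewrite -exprMn mulN1r mulrDl mul1r addrA subrK exprS mulNr opprK. by [].
Qed.

Lemma lP_divX N : exists r, lP N = 'X * r.
Proof.
exists (\sum_(j < N) ((-1) ^+ j / j.+1%:R) *: 'X^j).
by rewrite mulr_sumr; apply: eq_bigr => j _; rewrite -scalerAr -exprS.
Qed.

(** Up to a multiple of $X^N$ the composite $c$ solves $(1+X)c'=c$ with $c(0)=1$, and this
    recurrence on coefficients forces $c=1+X$ in degrees at most $N$. *)
Lemma coef_exp_log N j : (j <= N)%N -> (eP N \Po lP N)`_j = (1 + 'X : {poly k})`_j.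
Proof.
set c := eP N \Po lP N.
have [r Er] := lP_divX N.
have c0 : c`_0 = 1.
  rewrite -horner_coef0 horner_comp Er hornerM hornerX mul0r horner_coef0.
  rewrite /eP coef_sum big_ord_recl /= coefZ coefXn eqxx mulr1 big1 ?addr0.
    by rewrite /ifact fact0 invr1.
  by move=> i _; rewrite coefZ coefXn mulr0.
have [q Hq] : exists q, (1 + 'X) * c^`() = c + 'X^N * q.
  rewrite deriv_comp deriv_eP mulrCA deriv_lP comp_polyB comp_polyZ comp_Xn_poly.
  rewrite Er exprMn exprNn.
  exists (- (ifact k N *: r ^+ N) - c * (-1) ^+ N + ifact k N *: r ^+ N * ('X^N * (-1) ^+ N)).
  rewrite -/c -mul_polyC -Er -/c -!mul_polyC; ring.
have R i : (i < N)%N -> c`_i.+1 *+ i.+1 + c`_i *+ i = c`_i.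
  move=> iN; have := congr1 (fun p : {poly k} => p`_i) Hq; rewrite [in RHS]coefD coefXnM iN addr0 => E.
  rewrite -[RHS]E mulrDl mul1r coefD coef_deriv; congr (_ + _).
  by case: i {iN E} => [|i]; rewrite coefXM ?coef_deriv.
elim: j => [|j IH] jN; first by rewrite c0 coefD coef1 coefX addr0.
have := R j jN; rewrite IH; last exact: ltnW.
rewrite !coefD !coef1 !coefX.
case: j IH jN => [|[|j]] IH jN /=; rewrite ?addr0 ?add0r ?mul0rn ?mulr0n ?mulr1n ?addr0.
- by [].
- rewrite -[X in _ = X -> _]add0r => /addIr /eqP.
  by rewrite -mulr_natr mulf_eq0 (negPf (natS_neq0 _)) orbF => /eqP.
- by move=> /eqP; rewrite -mulr_natr mulf_eq0 (negPf (natS_neq0 _)) orbF => /eqP.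
Qed.

Lemma horner_alg_vanish m (t : series k m) (p : {poly k}) N : t [::] = 0 ->
  (forall i, (i <= N)%N -> p`_i = 0) -> vanish N.+1 (horner_alg t p).
Proof.
move=> t0 Hp; rewrite -[p]coefK poly_def linear_sum; apply: vanish_sum => i _ /=.
rewrite linearZ /= mulr_algl rmorphXn /= horner_algX.
case: (leqP i N) => iN; first by rewrite Hp // scale0r; exact: vanish_0.
by apply/vanishZ/(vanishW iN)/vanish_exp/vanish1P.
Qed.

Lemma slog_nil m (g : series k m) : slog g [::] = 0.
Proof. by rewrite /slog big_ord0. Qed.

(** The polynomial identity is transported along [horner_alg t] with $t=g-1$; as $t$ has no constant
    term, polynomials agreeing up to degree $N$ give series agreeing up to degree $N$. *)
Lemma sexp_slog m (g : series k m) : g [::] = 1 -> sexp (slog g) = g.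
Proof.
move=> g1; set t : series k m := g - 1.
have t0 : t [::] = 0 by rewrite /t addsE oppsE g1 one_nil subrr.
apply: eq_vanish => N; apply: (vanishW (leqnSn N)).
set L := slog g.
have HL : vanish N.+1 (L - horner_alg t (lP N)).
  move=> w wN; rewrite addsE oppsE /L /slog linear_sum sumsE /=.
  rewrite (big_ord_widen N (fun j => (-1) ^+ j * spow (ssub g (@sone k m)) j.+1 w / j.+1%:R)) //.
  rewrite big_mkcond /= -sumrB big1 // => j _.
  rewrite linearZ /= mulr_algl rmorphXn /= horner_algX scalesE spowE -[ssub _ _]/t.
  case: ifP => [_|/negbT]; first by rewrite mulrAC exprS; apply: subrr.
  by rewrite -leqNgt => wj; rewrite (vanish_exp (d := j.+1) (vanish1P t0)) ?mulr0 ?subrr.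
have := sexp_trunc (f := L) (N := N) (slog_nil g).
set S := \sum_(j < _) _ => HS.
rewrite -[sexp L](subrK S) -addrA; apply: vanishD => //.
rewrite -[S](subrK (horner_alg t (eP N \Po lP N))) -addrA; apply: vanishD.
  rewrite /eP linear_sum [horner_alg t _]linear_sum /= -sumrB; apply: vanish_sum => j _.
  rewrite linearZ /= comp_Xn_poly linearZ /= mulr_algl rmorphXn /= -scalerBr; apply: vanishZ.
  exact: vanish_expB.
have -> : g = horner_alg t (1 + 'X).
  by rewrite rmorphD rmorph1 /= horner_algX addrC subrK.
rewrite -rmorphB; apply: horner_alg_vanish => // i iN.
by rewrite coefB coef_exp_log // subrr.
Qed.
End CharZero.

(** * Lie series and the Campbell-Hausdorff series *)

Section LieSeries.
Context (k : fieldType).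
Section Closure.
Context (n : nat).
Implicit Types f g h : series k n.

Definition br f g := f * g - g * f.

Lemma lie_polyD f g : lie_poly f -> lie_poly g -> lie_poly (f + g).
Proof. exact: LPadd. Qed.
Lemma lie_polyZ a f : lie_poly f -> lie_poly (a *: f).
Proof. exact: LPscale. Qed.
Lemma lie_poly0 : lie_poly (0 : series k n).
Proof. exact: LP0. Qed.
Lemma lie_poly_br f g : lie_poly f -> lie_poly g -> lie_poly (br f g).
Proof. exact: LPbr. Qed.
Lemma lie_poly_sum I (r : seq I) (P : pred I) (F : I -> series k n) :
  (forall i, P i -> lie_poly (F i)) -> lie_poly (\sum_(i <- r | P i) F i).
Proof.
by move=> H; elim/big_rec: _ => [|i x Pi Hx]; [exact: lie_poly0 | apply/lie_polyD/Hx/H].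
Qed.

Lemma lie_poly_ind' (Q : series k n -> Prop) :
  Q 0 -> (forall i, Q (var i)) ->
  (forall f g, lie_poly f -> lie_poly g -> Q f -> Q g -> Q (f + g)) ->
  (forall a f, lie_poly f -> Q f -> Q (a *: f)) ->
  (forall f g, lie_poly f -> lie_poly g -> Q f -> Q g -> Q (br f g)) ->
  forall f, lie_poly f -> Q f.
Proof.
move=> H0 Hx HD HZ Hbr f; elim=> {f}.
- exact: H0.
- exact: Hx.
- by move=> f g Lf Qf Lg Qg; apply: HD.
- by move=> a f Lf Qf; apply: HZ.
- by move=> f g Lf Qf Lg Qg; apply: Hbr.
- by move=> f g _ Qf /funext <-.
Qed.

Lemma shomD d f g : shom d (f + g) = shom d f + shom d g.
Proof. by apply/funext=> w; rewrite /shom !addsE; case: eqP; rewrite ?addr0. Qed.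
Lemma shomZ d a f : shom d (a *: f) = a *: shom d f.
Proof. by apply/funext=> w; rewrite /shom !scalesE; case: eqP; rewrite ?mulr0. Qed.
Lemma shomN d f : shom d (- f) = - shom d f.
Proof. by rewrite -scaleN1r shomZ scaleN1r. Qed.
Lemma shomB d f g : shom d (f - g) = shom d f - shom d g.
Proof. by rewrite shomD shomN. Qed.
Lemma shom0 d : shom d (0 : series k n) = 0.
Proof. by apply/funext=> w; rewrite /shom; case: eqP. Qed.
Lemma shom_sum d I (r : seq I) (P : pred I) (F : I -> series k n) :
  shom d (\sum_(i <- r | P i) F i) = \sum_(i <- r | P i) shom d (F i).
Proof. by elim/big_rec2: _ => [|i x y _ <-]; rewrite ?shom0 ?shomD. Qed.
Lemma shom_van d f : vanish d.+1 f -> shom d f = 0.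
Proof. by move=> H; apply/funext=> w; rewrite /shom; case: eqP => // E; apply: H; rewrite E. Qed.
Lemma eq_shom d f g : vanish d.+1 (f - g) -> shom d f = shom d g.
Proof. by move=> /shom_van /eqP; rewrite shomB subr_eq0 => /eqP. Qed.
Lemma shom_shom d e f : shom d (shom e f) = if d == e then shom d f else 0.
Proof.
apply/funext=> w; rewrite /shom; case: (size w =P d) => [<-|E]; first by case: (_ == e); rewrite ?eqxx.
by case: (d == e) => //; case: eqP E.
Qed.

Lemma mul_shom i j f g w :
  (shom i f * shom j g) w = if size w == (i + j)%N then f (take i w) * g (drop i w) else 0.
Proof.
rewrite [LHS]/(smul _ _ w) /smul; case: ifP => [/eqP E|/eqP E].
  have iw : (i < (size w).+1)%N by rewrite E ltnS leq_addr.
  rewrite (bigD1 (Ordinal iw)) //= big1 ?addr0 => [|[l lw] /= /eqP H].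
    by rewrite /shom size_takel // size_drop E addKn !eqxx.
  rewrite /shom size_takel //; case: eqP => [li|]; last by rewrite mul0r.
  by case: H; apply: ord_inj.
rewrite big1 // => -[l lw] _ /=; rewrite /shom size_takel // size_drop.
case: eqP => [li|]; last by rewrite mul0r.
by case: eqP => [lj|]; rewrite ?mulr0 //; case: E; rewrite -li -lj subnKC.
Qed.

Lemma shom_mul d f g : shom d (f * g) = \sum_(i < d.+1) shom i f * shom (d - i) g.
Proof.
apply/funext=> w; rewrite sumsE {1}/shom; case: eqP => [<-|E].
  by apply: eq_bigr => -[i iw] _ /=; rewrite mul_shom subnKC // eqxx.
by rewrite big1 // => -[i iw] _ /=; rewrite mul_shom subnKC //; case: eqP.
Qed.

Lemma lie_seriesD f g : lie_series f -> lie_series g -> lie_series (f + g).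
Proof. by move=> Hf Hg d; rewrite shomD; apply: lie_polyD. Qed.
Lemma lie_seriesZ a f : lie_series f -> lie_series (a *: f).
Proof. by move=> Hf d; rewrite shomZ; apply: lie_polyZ. Qed.
Lemma lie_seriesN f : lie_series f -> lie_series (- f).
Proof. by rewrite -scaleN1r; apply: lie_seriesZ. Qed.
Lemma lie_seriesB f g : lie_series f -> lie_series g -> lie_series (f - g).
Proof. by move=> Hf Hg; apply/lie_seriesD/lie_seriesN. Qed.
Lemma lie_series0 : lie_series (0 : series k n).
Proof. by move=> d; rewrite shom0; apply: lie_poly0. Qed.
Lemma lie_series_sum I (r : seq I) (P : pred I) (F : I -> series k n) :
  (forall i, P i -> lie_series (F i)) -> lie_series (\sum_(i <- r | P i) F i).
Proof. by move=> H d; rewrite shom_sum; apply: lie_poly_sum => i /H. Qed.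
Lemma lie_series_var i : lie_series (var i : series k n).
Proof.
move=> d; case: (d =P 1%N) => [->|d1].
  suff -> : shom 1 (var i) = var i :> series k n by exact: LPx.
  apply/funext=> w; rewrite /shom; case: eqP => // w1; case: w w1 => [|j [|l w]] // _.
  by rewrite /var /xvar eqseq_cons andbF.
suff -> : shom d (var i) = 0 :> series k n by exact: lie_poly0.
apply/funext=> w; rewrite /shom; case: eqP => // wd; case: w wd => [|j [|l w]] // E; first by case: d1.
by rewrite /var /xvar eqseq_cons andbF.
Qed.
Lemma lie_series_br f g : lie_series f -> lie_series g -> lie_series (br f g).
Proof.
move=> Hf Hg d; rewrite shomB !shom_mul [X in _ - X](reindex_inj rev_ord_inj) -sumrB.
apply: lie_poly_sum => -[i id] _ /=; rewrite subSS subKn //.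
exact: lie_poly_br.
Qed.
Lemma lie_poly_series f : lie_poly f -> lie_series f.
Proof.
elim/lie_poly_ind' => [|i|f' g _ _|a f' _|f' g _ _].
- exact: lie_series0.
- exact: lie_series_var.
- exact: lie_seriesD.
- exact: lie_seriesZ.
- exact: lie_series_br.
Qed.

Lemma lie_series_trunc f N : lie_series f -> lie_poly (\sum_(i < N) shom i f).
Proof. by move=> Hf; apply: lie_poly_sum => i _; apply: Hf. Qed.
Lemma lie_series_eq f :
  (forall d, exists2 g, lie_series g & vanish d.+1 (f - g)) -> lie_series f.
Proof. by move=> H d; case: (H d) => g Lg /eq_shom ->. Qed.

Lemma lie_nil f : lie_series f -> f [::] = 0.
Proof.
move=> /(_ 0%N) H; suff: forall g, lie_poly g -> g [::] = 0 by move=> /(_ _ H).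
apply: lie_poly_ind' => [//|//|g h _ _|a g _|g h _ _].
- by rewrite addsE => -> ->; rewrite addr0.
- by rewrite scalesE => ->; rewrite mulr0.
- by rewrite /br addsE oppsE !mul_nil => -> ->; rewrite !mul0r subrr.
Qed.

Lemma lie_van f : lie_series f -> vanish 1 f.
Proof. by move=> /lie_nil; apply: vanish1P. Qed.
End Closure.

(** * Derivatives of exponentials, and logarithms that are Lie series *)

Section ExpDerivation.
Context (n : nat) (hk : [pchar k] =i pred0).
Implicit Types f g h L : series k n.

Lemma triangle_sum (F : nat -> nat -> series k n) M :
  \sum_(m < M) \sum_(i < m.+1) F i (m - i)%N = \sum_(i < M) \sum_(j < M - i) F i j.
Proof.
elim: M => [|M IH]; first by rewrite !big_ord0.
rewrite big_ord_recr /= IH [in RHS]big_ord_recr /= subSnn big_ord1.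
rewrite [X in _ + X]big_ord_recr /= subnn addrA -big_split /=; congr (_ + _).
by apply: eq_bigr => -[i iM] _ /=; rewrite subSn 1?ltnW // big_ord_recr.
Qed.

(** Cauchy product: the terms in the square but outside the triangle have $i+j>N$. *)
Lemma triangle_square (F : nat -> nat -> series k n) N :
  (forall i j, vanish (i + j) (F i j)) ->
  vanish N.+1 (\sum_(m < N.+1) \sum_(i < m.+1) F i (m - i)%N
               - \sum_(i < N.+1) \sum_(j < N.+1) F i j).
Proof.
move=> HF; rewrite triangle_sum -sumrB; apply: vanish_sum => i _ w wN.
rewrite addsE oppsE !sumsE (big_ord_widen N.+1 (fun j => F i j w)) ?leq_subr //.
rewrite big_mkcond -sumrB big1 // => j _; case: ifP => [_|/negbT]; first by rewrite subrr.
by rewrite -leqNgt => H; rewrite HF ?subrr //; lia.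
Qed.

(** The bracket is taken on the right, $f\mapsto[f,L]$: the sign that suits formulas with $e^L$ on
    the left. *)
Definition adr L f := f * L - L * f.
Lemma raising_adr L : L [::] = 0 -> raising (adr L).
Proof.
move=> L0; split=> [a f g|d f Hf].
  by rewrite /adr mulrDl mulrDr -scalerAl -scalerAr opprD addrACA -scalerBr.
apply: vanishB; last by rewrite -add1n; apply: vanish_mul => //; apply: vanish1P.
by rewrite -addn1; apply: vanish_mul => //; apply: vanish1P.
Qed.

(** The coefficients of $(e^t-1)/t$. *)
Definition iphi (j : nat) : k := ifact k j.+1.

Record derivation (D : series k n -> series k n) : Prop := Derivation {
  der_lin : linear D;
  der_leib : forall f g, D (f * g) = D f * g + f * D g;
  der_vanish : forall d f, vanish d f -> vanish d (D f) }.

Lemma ifact_bin N i : (i <= N)%N -> ifact k N * 'C(N, i)%:R = ifact k i * ifact k (N - i).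
Proof.
move=> iN; have := fact_neq0 hk N; rewrite /ifact -(bin_fact iN) !natrM !mulf_eq0 !negb_or.
by case/andP=> C0 _; rewrite !invfM mulrAC mulVf // mul1r.
Qed.

Section WithD.
Context (D : series k n -> series k n) (HD : derivation D).
Lemma derD f g : D (f + g) = D f + D g.
Proof. by have := der_lin HD 1 f g; rewrite !scale1r. Qed.
Lemma der_zero : D 0 = 0.
Proof. by apply: (addrI (D 0)); rewrite -derD !addr0. Qed.
Lemma derZ a f : D (a *: f) = a *: D f.
Proof. by have := der_lin HD a f 0; rewrite der_zero !addr0. Qed.
Lemma der_sum I (r : seq I) (P : pred I) (F : I -> series k n) :
  D (\sum_(i <- r | P i) F i) = \sum_(i <- r | P i) D (F i).
Proof. by elim/big_rec2: _ => [|i x y _ <-]; rewrite ?der_zero ?derD. Qed.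
Lemma der_one : D 1 = 0.
Proof.
by apply: (addrI (D 1)); rewrite addr0 -[in RHS](mul1r 1) (der_leib HD) mul1r mulr1.
Qed.

(** Each [D L] is carried to the right of all factors [L]; passing one of them adds a term with the
    next iterate of [adr L], and Pascal's rule counts the outcomes. *)
Lemma der_power L m :
  D (L ^+ m.+1) = \sum_(i < m.+1) (L ^+ i * iter (m - i) (adr L) (D L)) *+ 'C(m.+1, i).
Proof.
elim: m => [|m IH]; first by rewrite big_ord1 expr0 mul1r expr1 bin0.
set a := fun j => iter j (adr L) (D L).
have aL j : a j * L = L * a j + a j.+1 by rewrite /a iterS /adr addrC subrK.
rewrite exprSr (der_leib HD) IH mulr_suml.
rewrite (eq_bigr (fun i : 'I_m.+1 => (L ^+ i.+1 * a (m - i)%N) *+ 'C(m.+1, i)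
   + (L ^+ i * a (m.+1 - i)%N) *+ 'C(m.+1, i))); last first.
  move=> [i im] _ /=; rewrite mulrnAl -mulrnDl; congr (_ *+ _).
  by rewrite -mulrA aL mulrDr mulrA -exprSr subSn.
rewrite big_split /= -addrA.
transitivity (\sum_(i < m.+2) ((L ^+ i * a (m.+1 - i)%N) *+ 'C(m.+1, i)
    + if (i : nat) is i'.+1 then (L ^+ i * a (m.+1 - i)%N) *+ 'C(m.+1, i') else 0)).
  rewrite big_split /= addrC; congr (_ + _).
    by rewrite [RHS]big_ord_recr /= subnn binn mulr1n.
  by rewrite [RHS]big_ord_recl add0r; apply: eq_bigr => i _; rewrite lift0 subSS.
apply: eq_bigr => -[[|i] im] _ /=; first by rewrite !bin0 addr0.
by rewrite -mulrnDr binS.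
Qed.

Lemma der_sexp L : L [::] = 0 ->
  D (sexp L) = sexp L * oser iphi (adr L) (D L).
Proof.
move=> L0; apply: eq_vanish => N; apply: (vanishW (leqnSn N)).
set E := \sum_(j < N.+2) ifact k j *: L ^+ j.
have HE : vanish N.+2 (sexp L - E) by exact: sexp_trunc.
have DL1 : vanish 1 (D L) by apply: der_vanish => //; apply: vanish1P.
have -> : sexp L = (sexp L - E) + E by rewrite subrK.
rewrite derD [in X in _ - X]subrK -addrA; apply: vanishD.
  by apply: der_vanish => //; exact: vanishW HE.
set W := oser _ _ _.
set G := fun i j : nat => (ifact k i * iphi j) *: (L ^+ i * iter j (adr L) (D L)).
(* [ifact_bin] turns $\binom{m+1}{i}/(m+1)!$ into $1/i!$ times $1/(m-i+1)!$, which makes the double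
   sum a Cauchy product. *)
have -> : D E = \sum_(m < N.+1) \sum_(i < m.+1) G i (m - i)%N.
  rewrite der_sum big_ord_recl derZ der_one scaler0 add0r; apply: eq_bigr => -[m mN] _.
  rewrite lift0 derZ der_power scaler_sumr; apply: eq_bigr => -[i im] _.
  by rewrite -scaler_nat scalerA /G /= /iphi -subSn // ifact_bin // ltnW.
set S := \sum_(m < _) _.
rewrite -[S](subrK (\sum_(i < N.+1) \sum_(j < N.+1) G i j)) -addrA; apply: vanishD.
  apply: triangle_square => i j; apply/vanishZ/vanish_mul; first exact/vanish_exp/vanish1P.
  by have := rais_iter (raising_adr L0) (j := j) DL1; apply: vanishW; lia.
have -> : \sum_(i < N.+1) \sum_(j < N.+1) G i j
  = (\sum_(i < N.+1) ifact k i *: L ^+ i) * (\sum_(j < N.+1) iphi j *: iter j (adr L) (D L)).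
  rewrite mulr_suml; apply: eq_bigr => i _; rewrite mulr_sumr; apply: eq_bigr => j _.
  by rewrite -scalerAl -scalerAr scalerA.
set E' := \sum_(i < _) _; set W' := \sum_(j < _) _.
have -> : E' * W' - sexp L * W = - ((sexp L - E') * W + E' * (W - W')).
  by rewrite mulrBl mulrBr addrA subrK opprB.
apply: vanishN; apply: vanishD.
  by rewrite -[N.+1]addn0; apply: vanish_mul => //; apply: sexp_trunc.
by rewrite -[N.+1]add0n; apply: vanish_mul => //; apply/oser_trunc/raising_adr.
Qed.
End WithD.

Lemma lie_oser c L b : L [::] = 0 -> lie_series L -> lie_series b ->
  lie_series (oser c (adr L) b).
Proof.
move=> L0 HL Hb; apply: lie_series_eq => d.
exists (\sum_(j < d.+1) c j *: iter j (adr L) b); last exact/oser_trunc/raising_adr.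
apply: lie_series_sum => j _; apply: lie_seriesZ.
by elim: (j : nat) => //= i IH; apply: lie_series_br.
Qed.

Lemma oser_id c (P : series k n -> series k n) h : raising P -> P h = 0 ->
  oser c P h = c 0%N *: h.
Proof.
move=> HP H; apply/funext=> w; rewrite /oser big_ord_recl big1 ?addr0 // => j _.
rewrite lift0 iterSr H (_ : iter j P 0 = 0) ?mulr0 //.
by elim: (j : nat) => //= i ->; exact: rais0.
Qed.

Definition euler f : series k n := fun w => (size w)%:R * f w.
Lemma euler_der : derivation euler.
Proof.
split.
- by move=> a f g; apply/funext=> w; rewrite /euler !(addsE, scalesE); ring.
- move=> f g; apply/funext=> w; rewrite /euler addsE [(f * g) w]/(smul f g w).
  rewrite [X in _ = X + _]/(smul _ g w) [X in _ = _ + X]/(smul f _ w) /smul.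
  rewrite -big_split mulr_sumr; apply: eq_bigr => -[i iw] _ /=.
  by rewrite size_takel // size_drop natrB //; ring.
- by move=> d f Hf w wd; rewrite /euler Hf ?mulr0.
Qed.
Lemma br_der z : derivation (br z).
Proof.
split.
- by move=> a f g; rewrite /br mulrDl mulrDr -scalerAl -scalerAr opprD addrACA -scalerBr.
- by move=> f g; rewrite /br mulrBl mulrBr !mulrA addrA subrK.
- move=> d f Hf; apply: vanishB; first by rewrite -[d]add0n; apply: vanish_mul.
  by rewrite -[d]addn0; apply: vanish_mul.
Qed.

Lemma mull_inj g : g [::] = 1 -> injective (GRing.mul g).
Proof.
move=> g1 a b E; apply: eq_vanish; elim=> [|d IH]; first exact: vanish0.
have -> : a - b = (1 - g) * (a - b).
  by rewrite mulrBl mul1r mulrBr E subrr subr0.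
rewrite -add1n; apply: vanish_mul => //; apply: vanish1P.
by rewrite addsE oppsE g1 subrr.
Qed.

(* For any derivation [D], [D(e^L) = e^L Q] with [Q] the sum of the
   [(ad L)^j(D L) / (j+1)!]; for [D] the Euler derivation the leading term of
   [Q] in each degree is a multiple of that of [L]. *)
Lemma lie_log_der L : L [::] = 0 ->
  lie_series (oser iphi (adr L) (euler L)) -> lie_series L.
Proof.
move=> L0 HQ d; elim/ltn_ind: d => -[|d] IH.
  by rewrite shom_van; [exact: lie_poly0 | exact: vanish1P].
set L' := \sum_(i < d.+1) shom i L.
have LL' : vanish d.+1 (L - L').
  by move=> w wd; rewrite addsE oppsE /L' sum_shom // subrr.
have HL' : lie_series L'.
  by apply/lie_poly_series/lie_poly_sum => -[i id] _; apply: IH.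
have L'0 : L' [::] = 0 by rewrite -(vanish_eq LL').
have HD := euler_der.
have DD : vanish d.+1 (euler L - euler L').
  have -> : euler L - euler L' = euler (L - L') by rewrite (derD HD) -[in RHS]scaleN1r (derZ HD) scaleN1r.
  exact: der_vanish.
have HDL : lie_series (euler L').
  move=> e; have -> : shom e (euler L') = e%:R *: shom e L'.
    by apply/funext=> w; rewrite scalesE /shom /euler; case: eqP => [->|]; rewrite ?mulr0.
  exact/lie_polyZ/HL'.
have A j : vanish d.+1 (iter j (adr L) (euler L) - iter j (adr L') (euler L')).
  elim: j => [//|j IHj] /=; apply: (vanishW (leqnSn _)).
  set a := iter j _ _ in IHj *; set a' := iter j _ _ in IHj *.
  have a'1 : vanish 1 a'.
    have D1 : vanish 1 (euler L') by apply: der_vanish => //; apply: vanish1P.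
    by have := rais_iter (raising_adr L'0) (j := j) D1; apply: vanishW.
  have -> : adr L a - adr L' a' = adr L (a - a') + br a' (L - L').
    by rewrite /adr /br !(mulrBl, mulrBr); sring.
  apply: vanishD; first exact: (rais_van (raising_adr L0)).
  apply: vanishB; first by rewrite -add1n; apply: vanish_mul.
  by rewrite -addn1; apply: vanish_mul.
(* The terms with $j\ge1$ contain a bracket with [L], so replacing [L] by [L'] in them is not seen
   below degree [d.+2]; what the replacement changes in degree [d.+1] is the Euler term alone. *)
have B : vanish d.+2 (oser iphi (adr L) (euler L) - euler L - (oser iphi (adr L') (euler L') - euler L')).
  move=> w wd; rewrite !(addsE, oppsE) /oser big_ord_recl [X in _ - (X - _)]big_ord_recl.
  rewrite /= /iphi /ifact invr1 !mul1r.
  rewrite [X in X - _]addrAC subrr add0r [X in _ - X]addrAC subrr add0r -sumrB big1 // => j _.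
  rewrite -mulrBr (_ : _ - _ = 0) ?mulr0 //.
  set a := iter j _ _; set a' := iter j _ _.
  have a'1 : vanish 1 a'.
    have D1 : vanish 1 (euler L') by apply: der_vanish => //; apply: vanish1P.
    by have := rais_iter (raising_adr L'0) (j := j) D1; apply: vanishW.
  have := A j; rewrite -/a -/a' => Aj.
  have -> : adr L a w - adr L' a' w = (adr L (a - a') + br a' (L - L')) w.
    rewrite -oppsE -addsE; congr (_ w); rewrite /adr /br !(mulrBl, mulrBr); sring.
  apply: (vanishD (d := d.+2)) => //; first exact: (rais_van (raising_adr L0)).
  apply: vanishB; first by rewrite -add1n; apply: vanish_mul.
  by rewrite -addn1; apply: vanish_mul.
have E : shom d.+1 (euler L) = shom d.+1 (oser iphi (adr L) (euler L)) - shom d.+1 (oser iphi (adr L') (euler L') - euler L').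
  rewrite -(eq_shom B) -shomB; congr (shom _ _); sring.
have -> : shom d.+1 L = d.+1%:R^-1 *: shom d.+1 (euler L).
  apply/funext=> w; rewrite scalesE /shom /euler; case: eqP => [->|]; rewrite ?mulr0 //.
  by rewrite mulKf // natS_neq0.
apply: lie_polyZ; rewrite E -shomB; apply: lie_seriesB => //.
by apply: lie_seriesB => //; apply: lie_oser.
Qed.
End ExpDerivation.

(** * The Campbell-Hausdorff series *)

Section CampbellHausdorff.
Context (hk : [pchar k] =i pred0).

Lemma sexp_ch : sexp (ch k) = sexp (var vx) * sexp (var vy).
Proof. by rewrite /ch sexp_slog // smul_nil !sexp_nil mulr1. Qed.
Lemma ch_nil : ch k [::] = 0.
Proof. exact: slog_nil. Qed.

(** For the Euler derivation $E$, $E(e^xe^y)=e^xe^y(e^{-y}xe^y+y)$, and $e^{-y}xe^y$ is a Lie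
    series; [lie_log_der] then applies. *)
Lemma lie_ch : lie_series (ch k).
Proof.
apply: lie_log_der => //; first exact: ch_nil.
set X : series k 2 := var vx; set Y : series k 2 := var vy.
have eX i : euler (var i) = var i :> series k 2.
  apply/funext=> -[|j [|l w]]; rewrite /euler ?mul0r ?mul1r //.
  by rewrite /var /xvar eqseq_cons andbF mulr0.
(* [R] is $e^{-y}xe^y-x$, obtained from [der_sexp] with the inner derivation $[x,\cdot]$. *)
set R := oser iphi (adr Y) (br X Y).
have LR : lie_series R by apply: lie_oser => //; try apply: lie_series_br; apply: lie_series_var.
have HR : X * sexp Y = sexp Y * (X + R).
  by rewrite mulrDr -(der_sexp hk (br_der X)) // /br addrC subrK.
have HX : euler (sexp X) = sexp X * X.
  rewrite (der_sexp hk (@euler_der 2)) // eX oser_id; [|exact: raising_adr|by rewrite /adr subrr].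
  by rewrite /iphi /ifact factS fact0 muln1 invr1 scale1r.
have HY : euler (sexp Y) = sexp Y * Y.
  rewrite (der_sexp hk (@euler_der 2)) // eX oser_id; [|exact: raising_adr|by rewrite /adr subrr].
  by rewrite /iphi /ifact factS fact0 muln1 invr1 scale1r.
suff -> : oser iphi (adr (ch k)) (euler (ch k)) = X + R + Y.
  by do 2?apply: lie_seriesD => //; apply: lie_series_var.
apply: (@mull_inj _ (sexp (ch k))); first exact: sexp_nil.
rewrite -(der_sexp hk (@euler_der 2)) ?ch_nil // sexp_ch (der_leib (@euler_der 2)) HX HY.
by rewrite -!mulrA HR -!mulrDr.
Qed.

Lemma ch1 i : ch k [:: i] = 1.
Proof.
have := congr1 (fun f => f [:: i]) sexp_ch.
rewrite mul_cons mul_nil !sexp_nil.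
have sexp1 (f : series k 2) j : sexp f [:: j] = f [:: j].
  rewrite /sexp big_ord_recl big_ord1 /= mul0r add0r factS fact0 muln1 divr1 smul_cons.
  by rewrite [sone _ _]/(0) mulr0 add0r smul_nil mulr1.
rewrite mulr1 mul1r /lq !sexp1 => ->; rewrite /var /xvar !eqseq_cons !andbT.
by case: i => -[|[|//]] H; rewrite -!val_eqE /= !inordK //= ?addr0 ?add0r.
Qed.

Lemma ch2 i j : ch k [:: i; j] = ((i < j)%N%:R - (j < i)%N%:R) / 2%:R.
Proof.
have := congr1 (fun f => f [:: i; j]) sexp_ch.
have sexp2 (f : series k 2) a b : f [::] = 0 -> sexp f [:: a; b] = f [:: a; b] + f [:: a] * f [:: b] / 2%:R.
  move=> f0; rewrite /sexp !big_ord_recl big_ord0 /= !addr0 mul0r add0r.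
  by rewrite !smul_cons !smul_nil f0 /lq /sone /= !(mul0r, mulr0, mulr1, add0r, addr0) factS fact0 muln1 divr1.
rewrite !mul_cons mul_nil !sexp_nil !sexp2 ?ch_nil // !ch1.
have sexp1 (f : series k 2) a : sexp f [:: a] = f [:: a].
  rewrite /sexp big_ord_recl big_ord1 /= mul0r add0r factS fact0 muln1 divr1 smul_cons.
  by rewrite [sone _ _]/(0) mulr0 add0r smul_nil mulr1.
rewrite /lq !sexp1 !sexp2 // /var /xvar !eqseq_cons !andbT !andbF.
have h2 : 2%:R != 0 :> k by exact: (natS_neq0 hk 1).
move=> /(canRL (addrK _)) ->.
case: i => -[|[|//]] Hi; case: j => -[|[|//]] Hj; rewrite -!val_eqE /= !inordK //=; by field.
Qed.
End CampbellHausdorff.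
End LieSeries.

(** * Tangential derivations and their group *)

Section Derivations.
Context (k : fieldType).
Section Fixed.
Context (n : nat).
Implicit Types (f g h : series k n) (u v : tder_el k n).

Definition nilfree u := forall i, u i [::] = 0.

Lemma take_belast T (c : T) w l : (l <= size w)%N -> take l (c :: w) = belast c (take l w).
Proof.
by elim: w c l => [|d w IH] c [|l] //= lw; rewrite -IH.
Qed.
Lemma drop_last T (c : T) w l : (l <= size w)%N ->
  drop l (c :: w) = last c (take l w) :: drop l w.
Proof. by elim: w c l => [|d w IH] c [|l] //= lw; rewrite -IH. Qed.

Lemma der_nil u f : der u f [::] = 0.
Proof. by rewrite /der big_ord0. Qed.

(** Splittings of [c :: w] with a nonempty prefix give [der] of the quotient; those with an empty
    prefix give the two halves of the brackets $[x_i,u_i]$ put in front. *)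
Lemma der_cons u f c w : nilfree u ->
  der u f (c :: w) = der u (lq c f) w + (u c * lq c f) w
   - \sum_i (u i * (var i * lq i f)) (c :: w).
Proof.
move=> u0; rewrite {1}/der big_ord_recl addrC -addrA; congr (_ + _).
  apply: eq_bigr => i _; rewrite /= big_mkcond big_ord_recl /= add0r.
  by rewrite [RHS]big_mkcond; apply: eq_bigr.
rewrite big_mkcond big_ord_recl /= add0r big_ord_recl /= add0r.
have -> : (u c * lq c f) w = \sum_(l < size w) f (c :: drop l.+1 w) * u c (take l.+1 w).
  rewrite [LHS]/(smul _ _ w) /smul big_ord_recl take0 u0 mul0r add0r.
  by apply: eq_bigr => l _; rewrite mulrC.
have -> : \sum_i (u i * (var i * lq i f)) (c :: w) =
    \sum_(l < size w) f (last c (take l.+1 w) :: drop l.+1 w)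
       * u (last c (take l.+1 w)) (belast c (take l.+1 w)).
  transitivity (\sum_i \sum_(l < size w) u i (belast c (take l.+1 w)) *
        ((last c (take l.+1 w) == i)%:R * f (i :: drop l.+1 w))).
    apply: eq_bigr => i _; rewrite [LHS]/(smul _ _ (c :: w)) /smul big_ord_recl take0 u0 mul0r add0r.
    rewrite big_ord_recr /= drop_size mul_nil var_nil mul0r mulr0 addr0.
    apply: eq_bigr => l _; rewrite -[c :: take l w]/(take l.+1 (c :: w)) -[drop l w]/(drop l.+1 (c :: w)) take_belast // drop_last // mul_cons var_nil mul0r add0r.
    by rewrite lq_var; case: (_ == i); rewrite ?mul1r ?mul0r.
  rewrite exchange_big; apply: eq_bigr => l _; rewrite (bigD1 (last c (take l.+1 w))) //= eqxx mul1r.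
  rewrite big1 ?addr0 => [|i]; first exact: mulrC.
  by rewrite eq_sym => /negPf ->; rewrite mul0r mulr0.
by rewrite -sumrB; apply: eq_bigr.
Qed.

Lemma der_rec u f : nilfree u ->
  der u f = \sum_i (br (var i) (u i) * lq i f + var i * der u (lq i f)).
Proof.
move=> u0; apply/funext=> -[|c w].
  rewrite der_nil sumsE big1 // => i _.
  by rewrite addsE !mul_nil /br addsE oppsE !mul_nil u0 var_nil !(mulr0, mul0r, subrr, addr0).
rewrite der_cons // sumsE.
transitivity (\sum_i ((c == i)%:R * (der u (lq i f) w + (u i * lq i f) w) - (u i * (var i * lq i f)) (c :: w))).
  rewrite sumrB; congr (_ - _); rewrite (bigD1 c) //= eqxx mul1r big1 ?addr0 // => i.
  by rewrite eq_sym => /negPf ->; rewrite mul0r.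
apply: eq_bigr => i _; rewrite addsE /br mulrBl -!mulrA addsE oppsE.
rewrite !(mul_cons (var i)) var_nil !mul0r !add0r lq_var.
case: (c == i); rewrite ?mul1r ?mul0r /= ?zerosE; last by rewrite add0r addr0.
by rewrite [der u _ w + _]addrC addrAC.
Qed.

Lemma linear_der u : linear (der u).
Proof.
move=> a f g; apply/funext=> w; rewrite addsE scalesE /der mulr_sumr -big_split.
apply: eq_bigr => i _; rewrite /= mulr_sumr -big_split; apply: eq_bigr => j _ /=.
case: (drop i (take j w)) => [|c t]; first by rewrite mulr0 addr0.
by rewrite !(addsE, scalesE); ring.
Qed.

Lemma br_van d e f g : vanish d f -> vanish e g -> vanish (d + e) (br f g).
Proof. by move=> Hf Hg; apply: vanishB; [|rewrite addnC]; apply: vanish_mul. Qed.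

Lemma der_van u f d e : nilfree u -> (forall i, vanish e.+1 (u i)) ->
  vanish d f -> vanish (d + e.+1) (der u f).
Proof.
move=> u0 ue; elim: d f => [|d IH] f Hf.
  suff H c : (c <= e.+1)%N -> forall f', vanish c (der u f') by apply: H.
  clear f Hf.
  elim: c => [|c IHc] ce f'; first exact: vanish0.
  rewrite der_rec //; apply: vanish_sum => i _; apply: vanishD.
    apply: (vanishW ce); rewrite -[e.+1]addn0; apply: vanish_mul => //.
    by apply: (@vanishW _ _ _ (1 + e.+1)) => //; apply: br_van => //; apply: vanish_var.
  by rewrite -add1n; apply: vanish_mul; [exact: vanish_var | apply/IHc/ltnW].
rewrite der_rec //; apply: vanish_sum => i _; apply: vanishD.
  have -> : (d.+1 + e.+1 = (1 + e.+1) + d)%N by lia.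
  apply: vanish_mul; last exact: vanish_lq.
  by apply: br_van => //; apply: vanish_var.
by rewrite addSn -add1n; apply: vanish_mul; [exact: vanish_var | apply/IH/vanish_lq].
Qed.

Lemma raising_der u : nilfree u -> raising (der u).
Proof.
move=> u0; split=> [|d f Hf]; first exact: linear_der.
by rewrite -addn1; apply: der_van => // i; apply: vanish1P.
Qed.

Lemma der_var u i : nilfree u -> der u (var i) = br (var i) (u i).
Proof.
move=> u0; have H1 : der u 1 = 0.
  by rewrite der_rec // big1 // => j _; rewrite lq1 mulr0 add0r rais0 ?mulr0 //; exact: raising_der.
rewrite der_rec // (bigD1 i) //= lq_var eqxx mulr1n mulr1 H1 mulr0 addr0 big1 ?addr0 // => j ji.
rewrite lq_var (negPf ji) mulr0n mulr0 add0r rais0 ?mulr0 //; exact: raising_der.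
Qed.

Lemma der1 u : nilfree u -> der u 1 = 0.
Proof.
by move=> u0; rewrite der_rec // big1 // => j _; rewrite lq1 mulr0 add0r rais0 ?mulr0 //; exact: raising_der.
Qed.

Lemma addBDCA (V : zmodType) (a b c d : V) : a + b - (c + (a + d)) = b - (c + d).
Proof. by rewrite addrCA opprD addrACA subrr add0r. Qed.

(** The defect of the Leibniz rule at [f] is the sum of $x_i$ times its defects at the quotients
    [lq i f], so it vanishes to every order. *)
Lemma der_mul u f g : nilfree u -> der u (f * g) = der u f * g + f * der u g.
Proof.
move=> u0; have Hu := raising_der u0.
apply: eq_vanish => d; elim: d f => [|d IH] f; first exact: vanish0.
have -> : der u (f * g) - (der u f * g + f * der u g)
    = \sum_i var i * (der u (lq i f * g) - (der u (lq i f) * g + lq i f * der u g)).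
  have E1 : f * der u g = f [::] *: der u g + \sum_i var i * (lq i f * der u g).
    rewrite {1}(series_dec f) mulrDl -scalerAl mul1r mulr_suml; congr (_ + _).
    by apply: eq_bigr => i _; rewrite mulrA.
  have E2 : der u f * g
      = \sum_i (br (var i) (u i) * (lq i f * g) + var i * (der u (lq i f) * g)).
    by rewrite der_rec // mulr_suml; apply: eq_bigr => i _; rewrite mulrDl !mulrA.
  have E3 : der u (f * g) = f [::] *: der u g
      + \sum_i (br (var i) (u i) * (lq i f * g) + var i * der u (lq i f * g)).
    rewrite [LHS]der_rec // [der u g]der_rec // scaler_sumr -big_split; apply: eq_bigr => i _.
    rewrite /= lq_mul (raisD Hu) (raisZ Hu) !mulrDr scalerDr !scalerAr; exact: addrACA.
  rewrite E1 E2 E3 addBDCA -big_split -sumrB; apply: eq_bigr => i _ /=.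
  by rewrite mulrBr mulrDr; sring.
by apply: vanish_sum => i _; rewrite -add1n; apply: vanish_mul => //; exact: vanish_var.
Qed.

Lemma derivation_der u : nilfree u -> derivation (der u).
Proof.
move=> u0; split; [exact: linear_der | by move=> f g; apply: der_mul |].
by move=> d f; apply: rais_vanW; apply: raising_der.
Qed.

Lemma der_br u f g : nilfree u -> der u (br f g) = br (der u f) g + br f (der u g).
Proof.
by move=> u0; rewrite /br (raisB (raising_der u0)) !der_mul //; sring.
Qed.

Lemma derivation_eq D D' : derivation D -> derivation D' ->
  (forall i : 'I_n, D (var i) = D' (var i)) -> forall f : series k n, D f = D' f.
Proof.
move=> HD HD' E f; apply: eq_vanish => d; elim: d f => [|d IH] f; first exact: vanish0.
rewrite (series_dec f) (derD HD) (derD HD') !(derZ HD) !(derZ HD') !(der_one HD) !(der_one HD').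
rewrite !scaler0 !add0r (der_sum HD) (der_sum HD') -sumrB; apply: vanish_sum => i _.
rewrite (der_leib HD) (der_leib HD') E opprD addrACA subrr add0r -mulrBr.
by rewrite -add1n; apply: vanish_mul => //; exact: vanish_var.
Qed.

Lemma derivation_add D D' : derivation D -> derivation D' ->
  derivation (fun f : series k n => D f + D' f).
Proof.
move=> HD HD'; split.
- by move=> a f g; rewrite (der_lin HD) (der_lin HD') scalerDr addrACA.
- by move=> f g; rewrite (der_leib HD) (der_leib HD') mulrDl mulrDr addrACA.
- by move=> d f Hf; apply: vanishD; apply: der_vanish.
Qed.
Lemma derivation_scale a D : derivation D -> derivation (fun f : series k n => a *: D f).
Proof.
move=> HD; split.
- by move=> b f g; rewrite (der_lin HD) scalerDr !scalerA mulrC.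
- by move=> f g; rewrite (der_leib HD) scalerDr scalerAl scalerAr.
- by move=> d f Hf; apply: vanishZ; apply: der_vanish.
Qed.
Lemma derivation_comm D D' : derivation D -> derivation D' ->
  derivation (fun f : series k n => D (D' f) - D' (D f)).
Proof.
move=> HD HD'; split.
- move=> a f g; rewrite !(der_lin HD', der_lin HD) scalerBr; sring.
- move=> f g; rewrite !(der_leib HD, der_leib HD') (derD HD) (derD HD').
  by rewrite !(der_leib HD, der_leib HD') mulrBl mulrBr; sring.
- by move=> d f Hf; apply: vanishB; do 2 apply: der_vanish => //.
Qed.

(** Components of the commutator of derivations: the last term comes from the Jacobi identity
    $[[x,a],b]-[[x,b],a]=[x,[a,b]]$. *)
Definition tbr u v : tder_el k n :=
  fun i => der u (v i) - der v (u i) + br (u i) (v i).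
Definition tadd u v : tder_el k n := fun i => u i + v i.
Definition tscl (a : k) u : tder_el k n := fun i => a *: u i.
Definition tzero : tder_el k n := fun i => 0.

Lemma nilfree_tbr u v : nilfree u -> nilfree v -> nilfree (tbr u v).
Proof.
move=> u0 v0 i; rewrite /tbr /br !(addsE, oppsE) !mul_nil !der_nil u0 v0.
by rewrite !mul0r !subrr addr0.
Qed.

Lemma der_tadd u v f : nilfree u -> nilfree v -> der (tadd u v) f = der u f + der v f.
Proof.
move=> u0 v0; have uv0 : nilfree (tadd u v) by move=> i; rewrite /tadd addsE u0 v0 addr0.
apply: (derivation_eq (D' := fun f => der u f + der v f)).
- exact: derivation_der.
- by apply: derivation_add; apply: derivation_der.
- by move=> i; rewrite !der_var // /br /tadd mulrDl mulrDr; sring.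
Qed.
Lemma der_tscl a u f : nilfree u -> der (tscl a u) f = a *: der u f.
Proof.
move=> u0; have au0 : nilfree (tscl a u) by move=> i; rewrite /tscl scalesE u0 mulr0.
apply: (derivation_eq (D' := fun f => a *: der u f)).
- exact: derivation_der.
- by apply: derivation_scale; apply: derivation_der.
- by move=> i; rewrite !der_var // /br /tscl -scalerAl -scalerAr scalerBr.
Qed.
Lemma der_tbr u v f : nilfree u -> nilfree v ->
  der (tbr u v) f = der u (der v f) - der v (der u f).
Proof.
move=> u0 v0; have uv0 := nilfree_tbr u0 v0.
apply: (derivation_eq (D' := fun f => der u (der v f) - der v (der u f))).
- exact: derivation_der.
- by apply: derivation_comm; apply: derivation_der.
- move=> i; rewrite !der_var // !der_br // !der_var // /tbr /br.
  by rewrite !(mulrDl, mulrDr, mulrN, mulNr, opprD, opprK, mulrA); sring.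
Qed.
Lemma der_tzero f : der tzero f = 0.
Proof.
have -> : tzero = tscl 0 tzero by apply/funext=> i; rewrite /tscl scaler0.
by rewrite der_tscl ?scale0r.
Qed.

Lemma tder_nilfree u : tder u -> nilfree u.
Proof. by case=> Lu _ i; apply: lie_nil. Qed.
End Fixed.
End Derivations.

(** * Lie series evaluated at tangential derivations *)

Section LieGroup.
Context (k : fieldType).

Lemma trunc_van n (f : series k n) d : vanish d (f - \sum_(i < d) shom i f).
Proof. by move=> w wd; rewrite addsE oppsE sum_shom // subrr. Qed.

Section Fixed.
Context (n : nat).
Implicit Types (f g h : series k n) (u v : tder_el k n).

(* [Mop u i] is the lift of the derivation [u] to right multiples of [x_i]: it
   is a representation of tder, and [u i = Mop u i 1]. *)
Definition Mop u (i : 'I_n) h := der u h + u i * h.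

Lemma raising_Mop u i : nilfree u -> raising (Mop u i).
Proof. by move=> u0; apply: raising_add; [exact: raising_der | exact: raising_mull]. Qed.

Lemma Mop_tbr u v i h : nilfree u -> nilfree v ->
  Mop (tbr u v) i h = Mop u i (Mop v i h) - Mop v i (Mop u i h).
Proof.
move=> u0 v0; rewrite /Mop der_tbr // !(raisD (raising_der _)) // !der_mul // /tbr /br.
by rewrite !(mulrDl, mulrDr, mulrN, mulNr, opprD, opprK, mulrA); sring.
Qed.

Lemma Mop1 u i : nilfree u -> Mop u i 1 = u i.
Proof. by move=> u0; rewrite /Mop der1 // add0r mulr1. Qed.
Lemma Mop_tadd u v i h : nilfree u -> nilfree v ->
  Mop (tadd u v) i h = Mop u i h + Mop v i h.
Proof. by move=> u0 v0; rewrite /Mop der_tadd // /tadd mulrDl addrACA. Qed.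
Lemma Mop_tscl a u i h : nilfree u -> Mop (tscl a u) i h = a *: Mop u i h.
Proof. by move=> u0; rewrite /Mop der_tscl // /tscl -scalerAl scalerDr. Qed.

Lemma der_close u v d f e : nilfree u -> nilfree v ->
  (forall i, vanish e.+1 (u i - v i)) -> vanish d f -> vanish (d + e.+1) (der u f - der v f).
Proof.
move=> u0 v0 H Hf; have nv0 : nilfree (tscl (-1) v) by move=> i; rewrite /tscl scalesE v0 mulr0.
have -> : der u f - der v f = der (tadd u (tscl (-1) v)) f.
  by rewrite der_tadd // der_tscl // scaleN1r.
apply: der_van => // [i|i]; first by rewrite /tadd addsE u0 nv0 addr0.
by rewrite /tadd /tscl scaleN1r.
Qed.

Lemma Mop_close u v d h i e : nilfree u -> nilfree v ->
  (forall i, vanish e.+1 (u i - v i)) -> vanish d h -> vanish (d + e.+1) (Mop u i h - Mop v i h).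
Proof.
move=> u0 v0 H Hh; rewrite /Mop opprD addrACA -mulrBl; apply: vanishD.
  exact: der_close.
by rewrite addnC; apply: vanish_mul.
Qed.

Section Family.
Context (r : nat).
Implicit Types (U V : 'I_r -> tder_el k n) (p q : series k r).
Definition nilfam U := forall c, nilfree (U c).

(* The value of a Lie series [p] at elements of tder, read off from the
   operators [Mop]. *)
Definition bev U p : tder_el k n := fun i => ev (fun c => Mop (U c) i) p 1.

Lemma raising_fam U i : nilfam U -> forall c, raising (Mop (U c) i).
Proof. by move=> U0 c; apply: raising_Mop. Qed.

Lemma bev_nilfree U p : nilfam U -> p [::] = 0 -> nilfree (bev U p).
Proof.
move=> U0 p0 i; have := raising_ev (raising_fam i U0) p0 => -[_ H].
by apply: (H 0%N 1 (vanish0 _)).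
Qed.

Lemma bevD U p q : nilfam U -> bev U (p + q) = tadd (bev U p) (bev U q).
Proof. by move=> U0; apply/funext=> i; rewrite /bev evDl //; apply: raising_fam. Qed.
Lemma bevZ U a p : nilfam U -> bev U (a *: p) = tscl a (bev U p).
Proof. by move=> U0; apply/funext=> i; rewrite /bev evZl //; apply: raising_fam. Qed.
Lemma bev0 U : nilfam U -> bev U 0 = @tzero k n.
Proof. by move=> U0; apply/funext=> i; rewrite /bev ev0l //; apply: raising_fam. Qed.
Lemma bev_var U c : nilfam U -> bev U (var c) = U c.
Proof.
by move=> U0; apply/funext=> i; rewrite /bev ev_var ?Mop1 //; apply: raising_fam.
Qed.

Lemma lie_poly_nil m (p : series k m) : lie_poly p -> p [::] = 0.
Proof. by move/lie_poly_series/lie_nil. Qed.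

(** Since [Mop] represents the bracket, a Lie polynomial in the operators [Mop (U c) i] is again
    [Mop] of one derivation. The same derivation serves every index [i] and, by [bev_der], the
    action on series. *)
Lemma bev_Mop U p i h : nilfam U -> lie_poly p ->
  ev (fun c => Mop (U c) i) p h = Mop (bev U p) i h.
Proof.
move=> U0 Lp; elim/lie_poly_ind': p / Lp i h => [|c|p q Lp Lq IHp IHq|a p Lp IHp|p q Lp Lq IHp IHq] i h.
- rewrite ev0l ?bev0 //; last exact: raising_fam.
  by rewrite /Mop der_tzero mul0r addr0.
- by rewrite ev_var ?bev_var //; apply: raising_fam.
- rewrite evDl; last exact: raising_fam.
  by rewrite IHp IHq bevD // Mop_tadd //; apply: bev_nilfree => //; apply: lie_poly_nil.
- rewrite evZl; last exact: raising_fam.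
  by rewrite IHp bevZ // Mop_tscl //; apply: bev_nilfree => //; apply: lie_poly_nil.
- have p0 := bev_nilfree U0 (lie_poly_nil Lp); have q0 := bev_nilfree U0 (lie_poly_nil Lq).
  have E j h' : ev (fun c => Mop (U c) j) (br p q) h' = Mop (tbr (bev U p) (bev U q)) j h'.
    rewrite /br evBl ?ev_mul; try exact: raising_fam.
    by rewrite !IHp !IHq Mop_tbr.
  have -> : bev U (br p q) = tbr (bev U p) (bev U q).
    by apply/funext=> j; rewrite /bev E Mop1 //; apply: nilfree_tbr.
  exact: E.
Qed.

Lemma bev_br U p q : nilfam U -> lie_poly p -> lie_poly q ->
  bev U (br p q) = tbr (bev U p) (bev U q).
Proof.
move=> U0 Lp Lq; apply/funext=> i.
have p0 := bev_nilfree U0 (lie_poly_nil Lp); have q0 := bev_nilfree U0 (lie_poly_nil Lq).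
rewrite /bev /br evBl ?ev_mul; try exact: raising_fam.
by rewrite !bev_Mop // -Mop_tbr // Mop1 //; apply: nilfree_tbr.
Qed.

Lemma bev_close U p q d : nilfam U -> vanish d (p - q) -> forall i, vanish d (bev U p i - bev U q i).
Proof.
move=> U0 H i; rewrite /bev -evBl; last exact: raising_fam.
by rewrite -[d]add0n; apply: ev_van => //; apply: raising_fam.
Qed.

Lemma bev_der U p h : nilfam U -> lie_series p ->
  ev (fun c => der (U c)) p h = der (bev U p) h.
Proof.
move=> U0 Lp.
have H q : lie_poly q -> forall h, ev (fun c => der (U c)) q h = der (bev U q) h.
  move=> {h} Lq; have R0 c : raising (der (U c)) by exact: raising_der.
  elim/lie_poly_ind': q / Lq => [|c|p' q Lp' Lq IHp IHq|a q Lq IHq|p' q Lp' Lq IHp IHq] h.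
  - by rewrite ev0l // bev0 // der_tzero.
  - by rewrite ev_var // bev_var.
  - by rewrite evDl // IHp IHq bevD // der_tadd //; apply: bev_nilfree => //; apply: lie_poly_nil.
  - by rewrite evZl // IHq bevZ // der_tscl //; apply: bev_nilfree => //; apply: lie_poly_nil.
  - rewrite /br evBl // !ev_mul // !IHp !IHq -/(br p' q) bev_br // der_tbr //;
      by apply: bev_nilfree => //; apply: lie_poly_nil.
have R0 c : raising (der (U c)) by exact: raising_der.
apply: eq_vanish => d; set q := \sum_(i < d) shom i p.
have Lq : lie_poly q by exact: lie_series_trunc.
have pq : vanish d (p - q) by exact: trunc_van.
have p0 := bev_nilfree U0 (lie_nil Lp); have q0 := bev_nilfree U0 (lie_poly_nil Lq).
rewrite -[ev _ p h](subrK (ev (fun c => der (U c)) q h)) -addrA; apply: vanishD.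
  by rewrite -evBl // -[d]add0n; apply: ev_van.
rewrite H // -opprB; apply: vanishN; case: d @q Lq pq q0 => [|d] q Lq pq q0; first exact: vanish0.
by rewrite -[d.+1]add0n; apply: der_close => //; apply: bev_close.
Qed.

Lemma bev_Mop_series U p i h : nilfam U -> lie_series p ->
  ev (fun c => Mop (U c) i) p h = Mop (bev U p) i h.
Proof.
move=> U0 Lp; apply: eq_vanish => d; set q := \sum_(i < d) shom i p.
have Lq : lie_poly q by exact: lie_series_trunc.
have pq : vanish d (p - q) by exact: trunc_van.
have p0 := bev_nilfree U0 (lie_nil Lp); have q0 := bev_nilfree U0 (lie_poly_nil Lq).
rewrite -[ev _ p h](subrK (ev (fun c => Mop (U c) i) q h)) -addrA; apply: vanishD.
  by rewrite -evBl; [rewrite -[d]add0n; apply: ev_van => // |]; apply: raising_fam.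
rewrite bev_Mop // -opprB; apply: vanishN; case: d @q Lq pq q0 => [|d] q Lq pq q0; first exact: vanish0.
by rewrite -[d.+1]add0n; apply: Mop_close => //; apply: bev_close.
Qed.
End Family.

Lemma lie_der u f : nilfree u -> (forall i, lie_series (u i)) -> lie_series f -> lie_series (der u f).
Proof.
move=> u0 Lu Lf; apply: lie_series_eq => d; exists (der u (\sum_(i < d.+1) shom i f)).
  elim/lie_poly_ind': _ / (lie_series_trunc d.+1 Lf) => [|i|f' g _ _ Hf Hg|a f' _ Hf|f' g Lf' Lg Hf Hg].
  - by rewrite (rais0 (raising_der u0)); exact: lie_series0.
  - by rewrite der_var //; apply: lie_series_br => //; exact: lie_series_var.
  - by rewrite (raisD (raising_der u0)); apply: lie_seriesD.
  - by rewrite (raisZ (raising_der u0)); apply: lie_seriesZ.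
  - by rewrite der_br //; apply: lie_seriesD; apply: lie_series_br => //; apply: lie_poly_series.
rewrite -(raisB (raising_der u0)); apply: rais_vanW; first exact: raising_der.
exact: trunc_van.
Qed.

Lemma tder_tbr u v : tder u -> tder v -> tder (tbr u v).
Proof.
move=> Hu Hv; have u0 := tder_nilfree Hu; have v0 := tder_nilfree Hv.
split=> i.
  apply: lie_seriesD; last by apply: lie_series_br; [apply Hu | apply Hv].
  by apply: lie_seriesB; apply: lie_der => //; first [apply Hu | apply Hv].
have V1 w f : nilfree w -> f [::] = 0 -> der w f [:: i] = 0.
  by move=> w0 f0; apply: (rais_van (raising_der w0) (vanish1P f0)).
rewrite /tbr !(addsE, oppsE) !V1 // subrr add0r.
by have := br_van (vanish1P (u0 i)) (vanish1P (v0 i)); apply.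
Qed.
Lemma tder_tadd u v : tder u -> tder v -> tder (tadd u v).
Proof.
move=> [Lu Nu] [Lv Nv]; split=> i; first exact: lie_seriesD.
by rewrite /tadd addsE Nu Nv addr0.
Qed.
Lemma tder_tscl a u : tder u -> tder (tscl a u).
Proof.
move=> [Lu Nu]; split=> i; first exact: lie_seriesZ.
by rewrite /tscl scalesE Nu mulr0.
Qed.
Lemma tder_tzero : tder (@tzero k n).
Proof. by split=> i //; exact: lie_series0. Qed.

Lemma tder_bev r (U : 'I_r -> tder_el k n) p : (forall c, tder (U c)) -> lie_series p -> tder (bev U p).
Proof.
move=> HU Lp; have U0 : nilfam U by move=> c; apply: tder_nilfree.
have H q : lie_poly q -> tder (bev U q).
  elim/lie_poly_ind' => [|c|p' q' Lp' Lq IHp IHq|a q' Lq IHq|p' q' Lp' Lq IHp IHq].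
  - by rewrite bev0 //; exact: tder_tzero.
  - by rewrite bev_var.
  - by rewrite bevD //; apply: tder_tadd.
  - by rewrite bevZ //; apply: tder_tscl.
  - by rewrite bev_br //; apply: tder_tbr.
have C d i : vanish d (bev U p i - bev U (\sum_(i < d) shom i p) i).
  by apply: bev_close => //; exact: trunc_van.
split=> i.
  apply: lie_series_eq => d; exists (bev U (\sum_(i < d.+1) shom i p) i) => //.
  by have [] := H _ (lie_series_trunc d.+1 Lp).
by have /(vanish_eq (w := [:: i])) -> // := C 2%N i; have [_ ->] := H _ (lie_series_trunc 2 Lp).
Qed.
End Fixed.
End LieGroup.

(** * The group law of TAut on logarithms *)

Section BCH.
Context (k : fieldType) (hk : [pchar k] =i pred0).

Lemma ord2 (c : 'I_2) : c = vx \/ c = vy.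
Proof.
case: c => -[|[|//]] H; [left|right]; apply: ord_inj; by rewrite /vx /vy inordK.
Qed.
Lemma vy_vx : (vy == vx) = false.
Proof. by rewrite -val_eqE /= !inordK. Qed.
Lemma vx_vy : (vx == vy) = false.
Proof. by rewrite eq_sym vy_vx. Qed.
Lemma sum2 (V : nmodType) (F : 'I_2 -> V) : \sum_i F i = F vx + F vy.
Proof.
rewrite big_ord_recl big_ord1; congr (F _ + F _); apply: ord_inj; by rewrite /= inordK.
Qed.

Definition fam2 T (a b : T) (c : 'I_2) := if c == vx then a else b.
Lemma fam2x T (a b : T) : fam2 a b vx = a. Proof. by rewrite /fam2 eqxx. Qed.
Lemma fam2y T (a b : T) : fam2 a b vy = b. Proof. by rewrite /fam2 vy_vx. Qed.

(** The identity [sexp_ch] evaluated at the noncommuting pair [A], [B]. *)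
Lemma oexp_comp m (A B : series k m -> series k m) h : raising A -> raising B ->
  oexp A (oexp B h) = oexp (ev (fam2 A B) (ch k)) h.
Proof.
move=> HA HB; have HP c : raising (fam2 A B c) by rewrite /fam2; case: ifP.
rewrite -ev_sexp //; last exact: ch_nil.
rewrite sexp_ch // ev_mul // !ev_sexp //; congr (oexp _ _).
  by apply/funext=> g; rewrite ev_var // fam2x.
by congr (oexp _ _); apply/funext=> g; rewrite ev_var // fam2y.
Qed.

Section Fixed.
Context (n : nat).
Implicit Types (f g h : series k n) (u v z : tder_el k n).

Definition bch u v := bev (fam2 u v) (ch k).

Lemma nilfam2 u v : nilfree u -> nilfree v -> nilfam (fam2 u v).
Proof. by move=> u0 v0 c; rewrite /fam2; case: ifP. Qed.

Lemma tder_bch u v : tder u -> tder v -> tder (bch u v).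
Proof.
move=> Hu Hv; apply: tder_bev; last exact: lie_ch.
by move=> c; rewrite /fam2; case: ifP.
Qed.
Lemma nilfree_bch u v : nilfree u -> nilfree v -> nilfree (bch u v).
Proof. by move=> u0 v0; apply: bev_nilfree; [exact: nilfam2 | exact: ch_nil]. Qed.

Lemma expD_bch u v f : nilfree u -> nilfree v -> expD (bch u v) f = expD u (expD v f).
Proof.
move=> u0 v0; rewrite !expD_oexp oexp_comp; try exact: raising_der.
congr (oexp _ f); apply/funext=> h.
rewrite /bch -bev_der; [|exact: nilfam2|exact: lie_ch].
by congr (ev _ _ h); apply/funext=> c; rewrite /fam2; case: ifP.
Qed.
Lemma Mexp_bch u v i h : nilfree u -> nilfree v ->
  oexp (Mop (bch u v) i) h = oexp (Mop u i) (oexp (Mop v i) h).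
Proof.
move=> u0 v0; rewrite oexp_comp; try exact: raising_Mop.
congr (oexp _ h); apply/funext=> g.
rewrite /bch -bev_Mop_series; [|exact: nilfam2|exact: lie_ch].
by congr (ev _ _ g); apply/funext=> c; rewrite /fam2; case: ifP.
Qed.

(** Applied to $1$, [Mop u i] returns the component [u i], so the exponentials determine [u] degree
    by degree. Group identities for [bch], such as [bchA], thereby become identities of composed
    operators. *)
Lemma Mexp_inj u v : nilfree u -> nilfree v ->
  (forall i, oexp (Mop u i) 1 = oexp (Mop v i) 1) -> u = v.
Proof.
move=> u0 v0 E.
suff H d : forall i, vanish d (u i - v i) by apply/funext=> i; apply: eq_vanish.
elim: d => [|[|d] IH] i; first exact: vanish0.
  by apply: vanish1P; rewrite addsE oppsE u0 v0 subrr.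
have := oexp_pert (d := 0) (e := d.+1) (h := 1) (raising_Mop i u0) (raising_Mop i v0) _ (vanish0 _).
rewrite E subrr sub0r !Mop1 // => H; rewrite -[u i - v i]opprK; apply/vanishN/H.
by move=> c g Hg; apply: Mop_close.
Qed.

Lemma bchA u v w : nilfree u -> nilfree v -> nilfree w -> bch u (bch v w) = bch (bch u v) w.
Proof.
move=> u0 v0 w0; have uv0 := nilfree_bch u0 v0; have vw0 := nilfree_bch v0 w0.
by apply: Mexp_inj => [||i]; [exact: nilfree_bch | exact: nilfree_bch | rewrite !Mexp_bch].
Qed.

Definition teq d u v := forall i, vanish d (u i - v i).
Lemma teq_refl d u : teq d u u. Proof. by move=> i; rewrite subrr; exact: vanish_0. Qed.
Lemma teq_sym d u v : teq d u v -> teq d v u.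
Proof. by move=> H i; rewrite -opprB; apply: vanishN. Qed.
Lemma teq_trans d v u w : teq d u v -> teq d v w -> teq d u w.
Proof. by move=> H1 H2 i; rewrite -[u i](subrK (v i)) -addrA; apply: vanishD. Qed.
Lemma teqW d e u v : (d <= e)%N -> teq e u v -> teq d u v.
Proof. by move=> de H i; apply: vanishW (H i). Qed.
Lemma teq_eq u v : (forall d, teq d u v) -> u = v.
Proof. by move=> H; apply/funext=> i; apply: eq_vanish => d; apply: H. Qed.
Lemma teq1 u v : nilfree u -> nilfree v -> teq 1 u v.
Proof. by move=> u0 v0 i; apply: vanish1P; rewrite addsE oppsE u0 v0 subrr. Qed.
Lemma teq_tadd d u u' v v' : teq d u u' -> teq d v v' -> teq d (tadd u v) (tadd u' v').
Proof. by move=> H1 H2 i; rewrite /tadd opprD addrACA; apply: vanishD. Qed.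

(** [bch u v] minus its linear part $u+v$ is made of brackets, each of which raises the degree of
    the perturbation. The comparison is written with [tadd] on both sides in place of
    differences. *)
Lemma bch_pert u v u' v' d : nilfree u -> nilfree v -> nilfree u' -> nilfree v' ->
  teq d.+1 u u' -> teq d.+1 v v' ->
  teq d.+2 (tadd (bch u v) (tadd u' v')) (tadd (bch u' v') (tadd u v)).
Proof.
move=> u0 v0 u0' v0' Hu Hv i.
have H := @ev_pert k 2 n (fun c => Mop (fam2 u v c) i) (fun c => Mop (fam2 u' v' c) i)
  (ch k) 1 0 d.+1.
have := H _ _ _ (vanish0 _); rewrite add0n sum2 !ch1 // !scale1r !fam2x !fam2y !Mop1 //.
rewrite -[ev _ _ _]/(bch u v i) -[X in _ - X - _]/(bch u' v' i) => {}H.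
have -> : tadd (bch u v) (tadd u' v') i - tadd (bch u' v') (tadd u v) i =
  bch u v i - bch u' v' i - (u i - u' i + (v i - v' i)) by rewrite /tadd; sring.
apply: H.
- by move=> c; apply: raising_Mop; apply: nilfam2.
- by move=> c; apply: raising_Mop; apply: nilfam2.
- by move=> c e g Hg; apply: Mop_close => // [||j]; rewrite /fam2; case: ifP.
Qed.

Lemma bch_congr u v u' v' d : nilfree u -> nilfree v -> nilfree u' -> nilfree v' ->
  teq d u u' -> teq d v v' -> teq d (bch u v) (bch u' v').
Proof.
move=> u0 v0 u0' v0'; case: d => [|d] Hu Hv; first by move=> i; exact: vanish0.
move=> i; have := bch_pert u0 v0 u0' v0' Hu Hv i => /(vanishW (leqnSn _)) H.
have -> : bch u v i - bch u' v' i
  = (tadd (bch u v) (tadd u' v') i - tadd (bch u' v') (tadd u v) i) + ((u i - u' i) + (v i - v' i)).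
  by rewrite /tadd; sring.
by apply: vanishD => //; apply: vanishD.
Qed.

Lemma bch_central_r u v z d : nilfree u -> nilfree v -> (forall i, vanish d.+1 (z i)) ->
  teq d.+2 (bch u (tadd v z)) (tadd (bch u v) z).
Proof.
move=> u0 v0 Hz i; have z0 j : z j [::] = 0 by apply: Hz.
have vz0 : nilfree (tadd v z) by move=> j; rewrite /tadd addsE v0 z0 addr0.
have Hvz : teq d.+1 (tadd v z) v by move=> j; rewrite /tadd addrAC subrr add0r.
have := bch_pert u0 vz0 u0 v0 (@teq_refl _ _) Hvz i.
by congr (vanish _ _); rewrite /tadd; sring.
Qed.
Lemma bch_central_l u v z d : nilfree u -> nilfree v -> (forall i, vanish d.+1 (z i)) ->
  teq d.+2 (bch (tadd u z) v) (tadd (bch u v) z).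
Proof.
move=> u0 v0 Hz i; have z0 j : z j [::] = 0 by apply: Hz.
have uz0 : nilfree (tadd u z) by move=> j; rewrite /tadd addsE u0 z0 addr0.
have Huz : teq d.+1 (tadd u z) u by move=> j; rewrite /tadd addrAC subrr add0r.
have := bch_pert uz0 v0 u0 v0 Huz (@teq_refl _ _) i.
by congr (vanish _ _); rewrite /tadd; sring.
Qed.

(** Brackets evaluate to zero at a commuting pair, so only the linear coefficients survive. *)
Lemma bev_comm u v p : nilfree u -> nilfree v -> tbr u v = @tzero k n -> lie_poly p ->
  bev (fam2 u v) p = tadd (tscl (p [:: vx]) u) (tscl (p [:: vy]) v).
Proof.
move=> u0 v0 E; have U0 := nilfam2 u0 v0.
elim/lie_poly_ind' => [|c|p' q Lp Lq IHp IHq|a q Lq IHq|p' q Lp Lq IHp IHq].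
- by rewrite bev0 //; apply/funext=> i; rewrite /tadd /tscl !zerosE !scale0r addr0.
- rewrite bev_var //; have l1 (d : 'I_2) : (var c : series k 2) [:: d] = (d == c)%:R.
    by rewrite /var /xvar eqseq_cons andbT.
  rewrite !l1; case: (ord2 c) => ->; rewrite ?fam2x ?fam2y ?eqxx ?vx_vy ?vy_vx;
    by apply/funext=> i; rewrite /tadd /tscl mulr1n mulr0n !scale1r !scale0r ?addr0 ?add0r.
- by rewrite bevD // IHp IHq; apply/funext=> i; rewrite /tadd /tscl !addsE !scalerDl addrACA.
- by rewrite bevZ // IHq; apply/funext=> i; rewrite /tadd /tscl !scalesE scalerDr !scalerA.
- rewrite bev_br // IHp IHq.
  have b1 c : br p' q [:: c] = 0.
    by have := br_van (lie_van (lie_poly_series Lp)) (lie_van (lie_poly_series Lq)); apply.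
  rewrite !b1; apply/funext=> i; rewrite /tadd /tscl !scale0r addr0.
  have tn a w : nilfree w -> nilfree (tscl a w) by move=> w0 j; rewrite /tscl scalesE w0 mulr0.
  have Ei := congr1 (@^~ i) E.
  rewrite /tbr !der_tadd ?der_tscl //; try exact: tn.
  rewrite !(raisD (raising_der _)) // !(raisZ (raising_der _)) //.
  have Dv : der u (v i) = der v (u i) - br (u i) (v i).
    by move: Ei; rewrite /= /tbr /tzero => /eqP; rewrite addr_eq0 subr_eq => /eqP ->; rewrite addrC.
  rewrite Dv /br !(mulrDl, mulrDr) -!scalerAl -!scalerAr !scalerA; sring.
Qed.

Lemma bch_comm u v : nilfree u -> nilfree v -> tbr u v = @tzero k n -> bch u v = tadd u v.
Proof.
move=> u0 v0 E; apply: teq_eq => d i.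
set q := \sum_(i < d.+2) shom i (ch k).
have Lq : lie_poly q by apply: lie_series_trunc; exact: lie_ch.
have Eq c : q [:: c] = 1 by rewrite /q sum_shom // ch1.
have := bev_comm u0 v0 E Lq; rewrite !Eq => /(congr1 (@^~ i)).
rewrite {1}/tadd /tscl !scale1r => E1; rewrite -[tadd u v i]E1.
by apply: bev_close; [exact: nilfam2 | apply: (@vanishW _ _ _ d.+2); [lia|exact: trunc_van]].
Qed.

Lemma tbrC u v : tbr u v = tscl (-1) (tbr v u).
Proof. by apply/funext=> i; rewrite /tbr /tscl scaleN1r /br; sring. Qed.

Lemma bch_commC u v : nilfree u -> nilfree v -> tbr u v = @tzero k n -> bch u v = bch v u.
Proof.
move=> u0 v0 E; rewrite !bch_comm //; last first.
  by rewrite tbrC E; apply/funext=> i; rewrite /tscl /tzero scaler0.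
by apply/funext=> i; rewrite /tadd addrC.
Qed.

Definition topp u := tscl (-1) u.
Lemma nilfree_topp u : nilfree u -> nilfree (topp u).
Proof. by move=> u0 j; rewrite /topp /tscl scalesE u0 mulr0. Qed.
Lemma tder_topp u : tder u -> tder (topp u).
Proof. exact: tder_tscl. Qed.
Lemma toppE u i : topp u i = - u i. Proof. exact: scaleN1r. Qed.

Lemma tbr_topp u : nilfree u -> tbr (topp u) u = @tzero k n.
Proof.
move=> u0; apply/funext=> i; rewrite /tbr !toppE (raisN (raising_der u0)) /topp der_tscl //.
by rewrite scaleN1r subrr add0r /br mulNr mulrN subrr.
Qed.
Lemma bch_Nu u : nilfree u -> bch (topp u) u = @tzero k n.
Proof.
move=> u0; rewrite bch_comm ?tbr_topp //; last exact: nilfree_topp.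
by apply/funext=> i; rewrite /tadd toppE addNr.
Qed.
Lemma bch_uN u : nilfree u -> bch u (topp u) = @tzero k n.
Proof. by move=> u0; rewrite -bch_commC ?bch_Nu ?tbr_topp //; apply: nilfree_topp. Qed.
Lemma nilfree0 : nilfree (@tzero k n). Proof. by []. Qed.
Lemma tbr0 u : tbr (@tzero k n) u = @tzero k n.
Proof.
apply/funext=> i; rewrite /tbr der_tzero /tzero /br mul0r mulr0 subrr addr0 sub0r.
have -> : der u 0 = 0; last by rewrite oppr0.
by have := linear_der u (-1) 0 0; rewrite scaler0 addr0 scaleN1r addNr.
Qed.
Lemma bch0u u : nilfree u -> bch (@tzero k n) u = u.
Proof.
by move=> u0; rewrite bch_comm ?tbr0 //; apply/funext=> i; rewrite /tadd add0r.
Qed.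
Lemma bchu0 u : nilfree u -> bch u (@tzero k n) = u.
Proof. by move=> u0; rewrite -bch_commC ?bch0u ?tbr0 //; exact: nilfree0. Qed.

Lemma tneg_topp u : tneg u = topp u.
Proof. by apply/funext=> i; rewrite toppE. Qed.

Lemma expD_zero f : expD (@tzero k n) f = f.
Proof.
rewrite expD_oexp oexp_id ?der_tzero //; exact: raising_der.
Qed.

Lemma mul_nseq f g m i : (f * g) (nseq m i) = (g * f) (nseq m i).
Proof.
have H (a b : series k n) : (a * b) (nseq m i) = \sum_(j < m.+1) a (nseq j i) * b (nseq (m - j) i).
  rewrite [LHS]/(smul a b _) /smul size_nseq; apply: eq_bigr => -[j jm] _ /=.
  by rewrite take_nseq // drop_nseq.
rewrite !H (reindex_inj rev_ord_inj); apply: eq_bigr => -[j jm] _ /=.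
by rewrite subSS subKn // mulrC.
Qed.

Lemma lie_nseq f m i : lie_series f -> m != 1%N -> f (nseq m i) = 0.
Proof.
move=> Lf m1; have <- : shom m f (nseq m i) = f (nseq m i) by rewrite /shom size_nseq eqxx.
elim/lie_poly_ind': _ / (Lf m) => [//|j|p q _ _|a p _|p q _ _ _ _].
- by case: m m1 => [|[|m]] // _; rewrite /var /xvar eqseq_cons andbF.
- by rewrite addsE => -> ->; rewrite addr0.
- by rewrite scalesE => ->; rewrite mulr0.
- by rewrite /br addsE oppsE mul_nseq subrr.
Qed.

(** Only series in $x_i$ commute with $x_i$. At $x_i^mx_ct$ with $c\ne i$, the coefficient of
    $[x_i,a]$ on this word followed by $x_i$ trades a leading $x_i$ for a trailing one, until the
    word starts with $x_c$ and the coefficient of $a$ is isolated. *)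
Lemma br_var_van i (a : series k n) d : (forall m, a (nseq m i) = 0) ->
  vanish d.+1 (br (var i) a) -> vanish d a.
Proof.
move=> an H.
have mulxr (b : series k n) t c : (b * var i) (rcons t c) = b t * (c == i)%:R.
  elim: t b => [|e t IH] b; first by rewrite /= mul_cons mul_nil var_nil mulr0 addr0 /var /xvar eqseq_cons andbT.
  rewrite rcons_cons mul_cons IH {1}/var /xvar eqseq_cons; case: (rcons t c) (size_rcons t c) => [//|x s _].
  by rewrite andbF mulr0 add0r.
have mulxl (b : series k n) t c : (var i * b) (c :: t) = (c == i)%:R * b t.
  by rewrite mul_cons var_nil mul0r add0r lq_var; case: (c == i); rewrite ?mul1r ?mul0r.
have K m (c : 'I_n) (t : seq 'I_n) : c != i -> ((size t + m).+1 < d)%N -> a (nseq m i ++ c :: t) = 0.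
  elim: m t => [|m IH] t ci td.
    have : br (var i) a (rcons (c :: t) i) = 0 by apply: H; rewrite size_rcons /=; lia.
    rewrite /br addsE oppsE mulxr rcons_cons mulxl (negPf ci) eqxx.
    by rewrite mul0r mulr1 sub0r => /eqP; rewrite oppr_eq0 => /eqP.
  have : br (var i) a (i :: rcons (nseq m i ++ c :: t) i) = 0.
    by apply: H; rewrite /= size_rcons size_cat size_nseq /=; lia.
  rewrite /br addsE oppsE mulxl -rcons_cons mulxr eqxx mul1r mulr1 rcons_cat rcons_cons.
  rewrite IH ?size_rcons //; last by lia.
  by rewrite sub0r => /eqP; rewrite oppr_eq0 => /eqP.
move=> t td; have [m [->|[c [t' [ci Et]]]]] : exists m, t = nseq m i \/ exists (c : 'I_n) (t' : seq 'I_n), c != i /\ t = nseq m i ++ c :: t'.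
- elim: t {td} => [|c t [m IH]]; first by exists 0%N; left.
  case: (c =P i) => [->|/eqP ci]; last by exists 0%N; right; exists c, t.
  exists m.+1; case: IH => [->|[e [t' [ei ->]]]]; first by left.
  by right; exists e, t'.
- exact: an.
- by rewrite Et K //; move: td; rewrite Et size_cat size_nseq /=; lia.
Qed.

(** The automorphism sees [u i] only through $[x_i,u_i]$; the normalization in [tder] removes the
    multiples of $x_i$ that this bracket forgets. *)
Lemma expD_inj u v : tder u -> tder v -> (forall i, expD u (var i) = expD v (var i)) -> u = v.
Proof.
move=> Hu Hv E; have u0 := tder_nilfree Hu; have v0 := tder_nilfree Hv.
apply: teq_eq; elim=> [|d IH]; first by move=> i; exact: vanish0.
case: d IH => [|d] IH; first exact: teq1.
move=> i.
have := oexp_pert (d := 1) (e := d.+1) (h := var i) (raising_der u0) (raising_der v0) _ (@vanish_var k n i).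
rewrite -!expD_oexp E subrr sub0r !der_var // add1n => H.
apply: (@br_var_van i).
  move=> m; have La : lie_series (u i - v i) by apply: lie_seriesB; [apply Hu | apply Hv].
  case: (m =P 1%N) => [->|/eqP m1]; last exact: lie_nseq.
  by rewrite /= addsE oppsE; case: Hu Hv => _ -> [_ ->]; rewrite subrr.
have -> : br (var i) (u i - v i) = br (var i) (u i) - br (var i) (v i).
  by rewrite /br mulrBr mulrBl; sring.
by rewrite -[_ - _]opprK; apply/vanishN/H => c g Hg; apply: der_close.
Qed.
End Fixed.
End BCH.

(** * Coface maps *)

Section Coface.
Context (k : fieldType).
Section Fixed.
Context (m n : nat) (p : 'I_m -> option 'I_n).
Implicit Types (f g h : series k n) (u v : tder_el k n) (w : seq 'I_m).

Lemma pmap_of_map w t : map p w = map Some t -> pmap p w = t.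
Proof. by elim: w t => [|j w IH] [|i t] //= [-> /IH ->]. Qed.
Lemma all_of_map w (t : seq 'I_n) : map p w = map Some t -> all (fun j => p j) w.
Proof. by elim: w t => [|j w IH] [|i t] //= [-> /IH ->]. Qed.

(** Every new letter lies in at most one block, so at most one word [v] contributes to the sum. *)
Lemma substE f w : subst p f w = if all (fun j => p j) w then f (pmap p w) else 0.
Proof.
rewrite /subst.
have P (v : (size w).-tuple 'I_n) :
   \prod_(j < size w) (p (tnth (in_tuple w) j) == Some (tnth v j))%:R
   = (map p w == map Some v)%:R :> k.
  have T (j : 'I_(size w)) : (p (tnth (in_tuple w) j) == Some (tnth v j))
      = (nth None (map p w) j == nth None (map Some v) j).
    set x := tnth _ _; set y := tnth v j.
    have jv : (j < size v)%N by rewrite size_tuple.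
    by rewrite (nth_map x) // (nth_map y) // -(tnth_nth x (in_tuple w)) -(tnth_nth y v).
  under eq_bigr do rewrite T.
  case: eqP => [E|E]; first by rewrite big1 // => j _; rewrite E eqxx.
  have [j Hj|H] := pickP (fun j : 'I_(size w) => nth None (map p w) j != nth None (map Some v) j).
    by rewrite (bigD1 j) //= (negPf Hj) mul0r.
  case: E; apply: (@eq_from_nth _ None) => [|i]; rewrite !size_map ?size_tuple // => iw.
  exact/eqP/negbFE/(H (Ordinal iw)).
under eq_bigr do rewrite P.
case: ifP => [A|A].
  have sz : size (pmap p w) == size w.
    by rewrite size_pmap -all_count.
  rewrite (bigD1 (Tuple sz)) //= big1 => [|v].
    have -> : map p w = map Some (pmap p w).
      by elim: w A {sz P} => //= j w IH /andP[]; case: (p j) => //= i _ /IH ->.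
    by rewrite eqxx mulr1 addr0.
  move=> vne; case: (map p w =P map Some v) => [E|]; last by rewrite mulr0.
  case/eqP: vne; apply: val_inj => /=.
  by rewrite (pmap_of_map E).
rewrite big1 // => v _; case: eqP => [E|]; last by rewrite mulr0.
by rewrite (all_of_map E) in A.
Qed.

Lemma subst_nil f : subst p f [::] = f [::]. Proof. by rewrite substE. Qed.
Lemma lq_subst f j : lq j (subst p f) = if p j is Some i then subst p (lq i f) else 0.
Proof.
apply/funext=> w; rewrite /lq substE /=; case: (p j) => [i|] //=.
by rewrite substE.
Qed.
Lemma linear_subst : linear (@subst k n m p).
Proof.
move=> a f g; apply/funext=> w; rewrite addsE scalesE !substE.
by case: ifP => _; rewrite ?addsE ?scalesE // mulr0 addr0.
Qed.
Lemma substD f g : subst p (f + g) = subst p f + subst p g.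
Proof. by have := linear_subst 1 f g; rewrite !scale1r. Qed.
Lemma subst0 : subst p (0 : series k n) = 0.
Proof. by apply/funext=> w; rewrite substE; case: ifP. Qed.
Lemma substZ a f : subst p (a *: f) = a *: subst p f.
Proof. by have := linear_subst a f 0; rewrite subst0 !addr0. Qed.
Lemma substB f g : subst p (f - g) = subst p f - subst p g.
Proof. by rewrite -scaleN1r substD substZ scaleN1r. Qed.
Lemma subst_sum I (r : seq I) (P : pred I) (F : I -> series k n) :
  subst p (\sum_(i <- r | P i) F i) = \sum_(i <- r | P i) subst p (F i).
Proof. by elim/big_rec2: _ => [|i x y _ <-]; rewrite ?subst0 ?substD. Qed.
Lemma subst1 : subst p (1 : series k n) = 1.
Proof.
apply: series_eq => [|j]; first by rewrite subst_nil.
by rewrite lq_subst !lq1; case: (p j) => // i; rewrite lq1 subst0.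
Qed.
Lemma subst_mul f g : subst p (f * g) = subst p f * subst p g.
Proof.
apply/funext=> w; elim: w f => [|j w IH] f; first by rewrite subst_nil !mul_nil !subst_nil.
rewrite mul_cons subst_nil.
have := lq_subst (f * g) j => /(congr1 (@^~ w)); rewrite {1}/lq => ->.
have -> : subst p g (j :: w) = (lq j (subst p g)) w by [].
rewrite !lq_subst; case: (p j) => [i|]; last by rewrite mulr0 mul0r addr0.
by rewrite lq_mul substD substZ addsE scalesE IH.
Qed.
Lemma subst_van d f : vanish d f -> vanish d (subst p f).
Proof.
move=> Hf w wd; rewrite substE; case: ifP => // _; apply: Hf.
by apply: leq_ltn_trans wd; rewrite size_pmap count_size.
Qed.
Lemma subst_var i : subst p (var i : series k n) = \sum_(j | p j == Some i) var j.
Proof.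
apply: series_eq => [|j]; first by rewrite subst_nil sumsE big1.
rewrite lq_subst lq_sum; case E: (p j) => [i'|].
  rewrite lq_var; case: (i' =P i) => [Ei|ne].
    rewrite mulr1n subst1 (bigD1 j) ?E ?Ei //= lq_var eqxx big1 ?addr0 ?mulr1n //.
    by move=> l /andP[_ lj]; rewrite lq_var eq_sym (negPf lj).
  rewrite mulr0n subst0 big1 // => l /eqP pl; rewrite lq_var; case: eqP => // jl.
  by case: ne; move: E; rewrite jl pl => -[].
by rewrite big1 // => l /eqP pl; rewrite lq_var; case: eqP => // jl; move: E; rewrite jl pl.
Qed.
Lemma shom_subst d f : shom d (subst p f) = subst p (shom d f).
Proof.
apply/funext=> w; rewrite /shom !substE; case A: (all _ w); last by case: eqP.
by rewrite size_pmap (eqP (_ : count _ w == size w)) // -all_count.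
Qed.
Lemma subst_br f g : subst p (br f g) = br (subst p f) (subst p g).
Proof. by rewrite /br substB !subst_mul. Qed.
Lemma lie_subst f : lie_series f -> lie_series (subst p f).
Proof.
move=> Lf d; rewrite shom_subst; elim/lie_poly_ind': _ / (Lf d) => [|i|a b _ _|a b _|a b _ _].
- by rewrite subst0; exact: lie_poly0.
- by rewrite subst_var; apply: lie_poly_sum => j _; exact: LPx.
- by rewrite substD; exact: lie_polyD.
- by rewrite substZ; exact: lie_polyZ.
- by rewrite subst_br; exact: lie_poly_br.
Qed.

Lemma cofaceE u j i : p j = Some i -> coface p u j = subst p (u i).
Proof. by rewrite /coface => ->. Qed.
Lemma coface_None u j : p j = None -> coface p u j = 0.
Proof. by rewrite /coface => ->. Qed.
Lemma nilfree_coface u : nilfree u -> nilfree (coface p u).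
Proof. by move=> u0 j; rewrite /coface; case: (p j) => [i|] //; rewrite subst_nil. Qed.
Lemma tder_coface u : tder u -> tder (coface p u).
Proof.
move=> [Lu Nu]; split=> j; rewrite /coface; case E: (p j) => [i|] //.
- by apply: lie_subst; apply: Lu.
- exact: lie_series0.
- by rewrite substE /= ?E /= ?E /= Nu.
Qed.
Lemma coface_van u d : (forall i, vanish d (u i)) -> forall j, vanish d (coface p u j).
Proof. by move=> H j; rewrite /coface; case: (p j) => [i|] //; apply: subst_van. Qed.
Lemma coface_tadd u v : coface p (tadd u v) = tadd (coface p u) (coface p v).
Proof.
apply/funext=> j; rewrite /coface /tadd; case: (p j) => [i|]; first exact: substD.
by rewrite addr0.
Qed.
Lemma teq_coface d u v : teq d u v -> teq d (coface p u) (coface p v).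
Proof.
move=> H j; rewrite /coface; case: (p j) => [i|]; first by rewrite -substB; apply: subst_van.
by rewrite subrr; exact: vanish_0.
Qed.

Lemma der_coface u f : nilfree u -> der (coface p u) (subst p f) = subst p (der u f).
Proof.
move=> u0; have c0 := nilfree_coface u0; have Dc := derivation_der c0; have Du := derivation_der u0.
apply: eq_vanish => d; elim: d f => [|d IH] f; first exact: vanish0.
rewrite (series_dec f) substD substZ subst1 (derD Du) (derD Dc) (derZ Du) (derZ Dc).
rewrite !(der_one Du, der_one Dc) !scaler0 !add0r subst_sum (der_sum Du) (der_sum Dc) subst_sum -sumrB.
apply: vanish_sum => i _; rewrite (der_leib Du) substD !subst_mul (der_leib Dc).
have -> : der (coface p u) (subst p (var i)) = subst p (der u (var i)).
  rewrite der_var // subst_br !subst_var (der_sum Dc).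
  rewrite /br mulr_suml mulr_sumr -sumrB; apply: eq_bigr => j /eqP pj.
  by rewrite der_var // (cofaceE u pj).
rewrite opprD addrACA subrr add0r -mulrBr -add1n; apply: vanish_mul => //.
by apply: subst_van; exact: vanish_var.
Qed.
Lemma Mop_coface u i j h : nilfree u -> p j = Some i ->
  Mop (coface p u) j (subst p h) = subst p (Mop u i h).
Proof. by move=> u0 pj; rewrite /Mop der_coface // (cofaceE u pj) substD subst_mul. Qed.

Lemma coface_bev r (U : 'I_r -> tder_el k n) (q : series k r) : nilfam U -> q [::] = 0 ->
  coface p (bev U q) = bev (fun c => coface p (U c)) q.
Proof.
move=> U0 q0; have V0 : nilfam (fun c => coface p (U c)) by move=> c; apply: nilfree_coface.
apply/funext=> j; case E: (p j) => [i|].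
  rewrite (cofaceE _ E) /bev.
  rewrite (ev_intertwine (P' := fun c => Mop (coface p (U c)) j)) ?subst1 //.
  - by move=> c; apply: raising_Mop.
  - by move=> c; apply: raising_Mop.
  - exact: linear_subst.
  - by move=> c h; rewrite (Mop_coface h (U0 c) E).
rewrite coface_None // /bev.
(* Outside the blocks the component is $0$, so all the operators kill $1$ and only the constant term
   of the series acts. *)
have H q' : (q' [::] *: 1 : series k m) = ev (fun c => Mop (coface p (U c)) j) q' 1.
  apply: (ev_uniq (G := fun q' : series k r => q' [::] *: (1 : series k m))) => [c|f'].
    exact: raising_Mop.
  rewrite big1 ?addr0 // => c _; rewrite (raisZ (raising_Mop _ (V0 c))) Mop1 //.
  by rewrite coface_None // scaler0.
by rewrite -H q0 scale0r.
Qed.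
Lemma coface_bch u v : nilfree u -> nilfree v ->
  coface p (bch u v) = bch (coface p u) (coface p v).
Proof.
move=> u0 v0; rewrite /bch coface_bev; [|exact: nilfam2|exact: ch_nil].
by congr (bev _ _); apply/funext=> c; rewrite /fam2; case: ifP.
Qed.

Lemma expD_coface u f : nilfree u -> expD (coface p u) (subst p f) = subst p (expD u f).
Proof.
move=> u0; apply/funext=> w; rewrite substE /expD.
have I j : iter j (der (coface p u)) (subst p f) = subst p (iter j (der u) f).
  by elim: j => //= j ->; rewrite der_coface.
case: ifP => A.
  have -> : size (pmap p w) = size w by rewrite size_pmap; apply/eqP; rewrite -all_count.
  by apply: eq_bigr => j _; rewrite I substE A.
by rewrite big1 // => j _; rewrite I substE A mul0r.
Qed.

Lemma divS_coface u : divS (coface p u) = subst p (divS u).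
Proof.
apply/funext=> -[|j w]; first by rewrite subst_nil.
rewrite [LHS]/= substE /= /coface; case E: (p j) => [i|] //=.
rewrite substE all_rcons E /= -cats1 pmap_cat /= E /=.
by rewrite cats1.
Qed.
Lemma Jser_coface u : nilfree u -> Jser (coface p u) = subst p (Jser u).
Proof.
move=> u0; apply/funext=> w; rewrite substE /Jser divS_coface.
have I j : iter j (der (coface p u)) (subst p (divS u)) = subst p (iter j (der u) (divS u)).
  by elim: j => //= j ->; rewrite der_coface.
case: ifP => A.
  have -> : size (pmap p w) = size w by rewrite size_pmap; apply/eqP; rewrite -all_count.
  by apply: eq_bigr => j _; rewrite I substE A.
by rewrite big1 // => j _; rewrite I substE A mul0r.
Qed.
End Fixed.

Definition pcomp l m n (q : 'I_l -> option 'I_m) (p : 'I_m -> option 'I_n) (j : 'I_l) :=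
  obind p (q j).
Lemma subst_comp l m n (q : 'I_l -> option 'I_m) (p : 'I_m -> option 'I_n) (f : series k n) :
  subst q (subst p f) = subst (pcomp q p) f.
Proof.
apply/funext=> w; rewrite !substE.
have -> : all (fun j => pcomp q p j) w = all (fun j => q j) w && all (fun j => p j) (pmap q w).
  elim: w => //= j w ->; rewrite /pcomp; case: (q j) => [i|] //=.
  by rewrite andbCA.
case: (all (fun j => q j) w) => //=; case: ifP => // _; congr f.
elim: w => //= j w IH; rewrite -[pcomp q p j]/(obind p (q j)); case: (q j) => [i|] //=.
by rewrite IH.
Qed.
Lemma coface_comp l m n (q : 'I_l -> option 'I_m) (p : 'I_m -> option 'I_n) (u : tder_el k n) :
  coface q (coface p u) = coface (pcomp q p) u.
Proof.
apply/funext=> j; rewrite {1}/coface [in RHS]/coface /pcomp; case: (q j) => [i|] //=.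
rewrite /coface; case: (p i) => [i'|]; first by rewrite subst_comp.
exact: subst0.
Qed.
End Coface.

(** * Cyclic words and the divergence cocycle *)

Section Trace.
Context (k : fieldType).

Section Cyc.
Context (n : nat).
Implicit Types (f g h : series k n) (u v : tder_el k n) (w : seq 'I_n).

Definition cyc f w : k := \sum_(i < size w) f (rot i w).
(* [trz f]: the image of [f] in the cyclic coinvariants tr_n vanishes, detected
   by cyclic sums since the characteristic is 0 (see [tr_eqP]) *)
Definition trz f := forall w, cyc f w = 0.

Lemma cycD f g w : cyc (f + g) w = cyc f w + cyc g w.
Proof. by rewrite /cyc -big_split. Qed.
Lemma cycZ a f w : cyc (a *: f) w = a * cyc f w.
Proof. by rewrite /cyc mulr_sumr. Qed.
Lemma cycB f g w : cyc (f - g) w = cyc f w - cyc g w.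
Proof. by rewrite /cyc -sumrB. Qed.
Lemma cyc0 w : cyc 0 w = 0. Proof. by rewrite /cyc big1. Qed.
Lemma cyc_van d f w : vanish d f -> (size w < d)%N -> cyc f w = 0.
Proof. by move=> H wd; rewrite /cyc big1 // => i _; apply: H; rewrite size_rot. Qed.
Lemma cyc_close d f g w : vanish d (f - g) -> (size w < d)%N -> cyc f w = cyc g w.
Proof. by move=> H wd; apply/eqP; rewrite -subr_eq0 -cycB (cyc_van H). Qed.

Lemma trzD f g : trz f -> trz g -> trz (f + g).
Proof. by move=> Hf Hg w; rewrite cycD Hf Hg addr0. Qed.
Lemma trzZ a f : trz f -> trz (a *: f).
Proof. by move=> Hf w; rewrite cycZ Hf mulr0. Qed.
Lemma trzN f : trz f -> trz (- f).
Proof. by rewrite -scaleN1r; apply: trzZ. Qed.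
Lemma trzB f g : trz f -> trz g -> trz (f - g).
Proof. by move=> Hf Hg; apply/trzD/trzN. Qed.
Lemma trz0 : trz 0. Proof. exact: cyc0. Qed.
Lemma trz_sum I (r : seq I) (P : pred I) (F : I -> series k n) :
  (forall i, P i -> trz (F i)) -> trz (\sum_(i <- r | P i) F i).
Proof. by move=> H; elim/big_rec: _ => [|i x Pi Hx]; [exact: trz0 | apply/trzD/Hx/H]. Qed.
Lemma trz_close f : (forall d, exists2 g, trz g & vanish d (f - g)) -> trz f.
Proof. by move=> H w; case: (H (size w).+1) => g Hg /cyc_close ->. Qed.

Lemma cyc_rot1 f w : cyc f (rot 1 w) = cyc f w.
Proof.
case: w => [//|c w]; rewrite /cyc size_rot [in RHS]big_ord_recl big_ord_recr /= addrC.
congr (_ + _).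
  by rewrite -rotD ?addn1 ?rot_size ?rot0 //= rot_oversize.
by apply: eq_bigr => i _; rewrite -rotD ?addn1 //= ltnS ltnW.
Qed.
Lemma cyc_rot f j w : cyc f (rot j w) = cyc f w.
Proof.
elim: j => [|j IH]; first by rewrite rot0.
case: (ltnP j (size w)) => jw; last by rewrite rot_oversize // ltnW.
by rewrite -add1n rotD ?cyc_rot1.
Qed.

(** Rotating a word past its cut exchanges the two factors, and cyclic sums do not see rotations. *)
Lemma trz_br f g : trz (br f g).
Proof.
move=> w; rewrite cycB; apply/eqP; rewrite subr_eq0; apply/eqP.
have E (a b : series k n) : cyc (a * b) w =
    \sum_(j < (size w).+1) \sum_(i < size w) a (take j (rot i w)) * b (drop j (rot i w)).
  rewrite exchange_big; apply: eq_bigr => i _.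
  by rewrite [LHS]/(smul _ _ _) /smul size_rot.
rewrite !E (reindex_inj rev_ord_inj); apply: eq_bigr => -[j jw] _ /=; rewrite subSS.
set F : series k n := fun t => g (take j t) * f (drop j t).
transitivity (cyc F (rot (size w - j) w)); last by rewrite cyc_rot.
rewrite /cyc size_rot; apply: eq_bigr => i _.
rewrite /F rot_rot; set v := rot i w.
have sd : size (drop (size w - j) v) = j by rewrite size_drop size_rot subKn.
have Er : rot (size w - j) v = drop (size w - j) v ++ take (size w - j) v by [].
by rewrite !Er take_size_cat // drop_size_cat // mulrC.
Qed.

(** The partial derivative $\partial_i$ of the divergence, which strips the last letter
    ([divSE]). *)
Definition rq (i : 'I_n) f : series k n := fun w => f (rcons w i).
Lemma rq_mul i f g : rq i (f * g) = f * rq i g + g [::] *: rq i f.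
Proof.
apply/funext=> w; rewrite addsE scalesE /rq; elim: w f => [|c w IH] f.
  by rewrite /= mul_cons mul_nil mul_nil /lq mulrC [g _ * _]mulrC.
by rewrite rcons_cons !mul_cons IH /lq addrA.
Qed.
Lemma rqD i f g : rq i (f + g) = rq i f + rq i g. Proof. by []. Qed.
Lemma rqN i f : rq i (- f) = - rq i f. Proof. by []. Qed.
Lemma rqZ i a f : rq i (a *: f) = a *: rq i f. Proof. by []. Qed.
Lemma rqB i f g : rq i (f - g) = rq i f - rq i g. Proof. by []. Qed.
Lemma rq_var i j : rq i (var j) = (i == j)%:R.
Proof.
apply/funext=> -[|c w]; rewrite /rq /var /xvar eqseq_cons.
  by rewrite andbT; case: (i == j).
by case: (w) => [|? ?]; rewrite /= ?andbF; case: (i == j).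
Qed.
Lemma rq_sum i I (r : seq I) (P : pred I) (F : I -> series k n) :
  rq i (\sum_(j <- r | P j) F j) = \sum_(j <- r | P j) rq i (F j).
Proof. by apply/funext=> w; rewrite /rq !sumsE. Qed.
Lemma series_decr f : f = f [::] *: 1 + \sum_i rq i f * var i.
Proof.
apply/funext=> w; case/lastP: w => [|w c].
  by rewrite addsE sumsE big1 ?addr0 ?scalesE ?mulr1// => i _; rewrite mul_nil var_nil mulr0.
have R (g : series k n) : g (rcons w c) = rq c g w by [].
rewrite !R rqD rqZ rq_sum (bigD1 c) //= rq_mul rq_var eqxx var_nil scale0r addr0 mulr1.
rewrite big1 ?addr0 => [|i ic].
  by rewrite addsE scalesE [rq c 1 w]/(sone _ _) /sone -size_eq0 size_rcons mulr0 add0r.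
by rewrite rq_mul rq_var eq_sym (negPf ic) mulr0 var_nil scale0r addr0.
Qed.

Lemma mull_var_sum (F : 'I_n -> series k n) c w : (\sum_i var i * F i) (c :: w) = F c w.
Proof.
rewrite sumsE (bigD1 c) //= big1 ?addr0 => [|i]; rewrite mul_cons var_nil mul0r add0r lq_var.
  by rewrite eqxx mul1r.
by rewrite eq_sym => /negPf ->; rewrite mul0r.
Qed.
End Cyc.

Section CharZ.
Context (hk : [pchar k] =i pred0).
Section Cyc2.
Context (n : nat).
Implicit Types (f g h : series k n) (u v : tder_el k n) (w : seq 'I_n).

(** A discrete primitive along the orbit of rotations: the weights $-i/N$ are chosen so that [f] is
    the difference of [cyc_prim f] and its rotation as soon as the cyclic sum is zero. *)
Definition cyc_prim f : series k n :=
  fun w => - \sum_(i < size w) i%:R / (size w)%:R * f (rot i w).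

Lemma cyc_primE f w : cyc f w = 0 -> w != [::] -> f w = cyc_prim f w - cyc_prim f (rot 1 w).
Proof.
case: w => [//|c t] H _; set w := c :: t in H *; set N := size t.
have Nw : size w = N.+1 by [].
have N0 : N.+1%:R != 0 :> k by exact: natS_neq0.
rewrite /cyc_prim size_rot Nw opprK big_ord_recl mul0r mul0r add0r.
rewrite [X in _ = _ + X]big_ord_recr /=.
have -> : rot N (rot 1 w) = w by rewrite -rotD ?addn1 //= rot_oversize.
rewrite addrA [- _ + _]addrC -sumrB.
rewrite (eq_bigr (fun i : 'I_N => - (N.+1%:R^-1 * f (rot (lift ord0 i) w)))); last first.
  move=> i _; rewrite lift0 -rotD ?addn1; last by rewrite Nw ltnS ltnW.
  by rewrite -!mulrBl -[i.+1%:R]natr1 opprD addrA subrr add0r !mulNr mul1r.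
have : cyc f w = f w + \sum_(i < N) f (rot (lift ord0 i) w).
  by rewrite /cyc Nw big_ord_recl rot0.
rewrite H => /esym /eqP; rewrite addrC addr_eq0 => /eqP E.
rewrite sumrN -mulr_sumr E mulrN -opprD -mulrDl; congr (- _).
by rewrite -[X in _ + X]div1r -mulrDl natr1 divff // mul1r.
Qed.

Lemma trz_brP f : trz f -> f [::] = 0 ->
  f = \sum_i br (rq i (cyc_prim f)) (var i).
Proof.
move=> Hf f0; set g := cyc_prim f.
have -> : \sum_i br (rq i g) (var i) = (g - g [::] *: 1) - \sum_i var i * rq i g.
  rewrite /br sumrB; congr (_ - _); apply: (addrI (g [::] *: 1)).
  by rewrite -series_decr addrC subrK.
apply/funext=> -[|c w].
  rewrite !(addsE, oppsE, scalesE) sumsE big1 ?f0 ?mulr1 ?subrr ?subr0 // => i _.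
  by rewrite mul_nil var_nil mul0r.
rewrite !(addsE, oppsE) mull_var_sum scalesE mulr0 subr0.
by rewrite (cyc_primE (Hf (c :: w))) // /rq rot1_cons.
Qed.

(** Without its constant term, a trace-zero series is a sum of brackets with letters ([trz_brP]),
    and a derivation sends brackets to sums of brackets. *)
Lemma trz_der u f : nilfree u -> trz f -> trz (der u f).
Proof.
move=> u0 Hf; have Du := derivation_der u0.
set f' := f - f [::] *: 1.
have t1 : trz (1 : series k n).
  move=> w; rewrite /cyc big1 // => i _.
  have -> : (1 : series k n) (rot i w) = (rot i w == [::])%:R by [].
  by rewrite -size_eq0 size_rot; case: (size w) i => [[]|].
have -> : der u f = der u f'.
  by rewrite /f' (raisB (raising_der u0)) (raisZ (raising_der u0)) der1 // scaler0 subr0.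
have f'0 : f' [::] = 0 by rewrite /f' addsE oppsE scalesE mulr1 subrr.
have Hf' : trz f' by apply: trzB => //; apply: trzZ.
rewrite (trz_brP Hf' f'0) (der_sum Du); apply: trz_sum => i _.
by rewrite der_br //; apply: trzD; exact: trz_br.
Qed.

Lemma trz_expD u f : nilfree u -> trz f -> trz (expD u f).
Proof.
move=> u0 Hf w; rewrite /cyc /expD.
under eq_bigr do rewrite size_rot.
rewrite exchange_big big1 // => m _; rewrite -mulr_suml.
have H : trz (iter m (der u) f) by elim: (m : nat) => //= j; apply: trz_der.
by rewrite -/(cyc _ w) H mul0r.
Qed.

Definition trzb d f := forall w, (size w < d)%N -> cyc f w = 0.
Definition strunc d f : series k n := fun w => if (size w < d)%N then f w else 0.
Lemma strunc_van d f : vanish d (f - strunc d f).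
Proof. by move=> w wd; rewrite addsE oppsE /strunc wd subrr. Qed.
Lemma trzb_strunc d f : trzb d f -> trz (strunc d f).
Proof.
move=> H w; case: (ltnP (size w) d) => wd.
  by rewrite -(cyc_close (strunc_van f) wd) H.
rewrite /cyc big1 // => i _; by rewrite /strunc size_rot ltnNge wd.
Qed.
(** The truncation of [f] below degree [d] is trace-zero and stays so under the automorphism; the
    rest starts in degree [d], where $\exp(u)$ acts as the identity to leading order. *)
Lemma trzb_expD u f d : nilfree u -> trzb d f -> trzb d.+1 (expD u f - f).
Proof.
move=> u0 Hf w wd; have Ru := raising_der u0.
have Hg := trzb_strunc Hf; set g := strunc d f in Hg.
have fg : vanish d (f - g) by exact: strunc_van.
have -> : expD u f - f = (expD u g - g) + (expD u (f - g) - (f - g)).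
  have L := linear_oexp Ru (-1) g f; rewrite !scaleN1r addrC -!expD_oexp [- _ + _]addrC in L.
  by rewrite L; sring.
rewrite cycD cycB trz_expD // Hg subrr add0r.
by apply: (cyc_van _ wd); rewrite expD_oexp; apply: oexp_lead.
Qed.
End Cyc2.

Lemma cyc_subst m n (p : 'I_m -> option 'I_n) (f : series k n) w :
  cyc (subst p f) w = if all (fun j => p j) w then cyc f (pmap p w) else 0.
Proof.
rewrite /cyc; case: ifP => A.
  have E : map p w = map Some (pmap p w).
    by elim: w A => //= j w IH /andP[]; case: (p j) => //= i _ /IH ->.
  have sz : size (pmap p w) = size w by rewrite -(size_map Some) -E size_map.
  rewrite sz; apply: eq_bigr => i _.
  have Ei : map p (rot i w) = map Some (rot i (pmap p w)) by rewrite !map_rot E.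
  by rewrite substE (all_of_map Ei) (pmap_of_map Ei).
rewrite big1 // => i _; rewrite substE; case: ifP => // Ai.
suff : all (fun j => p j) w by rewrite A.
by rewrite -(cat_take_drop i w) all_cat andbC -all_cat.
Qed.
Lemma trzb_subst m n (p : 'I_m -> option 'I_n) (f : series k n) d : trzb d f -> trzb d (subst p f).
Proof.
move=> Hf w wd; rewrite cyc_subst; case: ifP => // _; apply: Hf.
by apply: leq_ltn_trans wd; rewrite size_pmap count_size.
Qed.

Section TrEq.
Context (n : nat).
Implicit Types (f g h : series k n).

Definition mono (w : seq 'I_n) : series k n := fun v => (v == w)%:R.
Lemma mono_cons c w : mono (c :: w) = var c * mono w.
Proof.
apply/funext=> -[|d v]; first by rewrite mul_nil var_nil mul0r.
rewrite mul_cons var_nil mul0r add0r lq_var /mono eqseq_cons.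
by case: (d == c); rewrite ?mul1r ?mul0r.
Qed.
Lemma mono_cat (v w : seq 'I_n) : mono v * mono w = mono (v ++ w).
Proof.
elim: v => [|c v IH]; last by rewrite /= !mono_cons -mulrA IH.
have -> : mono [::] = 1 by [].
by rewrite mul1r.
Qed.
Lemma comm_span_trz f : comm_span f -> trz f.
Proof.
elim=> {f} [|v v'|f g _ Hf _ Hg|c f _ Hf|f g _ Hf /funext <- //].
- exact: trz0.
- have -> : (fun w => (w == v ++ v')%:R - (w == v' ++ v)%:R) = br (mono v) (mono v') :> series k n.
    by rewrite /br !mono_cat.
  exact: trz_br.
- exact: trzD.
- exact: trzZ.
Qed.
Lemma comm_span_sum I (r : seq I) (P : pred I) (F : I -> series k n) :
  (forall i, comm_span (F i)) -> comm_span (\sum_(i <- r | P i) F i).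
Proof. by move=> H; elim/big_rec: _ => [|i x _ Hx]; [exact: CS0 | apply: CSadd]. Qed.

(** Conversely to [comm_span_trz], [cyc_primE] writes a homogeneous part with zero cyclic sums as a
    combination of words minus their rotations, and such a difference is a commutator of a letter
    with a word. *)
Lemma tr_eqP f g : tr_eq f g <-> (forall w, w != [::] -> cyc (f - g) w = 0).
Proof.
split=> [H [//|c w] _|H [//|d] _].
  have := comm_span_trz (H (size w).+1 isT) (c :: w) => <-.
  by apply: eq_bigr => i _; rewrite /shom size_rot eqxx.
have <- : f - g = ssub f g by [].
set h := f - g in H *; set q := cyc_prim h.
have -> : shom d.+1 h =
    \sum_(v : (d.+1).-tuple 'I_n) q v *: (mono v - mono (rotr 1 v)).
  apply/funext=> w; rewrite sumsE /shom; case: eqP => [wd|wd].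
    have wn : w != [::] by rewrite -size_eq0 wd.
    rewrite (cyc_primE (H w wn) wn) -/q.
    have sw : size w == d.+1 by rewrite wd.
    have sw' : size (rot 1 w) == d.+1 by rewrite size_rot wd.
    transitivity (\sum_(v : d.+1.-tuple 'I_n) (q v * (w == v :> seq _)%:R - q v * (w == rotr 1 v)%:R)); last first.
      by apply: eq_bigr => v _; rewrite scalesE mulrBr.
    rewrite sumrB (bigD1 (Tuple sw)) //= eqxx mulr1 big1 ?addr0 => [|v /eqP vw]; last first.
      by case: eqP => [E|]; rewrite ?mulr0 //; case: vw; apply: val_inj.
    congr (_ - _); rewrite (bigD1 (Tuple sw')) //= rotK eqxx mulr1 big1 ?addr0 // => v /eqP vw.
    by case: eqP => [E|]; rewrite ?mulr0 //; case: vw; apply: val_inj; rewrite /= E rotrK.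
  rewrite big1 // => v _; rewrite scalesE addsE oppsE /mono.
  case: eqP => [E|_]; first by case: wd; rewrite E size_tuple.
  by case: eqP => [E|_]; [case: wd; rewrite E size_rotr size_tuple | rewrite subrr mulr0].
apply: comm_span_sum => v; apply: CSscale.
case: v => s /= /eqP; case/lastP: s => [//|s c] _.
have -> : rotr 1 (rcons s c) = [:: c] ++ s by rewrite rotr1_rcons.
by rewrite -cats1; apply: CSc.
Qed.
End TrEq.
End CharZ.
End Trace.

(** * The divergence and the group cocycle j *)

Section Divergence.
Context (k : fieldType) (hk : [pchar k] =i pred0).
Context (n : nat).
Implicit Types (f g h : series k n) (u v : tder_el k n) (w : seq 'I_n).

Lemma divS_nil u : divS u [::] = 0. Proof. by []. Qed.
Lemma divSE u : divS u = \sum_i var i * rq i (u i).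
Proof.
apply/funext=> -[|c w]; last by rewrite mull_var_sum.
by rewrite sumsE big1 // => i _; rewrite mul_nil var_nil mul0r.
Qed.
Lemma divS_tadd u v : divS (tadd u v) = divS u + divS v.
Proof. by apply/funext=> -[|c w]; rewrite addsE //= addr0. Qed.
Lemma divS_tscl a u : divS (tscl a u) = a *: divS u.
Proof. by apply/funext=> -[|c w]; rewrite scalesE //= mulr0. Qed.
Lemma divS_tzero : divS (@tzero k n) = 0.
Proof. by apply/funext=> -[|c w]. Qed.

Lemma rq_der u f j : nilfree u ->
  rq j (der u f) = der u (rq j f) + \sum_i rq i f * (var i * rq j (u i)) - rq j f * u j.
Proof.
move=> u0; have Du := derivation_der u0.
rewrite {1}(series_decr f) (derD Du) (derZ Du) (der_one Du) scaler0 add0r (der_sum Du) rq_sum.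
rewrite (eq_bigr (fun i => (j == i)%:R * der u (rq i f) + rq i f * (var i * rq j (u i))
    - (j == i)%:R * (rq i f * u i))); last first.
  move=> i _; rewrite (der_leib Du) rqD der_var // /br.
  have c0 : (var i * u i - u i * var i) [::] = 0.
    by rewrite addsE oppsE !mul_nil u0 var_nil subrr.
  rewrite !rq_mul rqB !rq_mul c0 rq_var u0 var_nil !scale0r !addr0.
  by case: (j == i); rewrite ?mulr1 ?mulr0 ?mul1r ?mul0r ?subr0 // mulrBr addrA.
rewrite sumrB big_split /=; congr (_ + _ - _).
  by rewrite (bigD1 j) //= eqxx mul1r big1 ?addr0 // => i; rewrite eq_sym => /negPf ->; rewrite mul0r.
by rewrite (bigD1 j) //= eqxx mul1r big1 ?addr0 // => i; rewrite eq_sym => /negPf ->; rewrite mul0r.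
Qed.

(** After [rq_der] the terms quadratic in partial derivatives pair up, under exchange of the
    summation indices, into commutators $[x_j\partial_iv_j,x_i\partial_ju_i]$; the remaining ones
    are commutators with $u_j$ and $v_j$. *)
Lemma div_cocycle u v : nilfree u -> nilfree v ->
  trz (der u (divS v) - der v (divS u) - divS (tbr u v)).
Proof.
move=> u0 v0; have Du := derivation_der u0; have Dv := derivation_der v0.
set V := fun i j => var i * rq j (v i); set U := fun i j => var i * rq j (u i).
have E (a b : tder_el k n) : nilfree a -> der a (divS b) =
    \sum_j (var j * a j * rq j (b j) - a j * (var j * rq j (b j)) + var j * der a (rq j (b j))).
  move=> a0; rewrite divSE (der_sum (derivation_der a0)); apply: eq_bigr => j _.
  by rewrite der_mul // der_var // /br mulrBl !mulrA.
have -> : der u (divS v) - der v (divS u) - divS (tbr u v) =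
   \sum_j (br (var j * rq j (v j)) (u j) - br (var j * rq j (u j)) (v j))
   - \sum_j \sum_i br (var j * rq i (v j)) (var i * rq j (u i)).
  have -> : \sum_j \sum_i br (var j * rq i (v j)) (var i * rq j (u i)) =
     \sum_j \sum_i var j * rq i (v j) * (var i * rq j (u i))
     - \sum_j \sum_i var j * rq i (u j) * (var i * rq j (v i)).
    rewrite [X in _ - X]exchange_big -sumrB; apply: eq_bigr => j _; rewrite -sumrB.
    exact: eq_bigr.
  rewrite !E // divSE -!sumrB; apply: eq_bigr => j _.
  rewrite /tbr /br !rqD !rqN !rq_der // !rq_mul u0 v0 !scale0r !addr0.
  set A := \sum_i _; set B := \sum_i _.
  have -> : \sum_i var j * rq i (v j) * (var i * rq j (u i)) = var j * A.
    by rewrite mulr_sumr; apply: eq_bigr => i _; rewrite !mulrA.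
  have -> : \sum_i var j * rq i (u j) * (var i * rq j (v i)) = var j * B.
    by rewrite mulr_sumr; apply: eq_bigr => i _; rewrite !mulrA.
  by rewrite !(mulrDr, mulrN, opprD, opprK, mulrA); sring.
apply: trzB; first by apply: trz_sum => j _; apply: trzB; exact: trz_br.
by apply: trz_sum => j _; apply: trz_sum => i _; exact: trz_br.
Qed.

(* [u] acts on k (+) tr_n by [c + t |-> u t + c div u], the constant term of the
   series playing the role of [c]; since div is a cocycle this is a
   representation modulo commutators. *)
Definition Dop u h := der u h + h [::] *: divS u.
Lemma raising_Dop u : nilfree u -> raising (Dop u).
Proof.
move=> u0; split=> [a f g|[|d] f Hf].
- rewrite /Dop (linear_der u) addsE scalesE scalerDl -scalerA scalerDr; exact: addrACA.
- by apply: vanish1P; rewrite /Dop addsE scalesE der_nil mulr0 addr0.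
- rewrite /Dop (vanish_nil Hf) scale0r addr0; exact: (rais_van (raising_der u0)).
Qed.
Lemma Dop_nil u h : Dop u h [::] = 0.
Proof. by rewrite /Dop addsE scalesE der_nil divS_nil mulr0 addr0. Qed.
Lemma Dop0 u h : h [::] = 0 -> Dop u h = der u h.
Proof. by move=> h0; rewrite /Dop h0 scale0r addr0. Qed.

(** [Dop] reads the constant term as the coefficient of the divergence, so the trace-zero series
    that it preserves are those without one. *)
Definition tz f := trz f /\ f [::] = 0.
Lemma tzD f g : tz f -> tz g -> tz (f + g).
Proof. by move=> [? f0] [? g0]; split; [exact: trzD | rewrite addsE f0 g0 addr0]. Qed.
Lemma tzZ a f : tz f -> tz (a *: f).
Proof. by move=> [? f0]; split; [exact: trzZ | rewrite scalesE f0 mulr0]. Qed.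
Lemma tzB f g : tz f -> tz g -> tz (f - g).
Proof. by move=> Hf Hg; rewrite -[- g]scaleN1r; apply/tzD/tzZ. Qed.
Lemma tz0 : tz 0. Proof. by split; [exact: trz0|]. Qed.
Lemma tz_Dop u f : nilfree u -> tz f -> tz (Dop u f).
Proof. by move=> u0 [Hf f0]; rewrite Dop0 //; split; [exact: trz_der | exact: der_nil]. Qed.

Lemma Dop_tbr u v h : nilfree u -> nilfree v ->
  tz (Dop u (Dop v h) - Dop v (Dop u h) - Dop (tbr u v) h).
Proof.
move=> u0 v0; split; last by rewrite !(addsE, oppsE) !Dop_nil !subr0.
rewrite !(Dop0 _ (Dop_nil _ _)) /Dop der_tbr //.
rewrite !(raisD (raising_der u0)) !(raisD (raising_der v0)) (raisZ (raising_der u0)) (raisZ (raising_der v0)).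
have := trzZ (h [::]) (div_cocycle u0 v0); congr (trz _); rewrite !scalerBr; sring.
Qed.

(** As [Dop] respects brackets modulo [tz], the induction carries trace-zero errors, and [tz_Dop]
    keeps them trace-zero under further operators. *)
Lemma bev_Dop_poly r (U : 'I_r -> tder_el k n) (p : series k r) h : nilfam U -> lie_poly p ->
  tz (ev (fun c => Dop (U c)) p h - Dop (bev U p) h).
Proof.
move=> U0 Lp; have R0 c : raising (Dop (U c)) by exact: raising_Dop.
elim/lie_poly_ind': p / Lp h => [|c|p q Lp Lq IHp IHq|a q Lq IHq|p q Lp Lq IHp IHq] h.
- rewrite ev0l // bev0 // /Dop der_tzero divS_tzero scaler0 addr0 subrr; exact: tz0.
- rewrite ev_var // bev_var // subrr; exact: tz0.
- rewrite evDl // bevD //.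
  have p0 := bev_nilfree U0 (lie_poly_nil Lp); have q0 := bev_nilfree U0 (lie_poly_nil Lq).
  have := tzD (IHp h) (IHq h); congr tz.
  rewrite /Dop der_tadd // divS_tadd scalerDr; sring.
- rewrite evZl // bevZ //; have q0 := bev_nilfree U0 (lie_poly_nil Lq).
  have := tzZ a (IHq h); congr tz.
  by rewrite scalerBr /Dop der_tscl // divS_tscl scalerDr !scalerA mulrC.
- have p0 := bev_nilfree U0 (lie_poly_nil Lp); have q0 := bev_nilfree U0 (lie_poly_nil Lq).
  rewrite bev_br // /br evBl // !ev_mul //.
  set P := bev U p in p0 IHp *; set Q := bev U q in q0 IHq *.
  set eP := ev _ p in IHp *; set eQ := ev _ q in IHq *.
  have H1 := tzD (IHp (eQ h)) (tz_Dop p0 (IHq h)).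
  have H2 := tzD (IHq (eP h)) (tz_Dop q0 (IHp h)).
  have := tzD (tzB H1 H2) (Dop_tbr h p0 q0); congr tz.
  rewrite (raisB (raising_Dop p0)) (raisB (raising_Dop q0)); sring.
Qed.

Lemma Dop_close u v d h : nilfree u -> nilfree v ->
  (forall i, vanish d.+1 (u i - v i)) -> vanish d.+1 (Dop u h - Dop v h).
Proof.
move=> u0 v0 H; rewrite /Dop opprD addrACA -scalerBr; apply: vanishD.
  by rewrite -[d.+1]add0n; apply: der_close.
apply: vanishZ => -[|c w] wd; first by rewrite addsE oppsE !divS_nil subrr.
by have := H c (rcons w c); rewrite addsE oppsE size_rcons => /(_ wd).
Qed.

Lemma bev_Dop r (U : 'I_r -> tder_el k n) (p : series k r) h : nilfam U -> lie_series p ->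
  tz (ev (fun c => Dop (U c)) p h - Dop (bev U p) h).
Proof.
move=> U0 Lp; have R0 c : raising (Dop (U c)) by exact: raising_Dop.
have p0 := bev_nilfree U0 (lie_nil Lp); split; last first.
  rewrite addsE oppsE Dop_nil subr0.
  by have := raising_ev R0 (lie_nil Lp) => -[_ H]; apply: (H 0%N h (vanish0 _)).
apply: trz_close => d; set q := \sum_(i < d.+1) shom i p.
have Lq : lie_poly q by exact: lie_series_trunc.
have q0 := bev_nilfree U0 (lie_poly_nil Lq).
have pq : vanish d.+1 (p - q) by exact: trunc_van.
have [Hq _] := bev_Dop_poly h U0 Lq.
exists (ev (fun c => Dop (U c)) q h - Dop (bev U q) h) => //.
apply: (vanishW (leqnSn d)).
set P := ev _ p h; set P' := ev _ q h; set Q := Dop _ h; set Q' := Dop _ h.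
have -> : P - Q - (P' - Q') = (P - P') - (Q - Q') by sring.
apply: vanishB; last by apply: Dop_close => //; apply: bev_close.
by rewrite /P /P' -evBl // -[d.+1]add0n; apply: ev_van.
Qed.

Lemma tz_oexp A B h : raising A -> raising B -> (forall x, tz (A x - B x)) ->
  (forall x, tz x -> tz (B x)) -> trz (oexp A h - oexp B h).
Proof.
move=> HA HB HAB HBt.
have H j : tz (iter j A h - iter j B h).
  elim: j => [|j IH]; first by rewrite subrr; exact: tz0.
  have := tzD (HAB (iter j A h)) (HBt _ IH); congr tz.
  by rewrite /= (raisB HB) addrA subrK.
move=> w; rewrite /cyc /oexp /oser.
under eq_bigr do rewrite addsE oppsE size_rot -sumrB.
rewrite exchange_big big1 // => j _.
have [Hj _] := H j; have := Hj w; rewrite /cyc => E.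
under eq_bigr do rewrite -mulrBr.
by rewrite -mulr_sumr [X in _ * X](_ : _ = 0) ?mulr0 // -[RHS]E.
Qed.

Lemma oexp_Dop_bch u v h : nilfree u -> nilfree v ->
  trz (oexp (Dop (bch u v)) h - oexp (Dop u) (oexp (Dop v) h)).
Proof.
move=> u0 v0; have U0 := nilfam2 u0 v0.
rewrite oexp_comp //; try exact: raising_Dop.
rewrite -opprB; apply: trzN.
have -> : ev (fam2 (Dop u) (Dop v)) (ch k) = ev (fun c => Dop (fam2 u v c)) (ch k).
  by congr ev; apply/funext=> c; rewrite /fam2; case: ifP.
apply: tz_oexp.
- by apply: raising_ev; [move=> c; exact: raising_Dop | exact: ch_nil].
- by apply: raising_Dop; exact: nilfree_bch.
- by move=> x; apply: bev_Dop => //; exact: lie_ch.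
- by move=> x; apply: tz_Dop; exact: nilfree_bch.
Qed.

Lemma oexp_Dop0 u h : nilfree u -> h [::] = 0 -> oexp (Dop u) h = expD u h.
Proof.
move=> u0 h0; rewrite expD_oexp; apply/funext=> w; apply: eq_bigr => j _.
have -> : iter j (Dop u) h = iter j (der u) h; last by [].
suff [] : iter j (Dop u) h = iter j (der u) h /\ iter j (der u) h [::] = 0 by [].
by elim: (j : nat) => //= i [-> i0]; rewrite Dop0 // der_nil.
Qed.

(** The first application of [Dop u] to $1$ yields the divergence and the later ones act by [u];
    this shift is the origin of $(m+1)!$ in $j$. *)
Lemma oexp_Dop1 u : nilfree u -> oexp (Dop u) 1 = 1 + Jser u.
Proof.
move=> u0; apply/funext=> w; rewrite addsE /oexp /oser big_ord_recl /ifact fact0 invr1 mul1r.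
congr (_ + _); rewrite /Jser big_ord_recr /=.
have Hi j : iter j.+1 (Dop u) 1 = iter j (der u) (divS u).
  elim: j => [|j IH]; first by rewrite /= /Dop der1 // add0r scale1r.
  rewrite iterS IH Dop0 //; by case: j {IH} => [|j] //=; exact: der_nil.
have Hv : vanish (size w).+1 (iter (size w) (der u) (divS u)).
  by rewrite -add1n; apply: (rais_iter (raising_der u0)); exact: vanish1P.
rewrite Hv // mul0r addr0; apply: eq_bigr => j _.
by rewrite -[Dop u _]/(iter j.+1 (Dop u) 1) Hi mulrC.
Qed.
Lemma Jser_nil u : Jser u [::] = 0.
Proof. by rewrite /Jser big_ord1 /= mul0r. Qed.

Lemma trz_Jser u : nilfree u -> trz (divS u) -> trz (Jser u).
Proof.
move=> u0 Hu w; rewrite /cyc /Jser.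
under eq_bigr do rewrite size_rot.
rewrite exchange_big big1 // => m _; rewrite -mulr_suml.
have H : trz (iter m (der u) (divS u)) by elim: (m : nat) => //= j; apply: trz_der.
by rewrite -/(cyc _ w) H mul0r.
Qed.

(* j(gh) = j(g) + g.j(h) *)
Lemma Jser_bch u v : nilfree u -> nilfree v ->
  trz (Jser (bch u v) - (Jser u + expD u (Jser v))).
Proof.
move=> u0 v0; have uv0 := nilfree_bch u0 v0.
have := oexp_Dop_bch 1 u0 v0; rewrite !oexp_Dop1 //.
have -> : oexp (Dop u) (1 + Jser v) = 1 + Jser u + expD u (Jser v).
  have := linear_oexp (raising_Dop u0) 1 1 (Jser v).
  by rewrite !scale1r oexp_Dop1 // (oexp_Dop0 (h := Jser v)) // Jser_nil.
by congr trz; sring.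
Qed.
End Divergence.

(** * Cohomology of the coface maps *)

Section Cohomology.
Context (k : fieldType) (hk : [pchar k] =i pred0).

Lemma blkE n m (l : seq nat) (j : 'I_m) :
  omap val (blk n l j) = if (nth n l j < n)%N then Some (nth n l j) else None.
Proof. by rewrite /blk; case: insubP => [i -> /= ->|/negPf ->]. Qed.

Lemma pcomp_blkE n m l l' q (j : 'I_q) :
  omap val (pcomp (blk m l) (blk n l') j) =
  if (nth m l j < m)%N then
    if (nth n l' (nth m l j) < n)%N then Some (nth n l' (nth m l j)) else None
  else None.
Proof.
have := blkE m l j; rewrite /pcomp; case: (blk m l j) => [i|] /=; case: ifP => // _ [E].
by rewrite blkE -E.
Qed.

Lemma eq_omap_val n (a b : option 'I_n) : omap val a = omap val b -> a = b.
Proof. by case: a b => [i|] [j|] //= [/val_inj ->]. Qed.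

(** A computable copy of [blk] on natural numbers: composites of cofaces are identified by
    evaluating it on [iota]. *)
Definition oblk n (l : seq nat) j := if (nth n l j < n)%N then Some (nth n l j) else None.

Lemma pcomp_blk q m n l l' l'' :
  all (fun j => obind (oblk n l') (oblk m l j) == oblk n l'' j) (iota 0 q) ->
  pcomp (@blk m q l) (@blk n m l') = @blk n q l''.
Proof.
move=> /allP H; apply/funext=> j; apply: eq_omap_val; rewrite pcomp_blkE blkE.
have /H /eqP : val j \in iota 0 q by rewrite mem_iota /=.
by rewrite /oblk => <-; case: ifP.
Qed.

Lemma blk_id n (l : seq nat) (f : series k n) : l = iota 0 n -> subst (@blk n n l) f = f.
Proof.
move=> ->; apply/funext=> w; rewrite substE.
have H j : @blk n n (iota 0 n) j = Some j.
  by apply: eq_omap_val; rewrite blkE nth_iota // add0n ltn_ord.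
have -> : all (fun j => @blk n n (iota 0 n) j) w by elim: w => //= j w ->; rewrite H.
by congr f; elim: w => //= j w ->; rewrite H.
Qed.

Lemma subst_blk q m n l l' l'' (f : series k n) :
  all (fun j => obind (oblk n l') (oblk m l j) == oblk n l'' j) (iota 0 q) ->
  subst (@blk m q l) (subst (@blk n m l') f) = subst (@blk n q l'') f.
Proof. by move=> H; rewrite subst_comp (pcomp_blk H). Qed.
Lemma coface_blk q m n l l' l'' (u : tder_el k n) :
  all (fun j => obind (oblk n l') (oblk m l j) == oblk n l'' j) (iota 0 q) ->
  coface (@blk m q l) (coface (@blk n m l') u) = coface (@blk n q l'') u.
Proof. by move=> H; rewrite coface_comp (pcomp_blk H). Qed.

Lemma subst_blk_map n m (l : seq nat) T (t : seq T) (g : T -> 'I_m) (h : T -> 'I_n) (f : series k n) :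
  (forall c, nth n l (g c) = h c) ->
  subst (@blk n m l) f (map g t) = f (map h t).
Proof.
move=> H; have E c : @blk n m l (g c) = Some (h c).
  by apply: eq_omap_val; rewrite blkE H ltn_ord.
rewrite substE; have -> : all (fun j => @blk n m l j) (map g t) by elim: t => //= c t ->; rewrite E.
by congr f; elim: t => //= c t ->; rewrite E.
Qed.
Lemma subst_blk_none n m (l : seq nat) (w : seq 'I_m) (f : series k n) :
  has (fun j : 'I_m => (n <= nth n l j)%N) w -> subst (@blk n m l) f w = 0.
Proof.
move=> /hasP [j jw H]; rewrite substE; case: ifP => // /allP /(_ j jw).
by have := blkE n l j; rewrite ltnNge H; case: (blk n l j).
Qed.

Definition thom d n (u : tder_el k n) : tder_el k n := fun i => shom d (u i).
Lemma coface_thom d m n (p : 'I_m -> option 'I_n) (u : tder_el k n) :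
  coface p (thom d u) = thom d (coface p u).
Proof.
apply/funext=> j; rewrite /coface /thom; case: (p j) => [i|]; first by rewrite shom_subst.
by rewrite shom0.
Qed.
Lemma tder_thom d n (u : tder_el k n) : tder u -> tder (thom d u).
Proof.
move=> [Lu Nu]; split=> i; first by apply: lie_poly_series; apply: Lu.
by rewrite /thom /shom Nu; case: eqP.
Qed.

(* the differential of the (truncated) cosimplicial complex lie_2 -> lie_3 *)
Definition d2 (P : series k 2) : series k 3 :=
  subst p2_3 P - subst p12_3 P + subst p1_23 P - subst p1_2 P.

Definition l0 : 'I_3 := Ordinal (isT : (0 < 3)%N).
Definition l1 : 'I_3 := Ordinal (isT : (1 < 3)%N).
Definition l2 : 'I_3 := Ordinal (isT : (2 < 3)%N).
Lemma val_vx : (vx : nat) = 0%N. Proof. by rewrite /vx inordK. Qed.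
Lemma val_vy : (vy : nat) = 1%N. Proof. by rewrite /vy inordK. Qed.

Section Words.
Context (P : series k 2) (d : nat).
Hypothesis HP : forall w, size w = d -> d2 P w = 0.

(** On a word in which the first and the last letter both occur, [subst p1_2] and [subst p2_3]
    vanish, and [d2 P = 0] says that the middle letter may be read as $x$ or as $y$. The type [T]
    decorates the positions: [g] gives the word in three letters, [a] and [b] its two readings. *)
Lemma d2_mixed T (t : seq T) (g : T -> 'I_3) (a b : T -> 'I_2) :
  size t = d -> has (fun c => g c == l0) t -> has (fun c => g c == l2) t ->
  (forall c, nth 2%N [:: 0; 0; 1]%N (g c) = a c) ->
  (forall c, nth 2%N [:: 0; 1; 1]%N (g c) = b c) ->
  P (map a t) = P (map b t).
Proof.
move=> td h0 h2 Ha Hb; have := HP (w := map g t); rewrite size_map => /(_ td).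
rewrite /d2 !(addsE, oppsE) /p2_3 /p12_3 /p1_23 /p1_2.
rewrite (subst_blk_map t P Ha) (subst_blk_map t P Hb).
rewrite !subst_blk_none ?has_map.
- by rewrite add0r subr0 => /eqP; rewrite addrC subr_eq0 => /eqP.
- by apply: sub_has h2 => c /= /eqP ->.
- by apply: sub_has h0 => c /= /eqP ->.
Qed.

Lemma d2_pure c : (0 < d)%N -> P (nseq d c) = 0.
Proof.
move=> d0; have map_nseq' T (x : 'I_3) (y : T) : nseq d x = map (fun=> x) (nseq d y).
  by rewrite map_nseq.
have := HP (w := nseq d (if c == vx then l0 else l2)); rewrite size_nseq => /(_ erefl).
rewrite /d2 !(addsE, oppsE) /p2_3 /p12_3 /p1_23 /p1_2.
have Pn (l : seq nat) (x : 'I_3) (y : 'I_2) : nth 2%N l x = y :> nat -> subst (@blk 2 3 l) P (nseq d x) = P (nseq d y).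
  by move=> E; rewrite (map_nseq' nat x 0%N) (subst_blk_map _ _ (h := fun=> y)) // map_nseq.
have P0 (l : seq nat) (x : 'I_3) : nth 2%N l x = 2%N -> subst (@blk 2 3 l) P (nseq d x) = 0.
  by move=> E; apply: subst_blk_none; rewrite has_nseq d0 E.
case: (ord2 c) => ->; rewrite ?eqxx ?vy_vx.
  rewrite P0 // !(Pn _ _ vx) ?val_vx // sub0r addNr sub0r.
  by move=> /eqP; rewrite oppr_eq0 => /eqP.
rewrite [subst _ P _ in X in _ - X]P0 // !(Pn _ _ vy) ?val_vy // subrr add0r subr0.
by [].
Qed.

Let c0 := vx :: nseq d.-1 vy.
Lemma d2_const v : (3 <= d)%N -> size v = d -> vx \in v -> vy \in v -> P v = P c0.
Proof.
move=> d3.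
(* The leading $x$ is the first of the three letters, the other $x$ are middle letters and every $y$
   is the last one; rereading turns the middle letters into $y$. *)
have step1 t : size t = d.-1 -> vy \in t -> P (vx :: t) = P c0.
  move=> td yt.
  pose g (c : bool * 'I_2) := if c.1 then l0 else if c.2 == vx then l1 else l2.
  pose a (c : bool * 'I_2) := if c.1 then vx else c.2.
  pose b (c : bool * 'I_2) := if c.1 then vx else vy.
  have := @d2_mixed _ ((true, vx) :: map (pair false) t) g a b.
  rewrite /= -!map_comp /= map_id size_map td => H; rewrite H ?prednK //; try lia.
  - by congr P; rewrite /b /= /c0 -td; congr (_ :: _); elim: (t) => //= ? ? ->.
  - by rewrite has_map; apply/hasP; exists vy; rewrite //= /g /= vy_vx.
  - by case=> -[] c; rewrite /g /a /= ?val_vx //; case: (ord2 c) => ->; rewrite ?eqxx ?vy_vx ?val_vx ?val_vy.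
  - by case=> -[] c; rewrite /g /b /= ?val_vx //; case: (ord2 c) => ->; rewrite ?eqxx ?vy_vx ?val_vy.
(* Here the leading $y$ is the middle letter, interchangeable with $x$. *)
have step2 t : size t = d.-1 -> vx \in t -> vy \in t -> P (vy :: t) = P c0.
  move=> td xt yt; rewrite -(step1 t) //.
  pose g (c : bool * 'I_2) := if c.1 then l1 else if c.2 == vx then l0 else l2.
  pose a (c : bool * 'I_2) := if c.1 then vx else c.2.
  pose b (c : bool * 'I_2) := if c.1 then vy else c.2.
  have := @d2_mixed _ ((true, vx) :: map (pair false) t) g a b.
  rewrite /= -!map_comp /= map_id size_map td => H; rewrite H ?prednK //; try lia.
  - by rewrite has_map; apply/hasP; exists vx; rewrite //= /g /= eqxx.
  - by rewrite has_map; apply/hasP; exists vy; rewrite //= /g /= vy_vx.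
  - by case=> -[] c; rewrite /g /a /= ?val_vx //; case: (ord2 c) => ->; rewrite ?eqxx ?vy_vx ?val_vx ?val_vy.
  - by case=> -[] c; rewrite /g /b /= ?val_vy //; case: (ord2 c) => ->; rewrite ?eqxx ?vy_vx ?val_vx ?val_vy.
case: v => [|c t] //= td; have {}td : size t = d.-1 by rewrite -td.
case: (ord2 c) => ->; rewrite !inE ?eqxx ?vx_vy ?vy_vx ?orbF /=; first by move=> _; exact: step1.
move=> xt _; case: (boolP (vy \in t)) => yt; first exact: step2.
(* The one word left is $yx^{d-1}$: its first $x$ is kept and the other ones, middle letters, become
   $y$; there are some because $d\ge3$. *)
have Et : t = vx :: nseq d.-2 vx.
  have : all (pred1 vx) t.
    apply/allP => e et; case: (ord2 e) => Ee; rewrite Ee //= in et *.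
    by rewrite et in yt.
  by move/all_pred1P; rewrite td; case: (d) d3 => [|[|]].
have d2y : (0 < d.-2)%N by lia.
rewrite -(step2 (vx :: nseq d.-2 vy)) /=; first last.
- by rewrite inE vy_vx /= mem_nseq d2y eqxx.
- by rewrite inE eqxx.
- by rewrite size_nseq; lia.
rewrite Et.
pose g (c : nat) := if c is 0 then l2 else if c is 1 then l0 else l1.
pose a (c : nat) := if c is 0 then vy else vx.
pose b (c : nat) := if c is 1 then vx else vy.
have := @d2_mixed _ (0%N :: 1%N :: nseq d.-2 2%N) g a b; rewrite /= !map_nseq size_nseq.
move=> H; apply: H => //.
- by lia.
- by case=> [|[|e]]; rewrite /= ?val_vx ?val_vy.
- by case=> [|[|e]]; rewrite /= ?val_vx ?val_vy.
Qed.
End Words.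
End Cohomology.

(** * Exactness for Lie series *)

Section LieCohomology.
Context (k : fieldType) (hk : [pchar k] =i pred0).

Section OneLetter.
Context (n : nat) (a b : 'I_n).
Implicit Types f g : series k n.

(** For [a] and [b] distinct, the coefficient of $a^mb$ in the commutative image of [f]. Commutators
    have zero commutative image, which is why Lie series of degree at least two are annihilated. *)
Definition theta f m : k := \sum_(i < m.+1) f (nseq i a ++ b :: nseq (m - i) a).

Lemma thetaD f g m : theta (f + g) m = theta f m + theta g m.
Proof. by rewrite /theta -big_split. Qed.
Lemma thetaZ c f m : theta (c *: f) m = c * theta f m.
Proof. by rewrite /theta mulr_sumr. Qed.
Lemma theta_rec f m :
  theta f m = f (b :: nseq m a) + if m is m'.+1 then theta (lq a f) m' else 0.
Proof.
rewrite /theta big_ord_recl subn0; congr (_ + _); case: m => [|m]; first by rewrite big_ord0.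
by apply: eq_bigr => i _; rewrite lift0 subSS.
Qed.

Lemma mul_nseqE f g m :
  (f * g) (nseq m a) = \sum_(j < m.+1) f (nseq j a) * g (nseq (m - j) a).
Proof.
rewrite [LHS]/(smul _ _ _) /smul size_nseq; apply: eq_bigr => -[j jm] _ /=.
by rewrite take_nseq // drop_nseq.
Qed.

Lemma theta_mul f g m : theta (f * g) m =
  \sum_(j < m.+1) (f (nseq j a) * theta g (m - j) + theta f j * g (nseq (m - j) a)).
Proof.
elim: m f => [|m IH] f.
  rewrite big_ord1 subnn /theta !big_ord1 /= mul_cons mul_nil.
  by [].
rewrite theta_rec mul_cons mul_nseqE lq_mul thetaD thetaZ IH !big_split /=.
have -> : \sum_(j < m.+2) f (nseq j a) * theta g (m.+1 - j) =
    f [::] * theta g m.+1 + \sum_(j < m.+1) lq a f (nseq j a) * theta g (m - j).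
  by rewrite big_ord_recl subn0; congr (_ + _); apply: eq_bigr => j _; rewrite lift0 subSS.
have -> : \sum_(j < m.+2) theta f j * g (nseq (m.+1 - j) a) =
    \sum_(j < m.+2) lq b f (nseq j a) * g (nseq (m.+1 - j) a)
    + \sum_(j < m.+1) theta (lq a f) j * g (nseq (m - j) a).
  transitivity (\sum_(j < m.+2) (lq b f (nseq j a) * g (nseq (m.+1 - j) a)
     + (if (j : nat) is j'.+1 then theta (lq a f) j' else 0) * g (nseq (m.+1 - j) a))).
    by apply: eq_bigr => j _; rewrite theta_rec mulrDl.
  rewrite big_split /=; congr (_ + _); rewrite big_ord_recl /= mul0r add0r.
  by apply: eq_bigr => j _; rewrite -[bump 0 j]/j.+1 subSS.
rewrite [theta g m.+1]theta_rec /=; ring.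
Qed.

Lemma theta_lie f m : lie_series f -> (0 < m)%N -> theta f m = 0.
Proof.
move=> Lf m0; have -> : theta f m = theta (shom m.+1 f) m.
  apply: eq_bigr => i _; rewrite /shom size_cat /= !size_nseq addnS subnKC ?eqxx //.
  by rewrite -ltnS.
elim/lie_poly_ind': _ / (Lf m.+1) => [|i|p q _ _|c p _|p q _ _ _ _].
- by rewrite /theta big1.
- rewrite /theta big1 // => j _; case: m m0 j => // m _ [[|j] jm] /=.
    by rewrite /var /xvar eqseq_cons andbF.
  by rewrite /var /xvar eqseq_cons; case: j {jm} => [|j] /=; rewrite andbF.
- by rewrite thetaD => -> ->; rewrite addr0.
- by rewrite thetaZ => ->; rewrite mulr0.
- rewrite /br thetaD -scaleN1r thetaZ mulN1r !theta_mul -sumrB.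
  rewrite sumrB [X in _ - X](reindex_inj rev_ord_inj) -sumrB big1 // => -[j jm] _ /=.
  rewrite subSS subKn //; ring.
Qed.
End OneLetter.

Lemma lie_H2 (P : series k 2) d : (3 <= d)%N -> lie_series P ->
  (forall w, size w = d -> d2 P w = 0) -> forall v, size v = d -> P v = 0.
Proof.
move=> d3 LP HP; have d0 : (0 < d)%N by lia.
case: d d3 d0 HP => // d d3 d0 HP.
have C := d2_const HP d3; set c := P (vx :: nseq d.+1.-1 vy) in C.
have c0 : c = 0.
  (* All words with one $x$ and [d] letters $y$ have the value [c], and [theta] adds them up to
     zero. *)
  have : \sum_(i < d.+1) c = 0.
    rewrite -[RHS](theta_lie vy vx LP (m := d)); last by lia.
    rewrite /theta; apply: eq_bigr => i _; rewrite C; [by []| | |].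
    - by rewrite size_cat /= !size_nseq addnS subnKC // -ltnS.
    - by rewrite mem_cat inE eqxx orbT.
    - rewrite mem_cat inE !mem_nseq eqxx !andbT; case: i => i id /=; lia.
  rewrite sumr_const card_ord -mulr_natr => /eqP; rewrite mulf_eq0 => /orP[/eqP//|].
  by rewrite (negPf (natS_neq0 hk d)).
move=> v vd; case: (boolP (vx \in v)) => vxv; case: (boolP (vy \in v)) => vyv.
- by rewrite C.
- have /all_pred1P -> : all (pred1 vx) v.
    apply/allP => e ev; case: (ord2 e) => Ee; rewrite Ee //= in ev *; by rewrite ev in vyv.
  by rewrite vd (d2_pure HP).
- have /all_pred1P -> : all (pred1 vy) v.
    apply/allP => e ev; case: (ord2 e) => Ee; rewrite Ee //= in ev *; by rewrite ev in vxv.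
  by rewrite vd (d2_pure HP).
- case: v vd vxv vyv => [|e v] /= vd; first by rewrite -vd in d0.
  by rewrite !inE; case: (ord2 e) => ->; rewrite ?eqxx.
Qed.

Lemma lie_deg2 n (f : series k n) a b : lie_series f -> f [:: a; b] = - f [:: b; a].
Proof.
move=> Lf; have := theta_lie a b Lf (m := 1) isT.
by rewrite /theta big_ord_recl big_ord1 /= => /eqP; rewrite addrC addr_eq0 => /eqP.
Qed.

(* The linear parts of the twist equation and of the pentagon. *)
Definition dT2 (u : tder_el k 2) : tder_el k 3 := fun j =>
  coface p2_3 u j - coface p12_3 u j + coface p1_23 u j - coface p1_2 u j.
Definition dT3 (u : tder_el k 3) : tder_el k 4 := fun j =>
  coface p2_3_4 u j - coface p12_3_4 u j + coface p1_23_4 u j - coface p1_2_34 u j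
  + coface p1_2_3 u j.

Lemma coface_addN m n (p : 'I_m -> option 'I_n) (u v : tder_el k n) j :
  coface p (fun i => u i - v i) j = coface p u j - coface p v j.
Proof. by rewrite /coface; case: (p j) => [i|]; rewrite ?substB // subr0. Qed.
Lemma coface_addP m n (p : 'I_m -> option 'I_n) (u v : tder_el k n) j :
  coface p (fun i => u i + v i) j = coface p u j + coface p v j.
Proof. by rewrite /coface; case: (p j) => [i|]; rewrite ?substD // addr0. Qed.

(** By the cosimplicial identities the twenty double cofaces coincide in pairs of opposite signs;
    the lists [l''] name the common composites. *)
Lemma dT3_dT2 u j : dT3 (dT2 u) j = 0.
Proof.
have E p : coface p (dT2 u) j = coface p (coface p2_3 u) j - coface p (coface p12_3 u) j
    + coface p (coface p1_23 u) j - coface p (coface p1_2 u) j.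
  rewrite /dT2 coface_addN; congr (_ - _).
  by rewrite (coface_addP p (fun i => coface p2_3 u i - coface p12_3 u i) (coface p1_23 u)) coface_addN.
rewrite /dT3 !E /p2_3 /p12_3 /p1_23 /p1_2 /p2_3_4 /p12_3_4 /p1_23_4 /p1_2_34 /p1_2_3.
rewrite (coface_blk (l'' := [:: 2; 2; 0; 1]%N)) //.
rewrite (coface_blk (l := [:: 3; 0; 1; 2]%N) (l' := [:: 0; 0; 1]%N) (l'' := [:: 2; 0; 0; 1]%N)) //.
rewrite (coface_blk (l := [:: 3; 0; 1; 2]%N) (l' := [:: 0; 1; 1]%N) (l'' := [:: 2; 0; 1; 1]%N)) //.
rewrite (coface_blk (l := [:: 3; 0; 1; 2]%N) (l' := [:: 0; 1; 2]%N) (l'' := [:: 2; 0; 1; 2]%N)) //.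
rewrite (coface_blk (l := [:: 0; 0; 1; 2]%N) (l' := [:: 2; 0; 1]%N) (l'' := [:: 2; 2; 0; 1]%N)) //.
rewrite (coface_blk (l := [:: 0; 0; 1; 2]%N) (l' := [:: 0; 0; 1]%N) (l'' := [:: 0; 0; 0; 1]%N)) //.
rewrite (coface_blk (l := [:: 0; 0; 1; 2]%N) (l' := [:: 0; 1; 1]%N) (l'' := [:: 0; 0; 1; 1]%N)) //.
rewrite (coface_blk (l := [:: 0; 0; 1; 2]%N) (l' := [:: 0; 1; 2]%N) (l'' := [:: 0; 0; 1; 2]%N)) //.
rewrite (coface_blk (l := [:: 0; 1; 1; 2]%N) (l' := [:: 2; 0; 1]%N) (l'' := [:: 2; 0; 0; 1]%N)) //.
rewrite (coface_blk (l := [:: 0; 1; 1; 2]%N) (l' := [:: 0; 0; 1]%N) (l'' := [:: 0; 0; 0; 1]%N)) //.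
rewrite (coface_blk (l := [:: 0; 1; 1; 2]%N) (l' := [:: 0; 1; 1]%N) (l'' := [:: 0; 1; 1; 1]%N)) //.
rewrite (coface_blk (l := [:: 0; 1; 1; 2]%N) (l' := [:: 0; 1; 2]%N) (l'' := [:: 0; 1; 1; 2]%N)) //.
rewrite (coface_blk (l := [:: 0; 1; 2; 2]%N) (l' := [:: 2; 0; 1]%N) (l'' := [:: 2; 0; 1; 1]%N)) //.
rewrite (coface_blk (l := [:: 0; 1; 2; 2]%N) (l' := [:: 0; 0; 1]%N) (l'' := [:: 0; 0; 1; 1]%N)) //.
rewrite (coface_blk (l := [:: 0; 1; 2; 2]%N) (l' := [:: 0; 1; 1]%N) (l'' := [:: 0; 1; 1; 1]%N)) //.
rewrite (coface_blk (l := [:: 0; 1; 2; 2]%N) (l' := [:: 0; 1; 2]%N) (l'' := [:: 0; 1; 2; 2]%N)) //.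
rewrite (coface_blk (l := [:: 0; 1; 2; 3]%N) (l' := [:: 2; 0; 1]%N) (l'' := [:: 2; 0; 1; 2]%N)) //.
rewrite (coface_blk (l := [:: 0; 1; 2; 3]%N) (l' := [:: 0; 0; 1]%N) (l'' := [:: 0; 0; 1; 2]%N)) //.
rewrite (coface_blk (l := [:: 0; 1; 2; 3]%N) (l' := [:: 0; 1; 1]%N) (l'' := [:: 0; 1; 1; 2]%N)) //.
rewrite (coface_blk (l := [:: 0; 1; 2; 3]%N) (l' := [:: 0; 1; 2]%N) (l'' := [:: 0; 1; 2; 2]%N)) //.
sring.
Qed.
End LieCohomology.

(** * The complex of tangential derivations, component by component *)

Section TderCohomology.
Context (k : fieldType) (hk : [pchar k] =i pred0).

Definition sb n m (l : seq nat) (f : series k n) : series k m := subst (@blk n m l) f.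

Lemma sb_comp q m n l l' l'' (f : series k n) :
  all (fun j => obind (oblk n l') (oblk m l j) == oblk n l'' j) (iota 0 q) ->
  sb l (sb l' f : series k m) = sb l'' f :> series k q.
Proof. exact: subst_blk. Qed.
Lemma sbD n m l (f g : series k n) : sb l (f + g) = sb l f + sb l g :> series k m.
Proof. exact: substD. Qed.
Lemma sbN n m l (f : series k n) : sb l (- f) = - sb l f :> series k m.
Proof. by rewrite -scaleN1r /sb substZ scaleN1r. Qed.
Lemma sb0 n m l : sb l (0 : series k n) = 0 :> series k m.
Proof. exact: subst0. Qed.
Lemma lie_sb n m l (f : series k n) : lie_series f -> lie_series (sb l f : series k m).
Proof. exact: lie_subst. Qed.

Lemma coface_blkE n m (l : seq nat) (u : tder_el k n) (j : 'I_m) (i : 'I_n) :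
  nth n l j = i -> coface (@blk n m l) u j = sb l (u i).
Proof.
move=> E; rewrite (cofaceE u (i := i)) //; apply: eq_omap_val.
by rewrite blkE E ltn_ord.
Qed.
Lemma coface_blk0 n m (l : seq nat) (u : tder_el k n) (j : 'I_m) :
  (n <= nth n l j)%N -> coface (@blk n m l) u j = 0.
Proof.
move=> E; rewrite coface_None //; apply: eq_omap_val; by rewrite blkE ltnNge E.
Qed.

Section T2.
Variable u : tder_el k 2.
Lemma dT2_0 : dT2 u l0 = - sb [:: 0; 0; 1]%N (u vx) + sb [:: 0; 1; 1]%N (u vx) - sb [:: 0; 1; 2]%N (u vx).
Proof.
rewrite /dT2 /p2_3 /p12_3 /p1_23 /p1_2 coface_blk0 // sub0r.
by rewrite !(coface_blkE u (i := vx)) ?val_vx.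
Qed.
Lemma dT2_1 : dT2 u l1 = sb [:: 2; 0; 1]%N (u vx) - sb [:: 0; 0; 1]%N (u vx)
   + sb [:: 0; 1; 1]%N (u vy) - sb [:: 0; 1; 2]%N (u vy).
Proof.
rewrite /dT2 /p2_3 /p12_3 /p1_23 /p1_2.
by rewrite 2?(coface_blkE u (i := vx)) ?val_vx // !(coface_blkE u (i := vy)) ?val_vy.
Qed.
Lemma dT2_2 : dT2 u l2 = sb [:: 2; 0; 1]%N (u vy) - sb [:: 0; 0; 1]%N (u vy) + sb [:: 0; 1; 1]%N (u vy).
Proof.
rewrite /dT2 /p2_3 /p12_3 /p1_23 /p1_2 [X in _ - X]coface_blk0 // subr0.
by rewrite !(coface_blkE u (i := vy)) ?val_vy.
Qed.
End T2.

Lemma sb_single n m l (f : series k n) (c : 'I_n) (w : seq 'I_m) :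
  lie_series f -> size w != 1%N ->
  (forall j : 'I_m, nth n l j = c \/ (n <= nth n l j)%N) -> sb l f w = 0.
Proof.
move=> Lf w1 Hl; rewrite /sb substE; case: ifP => // A.
have E : pmap (@blk n m l) w = nseq (size w) c.
  elim: w A {w1} => //= j w IH /andP[]; have := blkE n l j.
  case: (Hl j) => H; last by rewrite ltnNge H; case: (blk _ _ _).
  rewrite H ltn_ord; case: (blk _ _ _) => //= i [/val_inj ->] _ /IH ->.
  by [].
by rewrite E lie_nseq.
Qed.

Lemma sb_id n l (f : series k n) : l = iota 0 n -> sb l f = f.
Proof. exact: blk_id. Qed.

(** Setting the first variable to zero in the first component leaves [u vx] up to sign and Lie
    series of a single argument, which vanish in degree other than one. For [u vy] the last variable
    is set to zero in the last component. *)
Lemma dT2_inj (u : tder_el k 2) d : tder u -> d != 1%N -> (forall j w, size w = d -> dT2 u j w = 0) ->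
  forall i w, size w = d -> u i w = 0.
Proof.
move=> [Lu _] d1 H i w wd; have w1 : size w != 1%N by rewrite wd.
have szs l : all (fun j => oblk 3 l j) (iota 0 2) -> forall f : series k 3, (forall v, size v = d -> f v = 0) -> sb l f w = 0.
  by move=> Al f Hf; rewrite /sb substE; case: ifP => // A; apply: Hf; rewrite size_pmap -wd; apply/eqP; rewrite -all_count.
case: (ord2 i) => ->.
  have := szs [:: 1; 2]%N isT _ (H l0).
  rewrite dT2_0 !(sbD, sbN) !(addsE, oppsE).
  rewrite (sb_comp (l'' := [:: 0; 1]%N)) // (sb_id (l := [:: 0; 1]%N)) //.
  rewrite (sb_comp (l'' := [:: 1; 1]%N)) // (sb_comp (l'' := [:: 1; 2]%N)) //.
  rewrite !(sb_single (c := vy)) ?val_vy //; first by rewrite addr0 subr0 => /eqP; rewrite oppr_eq0 => /eqP.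
  - by case=> -[|[|?]] //= _; [left|right].
  - by case=> -[|[|?]] //= _; left.
have := szs [:: 0; 1]%N isT _ (H l2).
rewrite dT2_2 !(sbD, sbN) !(addsE, oppsE).
rewrite (sb_comp (l'' := [:: 2; 0]%N)) // (sb_comp (l'' := [:: 0; 0]%N)) //.
rewrite (sb_comp (l'' := [:: 0; 1]%N)) // (sb_id (l := [:: 0; 1]%N)) //.
rewrite !(sb_single (c := vx)) ?val_vx //; first by rewrite ?(subr0, add0r, oppr0, addr0).
- by case=> -[|[|?]] //= _; left.
- by case=> -[|[|?]] //= _; [right|left].
Qed.

Section T3.
Variable u : tder_el k 3.
Definition p0 : 'I_4 := Ordinal (isT : (0 < 4)%N).
Definition p1 : 'I_4 := Ordinal (isT : (1 < 4)%N).
Definition p2 : 'I_4 := Ordinal (isT : (2 < 4)%N).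
Definition p3 : 'I_4 := Ordinal (isT : (3 < 4)%N).
Lemma dT3_0 : dT3 u p0 = - sb [:: 0; 0; 1; 2]%N (u l0) + sb [:: 0; 1; 1; 2]%N (u l0)
   - sb [:: 0; 1; 2; 2]%N (u l0) + sb [:: 0; 1; 2; 3]%N (u l0).
Proof.
rewrite /dT3 /p2_3_4 /p12_3_4 /p1_23_4 /p1_2_34 /p1_2_3 coface_blk0 // sub0r.
by rewrite !(coface_blkE u (i := l0)).
Qed.
Lemma dT3_1 : dT3 u p1 = sb [:: 3; 0; 1; 2]%N (u l0) - sb [:: 0; 0; 1; 2]%N (u l0)
   + sb [:: 0; 1; 1; 2]%N (u l1) - sb [:: 0; 1; 2; 2]%N (u l1) + sb [:: 0; 1; 2; 3]%N (u l1).
Proof.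
rewrite /dT3 /p2_3_4 /p12_3_4 /p1_23_4 /p1_2_34 /p1_2_3.
by rewrite 2?(coface_blkE u (i := l0)) // !(coface_blkE u (i := l1)).
Qed.
Lemma dT3_2 : dT3 u p2 = sb [:: 3; 0; 1; 2]%N (u l1) - sb [:: 0; 0; 1; 2]%N (u l1)
   + sb [:: 0; 1; 1; 2]%N (u l1) - sb [:: 0; 1; 2; 2]%N (u l2) + sb [:: 0; 1; 2; 3]%N (u l2).
Proof.
rewrite /dT3 /p2_3_4 /p12_3_4 /p1_23_4 /p1_2_34 /p1_2_3.
by rewrite 3?(coface_blkE u (i := l1)) // !(coface_blkE u (i := l2)).
Qed.
Lemma dT3_3 : dT3 u p3 = sb [:: 3; 0; 1; 2]%N (u l2) - sb [:: 0; 0; 1; 2]%N (u l2)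
   + sb [:: 0; 1; 1; 2]%N (u l2) - sb [:: 0; 1; 2; 2]%N (u l2).
Proof.
rewrite /dT3 /p2_3_4 /p12_3_4 /p1_23_4 /p1_2_34 /p1_2_3 [X in _ + X]coface_blk0 // addr0.
by rewrite !(coface_blkE u (i := l2)).
Qed.
End T3.

(* Setting the first (resp. last) variable to [0] in [dT3 u = 0] exhibits the
   outer components of [u] as coboundaries of the following series. *)
Definition prim_a (u : tder_el k 3) : series k 2 := - sb [:: 1; 2]%N (u l0).
Definition prim_c (u : tder_el k 3) : series k 2 := sb [:: 0; 1]%N (u l2).

Lemma dT3_solve_0 (u : tder_el k 3) : dT3 u p0 = 0 ->
  u l0 = - sb [:: 0; 0; 1]%N (prim_a u) + sb [:: 0; 1; 1]%N (prim_a u) - sb [:: 0; 1; 2]%N (prim_a u).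
Proof.
move=> /(congr1 (fun f => sb [:: 1; 2; 3]%N f : series k 3)).
rewrite dT3_0 !(sbD, sbN) sb0.
rewrite (sb_comp (l'' := [:: 0; 1; 2]%N)) // (sb_id (l := [:: 0; 1; 2]%N)) //.
rewrite !(sb_comp (l' := [:: 1; 2]%N) (l := [:: 0; 0; 1]%N) (l'' := [:: 1; 1; 2]%N)) //.
rewrite !(sb_comp (l' := [:: 1; 2]%N) (l := [:: 0; 1; 1]%N) (l'' := [:: 1; 2; 2]%N)) //.
rewrite !(sb_comp (l' := [:: 1; 2]%N) (l := [:: 0; 1; 2]%N) (l'' := [:: 1; 2; 3]%N)) //.
rewrite (sb_comp (l'' := [:: 1; 1; 2]%N)) // (sb_comp (l'' := [:: 1; 2; 2]%N)) //.
rewrite (sb_comp (l'' := [:: 1; 2; 3]%N)) // => E.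
by rewrite -[LHS]addr0 -E; sring.
Qed.
Lemma dT3_solve_3 (u : tder_el k 3) : dT3 u p3 = 0 ->
  u l2 = sb [:: 2; 0; 1]%N (prim_c u) - sb [:: 0; 0; 1]%N (prim_c u) + sb [:: 0; 1; 1]%N (prim_c u).
Proof.
move=> /(congr1 (fun f => sb [:: 0; 1; 2]%N f : series k 3)).
rewrite dT3_3 !(sbD, sbN) sb0 /prim_c.
rewrite (sb_comp (l := [:: 2; 0; 1]%N) (l'' := [:: 3; 0; 1]%N)) //.
rewrite (sb_comp (l := [:: 0; 0; 1]%N) (l'' := [:: 0; 0; 1]%N)) //.
rewrite (sb_comp (l := [:: 0; 1; 1]%N) (l'' := [:: 0; 1; 1]%N)) //.
rewrite (sb_comp (l'' := [:: 3; 0; 1]%N)) // (sb_comp (l'' := [:: 0; 0; 1]%N)) //.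
rewrite (sb_comp (l'' := [:: 0; 1; 1]%N)) // (sb_comp (l'' := [:: 0; 1; 2]%N)) // (sb_id (l := [:: 0; 1; 2]%N)) //.
by move=> /eqP; rewrite subr_eq0 => /eqP ->.
Qed.

(** Setting the second variable to zero in one middle equation and the third in the other expresses
    [u l1] through the same [P] in two ways; their agreement is [d2 P = 0]. *)
Lemma dT3_solve_b (u : tder_el k 3) : u l0 = 0 -> u l2 = 0 -> dT3 u p1 = 0 -> dT3 u p2 = 0 ->
  let P := sb [:: 0; 2]%N (u l1) : series k 2 in
  (u l1 = sb [:: 0; 1; 1]%N P - sb [:: 0; 1; 2]%N P)
  /\ (u l1 = sb [:: 0; 0; 1]%N P - sb [:: 2; 0; 1]%N P).
Proof.
move=> ua uc; rewrite dT3_1 dT3_2 ua uc !sb0 subrr add0r subr0 addr0 => H1 H2 P.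
split.
  have := congr1 (fun f => sb [:: 0; 2; 3]%N f : series k 3) H1.
  rewrite !(sbD, sbN) sb0 /P (sb_comp (l'' := [:: 0; 1; 2]%N)) // (sb_id (l := [:: 0; 1; 2]%N)) //.
  rewrite (sb_comp (l := [:: 0; 1; 1]%N) (l'' := [:: 0; 2; 2]%N)) //.
  rewrite (sb_comp (l := [:: 0; 1; 2]%N) (l'' := [:: 0; 2; 3]%N)) //.
  rewrite (sb_comp (l'' := [:: 0; 2; 2]%N)) // (sb_comp (l'' := [:: 0; 2; 3]%N)) //.
  by rewrite -addrA => /eqP; rewrite addr_eq0 opprD opprK => /eqP.
have := congr1 (fun f => sb [:: 0; 1; 3]%N f : series k 3) H2.
rewrite !(sbD, sbN) sb0 /P.
rewrite (sb_comp (l := [:: 0; 0; 1]%N) (l'' := [:: 0; 0; 2]%N)) //.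
rewrite (sb_comp (l := [:: 2; 0; 1]%N) (l'' := [:: 3; 0; 2]%N)) //.
rewrite (sb_comp (l'' := [:: 3; 0; 2]%N)) // (sb_comp (l'' := [:: 0; 0; 2]%N)) //.
rewrite (sb_comp (l'' := [:: 0; 1; 2]%N)) // (sb_id (l := [:: 0; 1; 2]%N)) //.
by move=> /eqP; rewrite addrC addr_eq0 opprB => /eqP.
Qed.

Lemma v3E : (v3 0 = l0) * (v3 1 = l1) * (v3 2 = l2).
Proof. by do !split; apply: ord_inj; rewrite /v3 inordK. Qed.

Lemma sb_word n m l (f : series k n) (w : seq 'I_m) (v : seq 'I_n) :
  map (nth n l) (map val w) = map val v -> sb l f w = f v.
Proof.
move=> E; have Ew : map (@blk n m l) w = map Some v.
  elim: w v E => [|j w IH] [|i v] //= [E /IH ->]; congr (_ :: _).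
  by apply: eq_omap_val; rewrite blkE E ltn_ord.
by rewrite /sb substE (all_of_map Ew) (pmap_of_map Ew).
Qed.
Lemma sb_word0 n m l (f : series k n) (w : seq 'I_m) :
  has (fun j => n <= j)%N (map (nth n l) (map val w)) -> sb l f w = 0.
Proof.
by move=> H; apply: subst_blk_none; rewrite -map_comp has_map in H.
Qed.

(** The coboundary terms cancel by antisymmetry of Lie series in degree two. Thus $\pi$ is an
    invariant of classes, and corrections of [W] cannot change it. *)
Lemma pi2_dT2 (u : tder_el k 2) : (forall i, lie_series (u i)) -> pi2 (dT2 u) = 0.
Proof.
move=> Lu; rewrite /pi2 !v3E dT2_0 dT2_1 dT2_2 !(addsE, oppsE).

rewrite (sb_word _ (w := [:: l1; l2]) (l := [:: 0; 0; 1]%N) (v := [:: vx; vy])) /= ?val_vx ?val_vy //.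
rewrite (sb_word _ (w := [:: l1; l2]) (l := [:: 0; 1; 1]%N) (v := [:: vy; vy])) /= ?val_vx ?val_vy //.
rewrite (sb_word0 _ (w := [:: l1; l2]) (l := [:: 0; 1; 2]%N)) //.
rewrite (sb_word0 _ (w := [:: l2; l0]) (l := [:: 2; 0; 1]%N)) //.
rewrite (sb_word _ (w := [:: l2; l0]) (l := [:: 0; 0; 1]%N) (v := [:: vy; vx])) /= ?val_vx ?val_vy //.
rewrite (sb_word _ (w := [:: l2; l0]) (l := [:: 0; 1; 1]%N) (v := [:: vy; vx])) /= ?val_vx ?val_vy //.
rewrite (sb_word0 _ (w := [:: l2; l0]) (l := [:: 0; 1; 2]%N)) //.
rewrite (sb_word0 _ (w := [:: l0; l1]) (l := [:: 2; 0; 1]%N)) //.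
rewrite (sb_word _ (w := [:: l0; l1]) (l := [:: 0; 0; 1]%N) (v := [:: vx; vx])) /= ?val_vx ?val_vy //.
rewrite (sb_word _ (w := [:: l0; l1]) (l := [:: 0; 1; 1]%N) (v := [:: vx; vy])) /= ?val_vx ?val_vy //.
rewrite [u vx [:: vy; vx]]lie_deg2 // [u vy [:: vy; vx]]lie_deg2 //.
rewrite (lie_nseq (m := 2) vy (Lu vx)) // (lie_nseq (m := 2) vx (Lu vy)) //; ring.
Qed.
End TderCohomology.

(** * Cocycles in tder_3 are coboundaries, up to pi *)

Section TderH3.
Context (k : fieldType) (hk : [pchar k] =i pred0).

Lemma ord3P (j : 'I_3) : [\/ j = l0, j = l1 | j = l2].
Proof.
case: j => -[|[|[|//]]] H; [apply: Or31|apply: Or32|apply: Or33]; exact: ord_inj.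
Qed.

Definition homog d n (f : series k n) := shom d f = f.
Lemma homog_val d n (f : series k n) w : homog d f -> size w != d -> f w = 0.
Proof. by move=> <- wd; rewrite /shom (negPf wd). Qed.
Lemma homog_eq0 d n (f : series k n) : homog d f -> (forall w, size w = d -> f w = 0) -> f = 0.
Proof.
move=> Hf H; apply/funext=> w; case: (size w =P d) => [/H //|/eqP wd].
exact: homog_val Hf wd.
Qed.
Lemma homogD d n (f g : series k n) : homog d f -> homog d g -> homog d (f + g).
Proof. by rewrite /homog shomD => -> ->. Qed.
Lemma homogN d n (f : series k n) : homog d f -> homog d (- f).
Proof. by rewrite /homog shomN => ->. Qed.
Lemma homog_sb d n m l (f : series k n) : homog d f -> homog d (sb l f : series k m).
Proof. by rewrite /homog /sb shom_subst => ->. Qed.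

Lemma dT3_sub (u v : tder_el k 3) j : dT3 (fun i => u i - v i) j = dT3 u j - dT3 v j.
Proof. by rewrite /dT3 !coface_addN; sring. Qed.

Lemma homog1_eq0 (f : series k 3) : homog 1 f -> f [:: l0] = 0 -> f [:: l1] = 0 -> f [:: l2] = 0 -> f = 0.
Proof.
move=> Hf H0 H1 H2; apply: (homog_eq0 Hf) => -[|c [|//]] // _.
by case: (ord3P c) => ->.
Qed.

(** In degree one a series is given by its coefficients at letters. Those left free by the
    coboundary formulas are the ones that the normalization of [tder] sets to zero. *)
Lemma tder_H3_1 (u : tder_el k 3) : tder u -> (forall i, homog 1 (u i)) ->
  (forall j, dT3 u j = 0) -> forall i, u i = 0.
Proof.
move=> [Lu Nu] Hu Du.
have Wd n m l (f : series k n) (j : 'I_m) (i : 'I_n) : nth n l j = i -> sb l f [:: j] = f [:: i].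
  by move=> E; apply: sb_word; rewrite /= E.
have Wn n m l (f : series k n) (j : 'I_m) : (n <= nth n l j)%N -> sb l f [:: j] = 0.
  by move=> E; apply: sb_word0; rewrite /= E.
have E0 := dT3_solve_0 (Du p0); have E2 := dT3_solve_3 (Du p3).
set f := prim_a u in E0; set g := prim_c u in E2.
have u0 : u l0 = 0.
  have V0 : u l0 [:: l0] = - f [:: vx].
    rewrite E0 !(addsE, oppsE) !(Wd _ _ _ _ _ vx) ?val_vx //; ring.
  have fx : f [:: vx] = 0 by apply/eqP; rewrite -oppr_eq0 -V0 Nu.
  apply: homog1_eq0 => //.
    rewrite E0 !(addsE, oppsE) (Wd _ _ [:: 0; 0; 1]%N _ _ vx) ?val_vx //.
    rewrite !(Wd _ _ _ _ _ vy) ?val_vy // fx; ring.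
  rewrite E0 !(addsE, oppsE) (Wn _ _ [:: 0; 1; 2]%N) // !(Wd _ _ _ _ _ vy) ?val_vy //; ring.
have u2 : u l2 = 0.
  have gy : g [:: vy] = 0.
    have := Nu l2; rewrite E2 !(addsE, oppsE) !(Wd _ _ _ _ _ vy) ?val_vy //.
    by rewrite subrr add0r.
  apply: homog1_eq0 => //.
    rewrite E2 !(addsE, oppsE) (Wn _ _ [:: 2; 0; 1]%N) // !(Wd _ _ _ _ _ vx) ?val_vx //; ring.
  rewrite E2 !(addsE, oppsE) (Wd _ _ [:: 0; 1; 1]%N _ _ vy) ?val_vy //.
  rewrite !(Wd _ _ _ _ _ vx) ?val_vx // gy; ring.
have [B1 B2] := dT3_solve_b u0 u2 (Du p1) (Du p2).
set P := sb [:: 0; 2]%N (u l1) in B1 B2.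
move=> i; case: (ord3P i) => -> //; apply: homog1_eq0 => //.
  by rewrite B1 !(addsE, oppsE) !(Wd _ _ _ _ _ vx) ?val_vx // subrr.
by rewrite B2 !(addsE, oppsE) !(Wd _ _ _ _ _ vy) ?val_vy // subrr.
Qed.

Lemma lie_dT2 (u : tder_el k 2) : (forall i, lie_series (u i)) -> forall j, lie_series (dT2 u j).
Proof.
move=> Lu j; have L p : lie_series (coface p u j).
  by rewrite /coface; case: (p j) => [i|]; [apply: lie_subst | exact: lie_series0].
by rewrite /dT2; apply: lie_seriesB => //; apply: lie_seriesD => //; apply: lie_seriesB.
Qed.
Lemma homog_dT2 d (u : tder_el k 2) : (forall i, homog d (u i)) -> forall j, homog d (dT2 u j).
Proof.
move=> Hu j; have L p : homog d (coface p u j).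
  rewrite /coface; case: (p j) => [i|]; first by rewrite /homog shom_subst Hu.
  exact: shom0.
by rewrite /dT2; apply: homogD; [apply: homogD => //; apply: homogD|] => //; apply: homogN.
Qed.

Lemma tder_H3 (u : tder_el k 3) d : (2 <= d)%N -> tder u -> (forall i, homog d (u i)) ->
  (forall j, dT3 u j = 0) -> (d = 2%N -> pi2 u = 0) ->
  exists v : tder_el k 2, [/\ tder v, forall i, homog d (v i) & forall j, dT2 v j = u j].
Proof.
move=> d2' [Lu Nu] Hu Du Hpi.
pose v := fam2 (prim_a u) (prim_c u).
have Lv i : lie_series (v i).
  by rewrite /v /fam2; case: ifP => _; [apply: lie_seriesN|]; apply: lie_sb.
have Hv i : homog d (v i).
  by rewrite /v /fam2; case: ifP => _; [apply: homogN|]; apply: homog_sb.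
have vx_ : v vx = prim_a u by exact: fam2x.
have vy_ : v vy = prim_c u by exact: fam2y.
exists v; split=> //.
  by split=> // i; apply: (homog_val (Hv i)) => /=; case: d d2' {Hu Du Hpi Hv} => [|[|]].
(* Subtracting the coboundary of [v] clears the outer components; the middle one is governed by the
   Lie series [P] with [d2 P = 0]. *)
pose u' : tder_el k 3 := fun j => u j - dT2 v j.
have D' j : dT3 u' j = 0 by rewrite /u' dT3_sub Du dT3_dT2 subr0.
have u'0 : u' l0 = 0 by rewrite /u' dT2_0 vx_ -(dT3_solve_0 (Du p0)) subrr.
have u'2 : u' l2 = 0 by rewrite /u' dT2_2 vy_ -(dT3_solve_3 (Du p3)) subrr.
have [] := dT3_solve_b u'0 u'2 (D' p1) (D' p2).
set P := sb [:: 0; 2]%N (u' l1) => B1 B2.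
have LP : lie_series P by apply: lie_sb; apply: lie_seriesB => //; apply: lie_dT2.
have HPd : homog d P.
  by apply: homog_sb; apply: homogD => //; apply: homogN; apply: homog_dT2.
have dP : d2 P = 0.
  have -> : d2 P = (sb [:: 0; 1; 1]%N P - sb [:: 0; 1; 2]%N P) - (sb [:: 0; 0; 1]%N P - sb [:: 2; 0; 1]%N P).
    by rewrite /d2 /sb /p2_3 /p12_3 /p1_23 /p1_2; sring.
  by rewrite -B1 -B2 subrr.
suff P0 : P = 0.
  move=> j; apply/esym/eqP; rewrite -subr_eq0 -/(u' j); apply/eqP.
  case: (ord3P j) => -> //; by rewrite B1 P0 !sb0 subrr.
apply: (homog_eq0 HPd); case: (ltngtP d 2%N) => [|d3|dE]; first by rewrite ltnNge d2'.
  by apply: (lie_H2 hk d3 LP) => w _; rewrite dP.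
(* In degree two [P] is a multiple of $[x,y]$, and that multiple is read off by $\pi$, to which only
   the middle component of [u'] contributes. *)
have Pyx : P [:: vy; vx] = 0.
  have H : u' l1 [:: l2; l0] = pi2 u'.
    by rewrite /pi2 !v3E u'0 u'2 !zerosE add0r addr0.
  have : u' l1 [:: l2; l0] = 0.
    rewrite H /pi2 /u' !(addsE, oppsE).
    have := pi2_dT2 Lv; have := Hpi dE; rewrite /pi2 => E1 E2.
    transitivity (0 - 0 : k); last by rewrite subrr.
    by rewrite -{1}E1 -E2; ring.
  rewrite B1 addsE oppsE (sb_word0 _ (l := [:: 0; 1; 2]%N)) // subr0.
  by rewrite (sb_word _ (v := [:: vy; vx])) //= val_vx val_vy.
rewrite dE => -[|a [|b [|]]] // _.
case: (ord2 a) => ->; case: (ord2 b) => -> //.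
- exact: (lie_nseq (m := 2) vx LP).
- by rewrite lie_deg2 // Pyx oppr0.
- exact: (lie_nseq (m := 2) vy LP).
Qed.
End TderH3.

(** * The pentagon and the twist equation *)

Section Commutation.
Context (k : fieldType) (hk : [pchar k] =i pred0).

(** On the letters of the blocks [v] coincides with the inner derivation $[\cdot,f]$, hence on
    everything they generate. The case $f=0$ handles disjoint supports. *)
Lemma der_subst_br m n (p : 'I_m -> option 'I_n) (v : tder_el k m) (f : series k m) :
  nilfree v -> (forall j, p j -> v j = f) ->
  forall h, der v (subst p h) = br (subst p h) f.
Proof.
move=> v0 Hv h; have Dv := derivation_der v0.
have X i : der v (subst p (var i)) = br (subst p (var i)) f.
  rewrite subst_var (der_sum Dv) /br mulr_suml mulr_sumr -sumrB; apply: eq_bigr => j /eqP pj.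
  by rewrite der_var // Hv ?pj.
apply: eq_vanish => d; elim: d h => [|d IH] h; first exact: vanish0.
rewrite (series_dec h) substD substZ subst1 (derD Dv) (derZ Dv) (der_one Dv) scaler0 add0r.
rewrite subst_sum (der_sum Dv).
have -> : br (h [::] *: 1 + \sum_i subst p (var i * lq i h)) f = \sum_i br (subst p (var i * lq i h)) f.
  by rewrite /br mulrDl mulrDr -scalerAl -scalerAr mul1r mulr1 opprD addrACA subrr add0r mulr_suml mulr_sumr -sumrB.
rewrite -sumrB; apply: vanish_sum => i _; rewrite subst_mul der_mul // X.
have -> : br (subst p (var i)) f * subst p (lq i h) + subst p (var i) * der v (subst p (lq i h))
   - br (subst p (var i) * subst p (lq i h)) f
   = subst p (var i) * (der v (subst p (lq i h)) - br (subst p (lq i h)) f).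
  by rewrite /br !(mulrDl, mulrDr, mulrN, mulNr, mulrA, opprD, opprK); sring.
by rewrite -add1n; apply: vanish_mul => //; apply: subst_van; exact: vanish_var.
Qed.

Lemma der_subst0 m n (p : 'I_m -> option 'I_n) (v : tder_el k m) : nilfree v ->
  (forall i, der v (subst p (var i)) = 0) -> forall h, der v (subst p h) = 0.
Proof.
move=> v0 X h; have Dv := derivation_der v0.
apply: eq_vanish => d; elim: d h => [|d IH] h; first exact: vanish0.
rewrite (series_dec h) substD substZ subst1 (derD Dv) (derZ Dv) (der_one Dv) scaler0 add0r.
rewrite subst_sum (der_sum Dv) subr0; apply: vanish_sum => i _; rewrite subst_mul der_mul // X mul0r add0r.
rewrite -add1n; apply: vanish_mul; first by apply: subst_van; exact: vanish_var.
by have := IH (lq i h); rewrite subr0.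
Qed.

Lemma tbr_disjoint m n n' (p : 'I_m -> option 'I_n) (q : 'I_m -> option 'I_n')
  (u : tder_el k n) (v : tder_el k n') : nilfree u -> nilfree v ->
  (forall j, p j -> q j = None) ->
  tbr (coface p u) (coface q v) = @tzero k m.
Proof.
move=> u0 v0 H; have cu := nilfree_coface p u0; have cv := nilfree_coface q v0.
have Z1 h : der (coface q v) (subst p h) = 0.
  rewrite (der_subst_br (f := 0) cv) ?/br ?mulr0 ?mul0r ?subrr // => j /H.
  exact: coface_None.
have Z2 h : der (coface p u) (subst q h) = 0.
  rewrite (der_subst_br (f := 0) cu) ?/br ?mulr0 ?mul0r ?subrr // => j qj.
  apply: coface_None; case E: (p j) => [i|] //.
  by have := H j; rewrite E => /(_ isT) qN; rewrite qN in qj.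
have R1 := rais0 (raising_der cu); have R2 := rais0 (raising_der cv).
apply/funext=> j; rewrite /tbr /tzero; case Ep: (p j) => [i|].
  rewrite (coface_None v) ?H ?Ep // (cofaceE u Ep) Z1 R1.
  by rewrite /br mulr0 mul0r !subrr addr0.
rewrite (coface_None u Ep) R2 subr0 /br mul0r mulr0 subrr addr0.
case Eq: (q j) => [i'|]; first by rewrite (cofaceE v Eq) Z2.
by rewrite (coface_None v Eq) R1.
Qed.

Lemma sum_var_kill n (u : tder_el k n) : sder u -> der u (\sum_i var i) = 0.
Proof.
move=> Su; apply/funext=> w; rewrite -[RHS](Su w); congr (der u _ w).
by apply/funext=> w'; rewrite sumsE.
Qed.

(* [v] only involves the variables of the block of [u] through their sum, which
   the special derivation [u] kills. *)
Lemma tbr_sder m n n' (p : 'I_m -> option 'I_n) (q : 'I_m -> option 'I_n')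
  (u : tder_el k n) (v : tder_el k n') (i0 : 'I_n') : nilfree u -> nilfree v -> sder u ->
  (forall j, (q j == Some i0) = p j) ->
  tbr (coface p u) (coface q v) = @tzero k m.
Proof.
move=> u0 v0 Su H; have cu := nilfree_coface p u0; have cv := nilfree_coface q v0.
set f := subst q (v i0).
have Z1 h : der (coface q v) (subst p h) = br (subst p h) f.
  apply: der_subst_br => // j pj; apply: cofaceE; apply/eqP; by rewrite H.
have Z2 h : der (coface p u) (subst q h) = 0.
  apply: der_subst0 => // i; rewrite subst_var; case: (i =P i0) => [->|ii].
    have <- : subst p (\sum_i (var i : series k n)) = \sum_(j | q j == Some i0) var j.
      rewrite (subst_sum p); under eq_bigr do rewrite subst_var.
      rewrite (exchange_big_dep xpredT) //= [RHS]big_mkcond; apply: eq_bigr => j _.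
      rewrite H; case: (p j) => [i'|] /=; last by rewrite big_pred0.
      by rewrite (big_pred1 i') // => i''; rewrite eq_sym.
    by rewrite der_coface // sum_var_kill // subst0.
  rewrite (der_sum (derivation_der cu)) big1 // => j /eqP qj; rewrite der_var //.
  rewrite coface_None ?/br ?mulr0 ?mul0r ?subrr //; have := H j; rewrite qj.
  by case: (p j) => // i1 /eqP [E]; case: ii.
have R1 := rais0 (raising_der cu); have R2 := rais0 (raising_der cv).
apply/funext=> j; rewrite /tbr /tzero; have := H j; case Ep: (p j) => [i|] /=.
  by move=> /eqP qj; rewrite (cofaceE u Ep) (cofaceE v qj) Z1 Z2 sub0r addNr.
move=> _; rewrite (coface_None u Ep) R2 subr0 /br mul0r mulr0 subrr addr0.
case Eq: (q j) => [i'|]; first by rewrite (cofaceE v Eq) Z2.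
by rewrite (coface_None v Eq) R1.
Qed.
End Commutation.

(* MacLane's pentagon with a defect: [f], [g], [z] stand for the cofaces of the
   twist, of the associator and of the defect [z] of the twist equation, which
   is central up to the congruence [E]. *)
Section PentagonChain.
Context (T : Type) (op pl : T -> T -> T) (E : T -> T -> Prop) (C : T -> Prop).
Hypotheses (opA : forall x y z, op x (op y z) = op (op x y) z)
  (Etr : forall x y z, E x y -> E y z -> E x z)
  (Esym : forall x y, E x y -> E y x)
  (Eop : forall x y z, E y z -> E (op x y) (op x z))
  (Epl : forall x y z, E x y -> E (pl x z) (pl y z))
  (Cr : forall x y z, C z -> E (op x (pl y z)) (pl (op x y) z))
  (Cl : forall x y z, C z -> E (op (pl x z) y) (pl (op x y) z)).

Lemma pentagon_chain f12 f12_3 f123_4 f34 f12_34 f2_34 f1_234 f23 f1_23 f23_4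
  ga gb gc gd ge za zb zc zd ze :
  C za -> C zb -> C zc -> C zd -> C ze ->
  op (op f12_3 f123_4) ga = pl (op f34 f12_34) za ->
  op (op f12 f12_34) gb = pl (op f2_34 f1_234) zb ->
  op (op f12 f12_3) gc = pl (op f23 f1_23) zc ->
  op (op f1_23 f123_4) gd = pl (op f23_4 f1_234) zd ->
  op (op f23 f23_4) ge = pl (op f34 f2_34) ze ->
  op ga gb = op gc (op gd ge) ->
  op f12 f34 = op f34 f12 -> op gc f123_4 = op f123_4 gc -> op ge f1_234 = op f1_234 ge ->
  E (pl (pl (op f34 (op f2_34 f1_234)) zb) za)
    (pl (pl (pl (op f34 (op f2_34 f1_234)) ze) zd) zc).
Proof.
move=> Ca Cb Cc Cd Ce Ha Hb Hc Hd He Hp H1 H2 H3.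
set M := op f34 (op f2_34 f1_234).
(* [X] is brought to $F^{3,4}F^{2,34}F^{1,234}$ along both sides of the pentagon: two associators
   are absorbed on one side, three on the other, each by a coface of the twist equation and at the
   cost of its defect. *)
pose X := op f12 (op (op (op f12_3 f123_4) ga) gb).
have E1 : E X (pl (pl M zb) za).
  apply: Etr (_ : E X (pl (op f12 (op (op f34 f12_34) gb)) za)) _.
    rewrite /X Ha; apply: Etr (Eop f12 (Cl _ gb Ca)) _; exact: Cr.
  apply: Epl.
  have -> : op f12 (op (op f34 f12_34) gb) = op f34 (op (op f12 f12_34) gb).
    by rewrite !opA H1.
  by rewrite Hb; exact: Cr.
have E2 : E X (pl (pl (pl M ze) zd) zc).
  have -> : X = op (op (op f12 f12_3) gc) (op f123_4 (op gd ge)).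
    rewrite /X -!opA Hp !opA -(opA _ f123_4 gc) -H2. by rewrite !opA.
  rewrite Hc; apply: Etr (Cl _ _ Cc) _; apply: Epl.
  have -> : op (op f23 f1_23) (op f123_4 (op gd ge)) = op f23 (op (op (op f1_23 f123_4) gd) ge).
    by rewrite !opA.
  rewrite Hd.
  apply: Etr (_ : E _ (pl (op f23 (op (op f23_4 f1_234) ge)) zd)) _.
    apply: Etr (Eop f23 (Cl _ ge Cd)) _; exact: Cr.
  apply: Epl.
  have -> : op f23 (op (op f23_4 f1_234) ge) = op (op (op f23 f23_4) ge) f1_234.
    by rewrite -!opA H3.
  by rewrite He /M opA; exact: Cl.
exact: Etr (Esym E1) E2.
Qed.
End PentagonChain.

(** * The defect of the twist equation is a cocycle *)

Section PentagonStep.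
Context (k : fieldType) (hk : [pchar k] =i pred0).

Lemma blk_eqSome n m (l : seq nat) (j : 'I_m) (i : 'I_n) :
  (blk n l j == Some i) = (nth n l j == i :> nat).
Proof.
have := blkE n l j; case: (blk n l j) => [i'|] /=; case: ifP => // H.
  by move=> [<-]; rewrite -[LHS]/(i' == i).
by move=> _; apply/esym/eqP => E; rewrite E ltn_ord in H.
Qed.
Lemma blk_isSome n m (l : seq nat) (j : 'I_m) : blk n l j = (nth n l j < n)%N :> bool.
Proof. by have := blkE n l j; case: (blk n l j) => [i'|] /=; case: ifP. Qed.

(** [bchA] and the congruences assume zero constant terms, while [pentagon_chain] asks for an
    operation with unconditional laws; hence a subtype. *)
Definition tn n := {u : tder_el k n | nilfree u}.
Lemma tn_eq n (x y : tn n) : sval x = sval y -> x = y.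
Proof.
case: x y => [x hx] [y hy] /= E; rewrite {}E in hx *.
by congr exist; exact: Prop_irrelevance.
Qed.
Definition tn_op n (x y : tn n) : tn n := exist _ (bch (sval x) (sval y)) (nilfree_bch (svalP x) (svalP y)).
Lemma nilfree_tadd n (u v : tder_el k n) : nilfree u -> nilfree v -> nilfree (tadd u v).
Proof. by move=> u0 v0 i; rewrite /tadd addsE u0 v0 addr0. Qed.
Definition tn_pl n (x y : tn n) : tn n := exist _ (tadd (sval x) (sval y)) (nilfree_tadd (svalP x) (svalP y)).

Definition assocA (phi : tder_el k 3) (W : tder_el k 2) : tder_el k 3 :=
  bch (bch (coface p1_2 W) (coface p12_3 W)) phi.
Definition assocB (W : tder_el k 2) : tder_el k 3 :=
  bch (coface p2_3 W) (coface p1_23 W).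

Lemma tder_assocA phi W : tder phi -> tder W -> tder (assocA phi W).
Proof. by move=> Hp HW; apply: tder_bch => //; apply: tder_bch => //; apply: tder_coface. Qed.
Lemma tder_assocB W : tder W -> tder (assocB W).
Proof. by move=> HW; apply: tder_bch => //; apply: tder_coface. Qed.

(** The hypothesis compares automorphisms; [expD_inj] brings it back to logarithms, where defects
    can be added. *)
Lemma pentagon_bch (phi : tder_el k 3) : tder phi -> pentagon phi ->
  bch (coface p12_3_4 phi) (coface p1_2_34 phi) =
  bch (coface p1_2_3 phi) (bch (coface p1_23_4 phi) (coface p2_3_4 phi)).
Proof.
move=> Hp H; have T p : tder (coface p phi : tder_el k 4) by exact: tder_coface.
have N p : nilfree (coface p phi : tder_el k 4) by exact: tder_nilfree.
have T2 p q : tder (bch (coface p phi : tder_el k 4) (coface q phi)) by exact: tder_bch.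
apply: expD_inj => //; first exact: tder_bch.
move=> i; rewrite !expD_bch //; last exact: tder_nilfree.
by apply/funext=> t; apply: H.
Qed.

Lemma pentagon_step (phi : tder_el k 3) (W : tder_el k 2) d : tder phi -> sder phi -> pentagon phi -> tder W ->
  teq d.+1 (assocA phi W) (assocB W) ->
  forall j, vanish d.+2 (dT3 (fun i => assocA phi W i - assocB W i) j).
Proof.
move=> Hp Sp Hpent HW HAB.
have p0 := tder_nilfree Hp; have W0 := tder_nilfree HW.
set A := assocA phi W in HAB *; set B := assocB W in HAB *.
set psi : tder_el k 3 := fun i => A i - B i.
have A0 : nilfree A by apply: tder_nilfree; exact: tder_assocA.
have B0 : nilfree B by apply: tder_nilfree; exact: tder_assocB.
have psi0 : nilfree psi by move=> i; rewrite /psi addsE oppsE A0 B0 subrr.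
have AB : A = tadd B psi by apply/funext=> i; rewrite /tadd /psi addrC subrK.
pose cW (p : 'I_4 -> option 'I_2) : tn 4 := exist _ (coface p W) (nilfree_coface p W0).
pose cp (p : 'I_4 -> option 'I_3) : tn 4 := exist _ (coface p phi) (nilfree_coface p p0).
pose cs (p : 'I_4 -> option 'I_3) : tn 4 := exist _ (coface p psi) (nilfree_coface p psi0).
have N2 (p : 'I_3 -> option 'I_2) : nilfree (coface p W) by exact: nilfree_coface.
(* Cofaces respect [bch], so each of them carries the twist equation and its defect to four
   strands. *)
have R (l : seq nat) l12 l12_3 l23 l1_23 :
  all (fun j => obind (oblk 2 [:: 0; 1; 2]%N) (oblk 3 l j) == oblk 2 l12 j) (iota 0 4) ->
  all (fun j => obind (oblk 2 [:: 0; 0; 1]%N) (oblk 3 l j) == oblk 2 l12_3 j) (iota 0 4) ->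
  all (fun j => obind (oblk 2 [:: 2; 0; 1]%N) (oblk 3 l j) == oblk 2 l23 j) (iota 0 4) ->
  all (fun j => obind (oblk 2 [:: 0; 1; 1]%N) (oblk 3 l j) == oblk 2 l1_23 j) (iota 0 4) ->
  tn_op (tn_op (cW (blk 2 l12)) (cW (blk 2 l12_3))) (cp (blk 3 l)) =
  tn_pl (tn_op (cW (blk 2 l23)) (cW (blk 2 l1_23))) (cs (blk 3 l)).
  move=> h1 h2 h3 h4; apply: tn_eq => /=.
  rewrite -(coface_blk W h1) -(coface_blk W h2) -(coface_blk W h3) -(coface_blk W h4).
  rewrite -!coface_bch; try exact: N2; try (exact: nilfree_bch (N2 _) (N2 _)); try exact: p0.
  by rewrite -/(assocA phi W) -/A AB coface_tadd.
have := @pentagon_chain (tn 4) (@tn_op 4) (@tn_pl 4) (fun x y => teq d.+2 (sval x) (sval y))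
  (fun z => forall i, vanish d.+1 (sval z i)) _ _ _ _ _ _ _
  (cW (blk 2 [:: 0; 1; 2; 2]%N)) (cW (blk 2 [:: 0; 0; 1; 2]%N)) (cW (blk 2 [:: 0; 0; 0; 1]%N))
  (cW (blk 2 [:: 2; 2; 0; 1]%N)) (cW (blk 2 [:: 0; 0; 1; 1]%N)) (cW (blk 2 [:: 2; 0; 1; 1]%N))
  (cW (blk 2 [:: 0; 1; 1; 1]%N)) (cW (blk 2 [:: 2; 0; 1; 2]%N)) (cW (blk 2 [:: 0; 1; 1; 2]%N))
  (cW (blk 2 [:: 2; 0; 0; 1]%N))
  (cp p12_3_4) (cp p1_2_34) (cp p1_2_3) (cp p1_23_4) (cp p2_3_4)
  (cs p12_3_4) (cs p1_2_34) (cs p1_2_3) (cs p1_23_4) (cs p2_3_4).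
move=> H j; rewrite -[dT3 psi j]opprK; apply: vanishN.
have {}H := H _ _ _ _ _ _ _ _ _ _ _ _ _ _ _ _ _ _ _ _ _ j.
have -> : - dT3 psi j = sval (tn_pl (tn_pl (tn_op (cW (blk 2 [:: 2; 2; 0; 1]%N))
     (tn_op (cW (blk 2 [:: 2; 0; 1; 1]%N)) (cW (blk 2 [:: 0; 1; 1; 1]%N)))) (cs p1_2_34)) (cs p12_3_4)) j
  - sval (tn_pl (tn_pl (tn_pl (tn_op (cW (blk 2 [:: 2; 2; 0; 1]%N))
     (tn_op (cW (blk 2 [:: 2; 0; 1; 1]%N)) (cW (blk 2 [:: 0; 1; 1; 1]%N)))) (cs p2_3_4)) (cs p1_23_4)) (cs p1_2_3)) j.
  by rewrite /= /tadd /dT3; sring.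
have psid : forall i, vanish d.+1 (psi i) by move=> i; exact: HAB.
apply: H.
- by move=> x y z; apply: tn_eq => /=; apply: bchA => //; exact: svalP.
- by move=> x y z; apply: teq_trans.
- by move=> x y; apply: teq_sym.
- by move=> x y z yz; apply: bch_congr => //; try exact: svalP; exact: teq_refl.
- by move=> x y z xy; apply: teq_tadd => //; exact: teq_refl.
- by move=> x y z Cz; apply: bch_central_r => //; exact: svalP.
- by move=> x y z Cz; apply: bch_central_l => //; exact: svalP.
- exact: coface_van.
- exact: coface_van.
- exact: coface_van.
- exact: coface_van.
- exact: coface_van.
- exact: R.
- exact: R.
- exact: R.
- exact: R.
- exact: R.
- by apply: tn_eq => /=; exact: pentagon_bch.
(* Three commutations: $F^{1,2}$ and $F^{3,4}$ involve different variables, while the special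
   $\Phi^{1,2,3}$ and $\Phi^{2,3,4}$ fix the sums through which $F^{123,4}$ and $F^{1,234}$ see
   their variables. *)
- apply: tn_eq => /=; apply: bch_commC => //; try exact: nilfree_coface.
  apply: tbr_disjoint => // i; rewrite blk_isSome => H; apply: eq_omap_val; rewrite blkE.
  by case: i H => -[|[|[|[|]]]].
- apply: tn_eq => /=; apply: bch_commC => //; try exact: nilfree_coface.
  apply: (tbr_sder (i0 := vx)) => // i; rewrite blk_eqSome blk_isSome val_vx.
  by case: i => -[|[|[|[|]]]].
- apply: tn_eq => /=; apply: bch_commC => //; try exact: nilfree_coface.
  apply: (tbr_sder (i0 := vy)) => // i; rewrite blk_eqSome blk_isSome val_vy.
  by case: i => -[|[|[|[|]]]].
Qed.
End PentagonStep.

(** * Second-order terms of the group law *)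

Section SecondOrder.
Context (k : fieldType) (hk : [pchar k] =i pred0) (n : nat).
Implicit Types (u v : tder_el k n) (f : series k n).

Lemma ev_order2 r m (P : 'I_r -> series k m -> series k m) (p : series k r) h :
  (forall c, raising (P c)) ->
  vanish 3 (ev P p h - (p [::] *: h + \sum_c (p [:: c] *: P c h)
      + \sum_c \sum_e (p [:: c; e] *: P c (P e h)))).
Proof.
move=> HP; rewrite [ev P p h]ev_rec // -[X in _ - X]addrA opprD addrACA subrr add0r.
rewrite -big_split -sumrB; apply: vanish_sum => c _ /=.
have -> : P c (ev P (lq c p) h) - (p [:: c] *: P c h + \sum_e p [:: c; e] *: P c (P e h))
  = P c (ev P (lq c p) h - p [:: c] *: h - \sum_e p [:: c; e] *: P e h).
  rewrite !(raisB (HP c)) (raisZ (HP c)) (rais_sum (HP c)).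
  by under [in RHS]eq_bigr do rewrite (raisZ (HP c)); rewrite opprD addrA.
apply: (rais_van (HP c)); rewrite ev_rec // [_ + \sum_i _]addrC -[X in X - _ - _]/(_ + p [:: c] *: h).
rewrite addrK -sumrB; apply: vanish_sum => e _.
have -> : P e (ev P (lq e (lq c p)) h) - p [:: c; e] *: P e h
  = P e (ev P (lq e (lq c p)) h - p [:: c; e] *: h) by rewrite (raisB (HP e)) (raisZ (HP e)).
apply: (rais_van (HP e)); rewrite ev_rec // addrC addrA addNr add0r.
by apply: vanish_sum => a _; apply: (rais_van (HP a)); exact: vanish0.
Qed.

Lemma bch2 u v i a b : nilfree u -> nilfree v ->
  bch u v i [:: a; b] = u i [:: a; b] + v i [:: a; b] + 2%:R^-1 * tbr u v i [:: a; b].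
Proof.
move=> u0 v0; have H2 : 2%:R != 0 :> k := natS_neq0 hk 1.
have U0 := nilfam2 u0 v0.
have := @ev_order2 _ _ (fun c => Mop (fam2 u v c) i) (ch k) 1 (raising_fam i U0).
move=> /(vanish_eq (w := [:: a; b])) => /(_ isT); rewrite -[ev _ _ _]/(bch u v i) => ->.
rewrite ch_nil // scale0r add0r !sum2 !fam2x !fam2y !ch1 // !ch2 // !Mop1 // !scale1r.
rewrite val_vx val_vy /= !subrr !mul0r !scale0r add0r addr0 sub0r subr0.
have -> : tbr u v i = Mop (tbr u v) i 1 by rewrite Mop1 //; exact: nilfree_tbr.
rewrite Mop_tbr // !Mop1 // !(addsE, scalesE, oppsE); field; exact: H2.
Qed.

Lemma der2 u f a b : der u f [:: a; b] = f [:: a] * u a [:: b] - f [:: b] * u b [:: a].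
Proof.
rewrite /der /= big_ord_recl big_ord1 /= [X in X + _]big_mkcond [X in _ + X]big_mkcond /=.
by rewrite !big_ord_recl !big_ord0 /= !(addr0, add0r).
Qed.

Lemma tbr2 u v i a b : nilfree u -> nilfree v -> tbr u v i [:: a; b] =
  v i [:: a] * u a [:: b] - v i [:: b] * u b [:: a]
  - (u i [:: a] * v a [:: b] - u i [:: b] * v b [:: a])
  + (u i [:: a] * v i [:: b] - v i [:: a] * u i [:: b]).
Proof.
move=> u0 v0; rewrite /tbr /br !(addsE, oppsE) !der2; congr (_ + _).
have M (f g : series k n) : f [::] = 0 -> g [::] = 0 -> (f * g) [:: a; b] = f [:: a] * g [:: b].
  by move=> f0 g0; rewrite !mul_cons mul_nil f0 g0 mulr0 addr0 mul0r add0r.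
by rewrite !M.
Qed.

Lemma tbr_van u v d : nilfree u -> nilfree v -> (forall i, vanish d.+1 (v i)) ->
  forall i, vanish d.+2 (tbr u v i).
Proof.
move=> u0 v0 Hv i; apply: vanishD; first apply: vanishB.
- exact: (rais_van (raising_der u0)).
- have := der_van (d := 1) v0 Hv (vanish1P (u0 i)); by rewrite add1n.
- by rewrite -add1n; apply: br_van => //; apply: vanish1P.
Qed.
End SecondOrder.

(** * Construction of the twist *)

Section Existence.
Context (k : fieldType) (hk : [pchar k] =i pred0).
Context (phi : tder_el k 3) (Hphi : tder phi) (Sphi : sder phi) (Hpent : pentagon phi).
Context (s : k) (Hs : s ^+ 2 / 8%:R = pi2 phi).

Definition W0 : tder_el k 2 := tscale (s / 2%:R) (@rder k).

Lemma W0_tscl : W0 = tscl (s / 2%:R) (@rder k). Proof. by []. Qed.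
Lemma rder_x : rder k vx = var vy. Proof. by rewrite /rder eqxx. Qed.
Lemma rder_y : rder k vy = 0. Proof. by rewrite /rder vy_vx. Qed.
Lemma tder_rder : tder (@rder k).
Proof.
split=> i; case: (ord2 i) => ->; rewrite ?rder_x ?rder_y //.
- exact: lie_series_var.
- exact: lie_series0.
- by rewrite /var /xvar eqseq_cons vx_vy.
Qed.
Lemma tder_W0 : tder W0.
Proof. by rewrite W0_tscl; apply: tder_tscl; exact: tder_rder. Qed.

Lemma thom_dT3 d (u : tder_el k 3) j : dT3 (thom d u) j = shom d (dT3 u j).
Proof. by rewrite /dT3 !coface_thom /thom !(shomD, shomN). Qed.
Lemma homog_thom d n (u : tder_el k n) i : homog d (thom d u i).
Proof. by rewrite /homog /thom shom_shom eqxx. Qed.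
Lemma thom_close d n (u : tder_el k n) i : vanish d (u i) -> vanish d.+1 (u i - thom d u i).
Proof.
move=> H w; rewrite ltnS addsE oppsE /thom /shom; case: eqP => [_|wd]; first by rewrite subrr.
by rewrite leq_eqVlt => /orP[/eqP //|/H ->]; rewrite subr0.
Qed.

Lemma tder_tsub n (u v : tder_el k n) : tder u -> tder v -> tder (fun i => u i - v i).
Proof.
move=> [Lu Nu] [Lv Nv]; split=> i; first exact: lie_seriesB.
by rewrite addsE oppsE Nu Nv subrr.
Qed.

Section Start.
Context (W : tder_el k 2) (HW : tder W) (HW0 : teq 2 W W0).
Let sg := s / 2%:R.

Lemma W_deg1 i c : W i [:: c] = if (i == vx) && (c == vy) then sg else 0.
Proof.
rewrite (vanish_eq (HW0 i)) // /W0 /tscale; case: (ord2 i) => ->; rewrite ?eqxx ?vy_vx /=.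
  by rewrite rder_x /var /xvar eqseq_cons andbT; case: (c == vy); rewrite ?mulr1 ?mulr0.
by rewrite rder_y mulr0.
Qed.

Lemma coface_W_deg1 l (j c : 'I_3) (i e : 'I_2) : nth 2%N l j = i -> nth 2%N l c = e ->
  coface (@blk 2 3 l) W j [:: c] = if (i == vx) && (e == vy) then sg else 0.
Proof.
by move=> Ei Ee; rewrite (coface_blkE W Ei) (sb_word _ (v := [:: e])) /= ?Ee // W_deg1.
Qed.
Lemma coface_W_deg1_out l (j c : 'I_3) : (2 <= nth 2%N l j)%N || (2 <= nth 2%N l c)%N ->
  coface (@blk 2 3 l) W j [:: c] = 0.
Proof.
case: (ltnP (nth 2%N l j) 2) => [Hj /= Hc|Hj _]; last by rewrite coface_blk0.
rewrite (coface_blkE W (i := Ordinal Hj)) // (sb_word0 _ (w := [:: c])) //=.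
by rewrite Hc.
Qed.

(** The element $r$ is a cocycle of degree one, so the parameter $s$ meets no condition before
    degree two. *)
Lemma dT2_W_deg1 j c : dT2 W j [:: c] = 0.
Proof.
have V (l : seq nat) : coface (@blk 2 3 l) W j [:: c] =
   if (nth 2%N l j == 0%N) && (nth 2%N l c == 1%N) then sg else 0.
  case: (ltnP (nth 2%N l j) 2) => Hj; last first.
    have j0 : (nth 2%N l j == 0%N) = false by lia.
    by have -> := coface_blk0 W Hj; rewrite j0.
  case: (ltnP (nth 2%N l c) 2) => Hc; last first.
    have c1 : (nth 2%N l c == 1%N) = false by lia.
    by rewrite coface_W_deg1_out ?Hc ?orbT // c1 andbF.
  rewrite (coface_W_deg1 (i := Ordinal Hj) (e := Ordinal Hc)) // -!val_eqE /= val_vx val_vy. by [].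
rewrite /dT2 !(addsE, oppsE) /p2_3 /p12_3 /p1_23 /p1_2 !V.
by case: (ord3P j) => ->; case: (ord3P c) => ->; rewrite /=; ring.
Qed.

(** The part of the defect linear in [W] is a coboundary and invisible to $\pi$. The brackets of the
    cofaces of $sr/2$ contribute $-(s/2)^2/2$, which cancels $\pi(\phi_2)=s^2/8$. *)
Lemma pi2_assoc : (forall i, vanish 2 (phi i)) ->
  pi2 (fun i => assocA phi W i - assocB W i) = 0.
Proof.
move=> phi2; have w0 := tder_nilfree HW; have f0 := tder_nilfree Hphi.
have N (p : 'I_3 -> option 'I_2) : nilfree (coface p W) by exact: nilfree_coface.
have E i a b : assocA phi W i [:: a; b] - assocB W i [:: a; b] =
  phi i [:: a; b] - dT2 W i [:: a; b]
  + 2%:R^-1 * (tbr (coface p1_2 W) (coface p12_3 W) i [:: a; b]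
              - tbr (coface p2_3 W) (coface p1_23 W) i [:: a; b]).
  rewrite /assocA /assocB !bch2 //; last exact: nilfree_bch.
  have -> : tbr (bch (coface p1_2 W) (coface p12_3 W)) phi i [:: a; b] = 0.
    by apply: (tbr_van (nilfree_bch (N _) (N _)) f0 phi2).
  by rewrite /dT2 !(addsE, oppsE); ring.
rewrite /pi2 !(addsE, oppsE) !E.
have Hpi := pi2_dT2 HW.1; rewrite /pi2 in Hpi.
rewrite !tbr2 // !v3E /p2_3 /p12_3 /p1_23 /p1_2.
have V (l : seq nat) j c : coface (@blk 2 3 l) W j [:: c] =
   if (nth 2%N l j == 0%N) && (nth 2%N l c == 1%N) then sg else 0.
  case: (ltnP (nth 2%N l j) 2) => Hj; last first.
    have j0 : (nth 2%N l j == 0%N) = false by lia.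
    by have -> := coface_blk0 W Hj; rewrite j0.
  case: (ltnP (nth 2%N l c) 2) => Hc; last first.
    have c1 : (nth 2%N l c == 1%N) = false by lia.
    by rewrite coface_W_deg1_out ?Hc ?orbT // c1 andbF.
  rewrite (coface_W_deg1 (i := Ordinal Hj) (e := Ordinal Hc)) // -!val_eqE /= val_vx val_vy. by [].
rewrite !V /=.
have Hp2 : pi2 phi = 2%:R^-1 * sg ^+ 2.
  rewrite -Hs /sg; have h2 : 2%:R != 0 :> k := natS_neq0 hk 1.
  by have h8 : 8%:R != 0 :> k := natS_neq0 hk 7; field; rewrite h2.
rewrite /pi2 !v3E in Hp2; rewrite !v3E in Hpi.
move: (phi l0 [:: l1; l2]) (phi l1 [:: l2; l0]) (phi l2 [:: l0; l1]) (dT2 W l0 [:: l1; l2])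
  (dT2 W l1 [:: l2; l0]) (dT2 W l2 [:: l0; l1]) Hp2 Hpi => a b c d e f Hp Hd.
transitivity ((a + b + c) - (d + e + f) - 2%:R^-1 * sg ^+ 2); first by ring.
by rewrite Hp Hd subr0 subrr.
Qed.
End Start.

Definition sol_upto d W :=
  [/\ tder W, teq 2 W W0 & teq d (assocA phi W) (assocB W)].

Lemma cocycle_dT3 d W : sol_upto d.+1 W ->
  let psi : tder_el k 3 := thom d.+1 (fun i => assocA phi W i - assocB W i) in
  tder psi /\ forall j, dT3 psi j = 0.
Proof.
move=> [HW _ HAB] psi; split.
  by apply: tder_thom; apply: tder_tsub; [exact: tder_assocA | exact: tder_assocB].
move=> j; rewrite /psi thom_dT3; apply: shom_van.
exact: pentagon_step.
Qed.

(** The degree-one part of the defect is a cocycle, and by [tder_H3_1] the only one is zero. *)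
Lemma sol_upto2 : sol_upto 2 W0.
Proof.
have H1 : sol_upto 1 W0.
  split; [exact: tder_W0 | exact: teq_refl |].
  by apply: teq1; apply: tder_nilfree; [exact: tder_assocA tder_W0 | exact: tder_assocB tder_W0].
have [T D] := cocycle_dT3 H1.
split; [exact: tder_W0 | exact: teq_refl |] => i.
have [_ _ HAB] := H1.
have := thom_close (HAB i : vanish 1 ((fun i => assocA phi W0 i - assocB W0 i) i)).
by rewrite (tder_H3_1 T (fun i => homog_thom _ _ _)) // subr0.
Qed.

(** In degree one the twist equation identifies $\phi$ with the coboundary of [W], which is zero by
    [dT2_W_deg1]. Hence brackets with $\phi$ do not enter the computation of $\pi$ in degree two. *)
Lemma phi_van2 W : sol_upto 2 W -> forall i, vanish 2 (phi i).
Proof.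
move=> [HW HW0 HAB] i [|c [|//]] _; first exact: tder_nilfree.
have w0 := tder_nilfree HW; have f0 := tder_nilfree Hphi.
have N (p : 'I_3 -> option 'I_2) : nilfree (coface p W) by exact: nilfree_coface.
have lin (u v : tder_el k 3) j : nilfree u -> nilfree v -> bch u v j [:: c] = u j [:: c] + v j [:: c].
  move=> u0 v0; have z0 := @nilfree0 k 3.
  have := bch_pert hk u0 v0 z0 z0 (teq1 u0 z0) (teq1 v0 z0) j => /(vanish_eq (w := [:: c])).
  rewrite bch0u // /tadd /tzero !addsE !zerosE !addr0 => /(_ isT) ->. by rewrite add0r.
have := vanish_eq (HAB i) (w := [:: c]) isT.
rewrite /assocA /assocB !lin //; last exact: nilfree_bch.
have := dT2_W_deg1 HW0 i c; rewrite /dT2 !(addsE, oppsE) => E1 E2.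
move: E1 E2; move: (coface p2_3 W i [:: c]) (coface p12_3 W i [:: c]) (coface p1_23 W i [:: c]) (coface p1_2 W i [:: c]) (phi i [:: c]).
move=> a b e g f E1 /eqP; rewrite -subr_eq0 => /eqP E2.
transitivity (a - b + e - g + (g + b + f - (a + e))); first by ring.
by rewrite E1 E2 addr0.
Qed.

(** A correction in degree [d.+1] is central to the order considered, so its four cofaces come out
    of the products additively. The same formula drives the construction and the uniqueness. *)
Lemma assoc_tadd d W v : nilfree W -> nilfree v -> (forall i, vanish d.+1 (v i)) ->
  forall i, vanish d.+2 (assocA phi (tadd W v) i - assocB (tadd W v) i
    - (assocA phi W i - assocB W i - dT2 v i)).
Proof.
move=> w0 v0 v_van; have f0 := tder_nilfree Hphi.
have N (p : 'I_3 -> option 'I_2) : nilfree (coface p W) by exact: nilfree_coface.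
have Nv (p : 'I_3 -> option 'I_2) i : vanish d.+1 (coface p v i) by exact: coface_van.
have N0 (p : 'I_3 -> option 'I_2) : nilfree (coface p v) by exact: nilfree_coface.
have Nt (p : 'I_3 -> option 'I_2) : nilfree (tadd (coface p W) (coface p v)) by exact: nilfree_tadd.
have C2 (p q : 'I_3 -> option 'I_2) :
  teq d.+2 (bch (coface p (tadd W v)) (coface q (tadd W v)))
    (tadd (tadd (bch (coface p W) (coface q W)) (coface q v)) (coface p v)).
  rewrite !coface_tadd.
  apply: teq_trans (bch_central_l hk (N p) (Nt q) (Nv p)) _.
  by apply: teq_tadd; [exact: bch_central_r | exact: teq_refl].
have HA : teq d.+2 (assocA phi (tadd W v))
    (tadd (tadd (assocA phi W) (coface p12_3 v)) (coface p1_2 v)).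
  have Nb : nilfree (bch (coface p1_2 W) (coface p12_3 W)) by exact: nilfree_bch.
  apply: teq_trans (bch_congr hk _ f0 _ f0 (C2 _ _) (@teq_refl _ _ _ _)) _.
  - by apply: nilfree_bch; rewrite coface_tadd.
  - by apply: nilfree_tadd => //; exact: nilfree_tadd.
  apply: teq_trans (bch_central_l hk _ f0 (Nv _)) _; first exact: nilfree_tadd.
  by apply: teq_tadd; [exact: bch_central_l | exact: teq_refl].
move=> i; have := vanishB (HA i) (C2 p2_3 p1_23 i).
rewrite -/(assocB (tadd W v)) -/(assocB W).
set x := assocA phi (tadd W v) i; set y := assocB (tadd W v) i => H.
suff -> : x - y - (assocA phi W i - assocB W i - dT2 v i) = x - tadd (tadd (assocA phi W) (coface p12_3 v)) (coface p1_2 v) i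
  - (y - tadd (tadd (assocB W) (coface p1_23 v)) (coface p2_3 v) i) by [].
by rewrite /dT2 /tadd; sring.
Qed.

Lemma sol_step d W : (2 <= d)%N -> sol_upto d W ->
  exists W', sol_upto d.+1 W' /\ teq d W' W.
Proof.
case: d => // d d2' HS; have [HW HW0 HAB] := HS.
have [T D] := cocycle_dT3 HS; set psi := thom _ _ in T D.
have Hpi : d.+1 = 2%N -> pi2 psi = 0.
  move=> dE; rewrite dE in HS.
  have := pi2_assoc HW HW0 (phi_van2 HS); rewrite /pi2 /psi dE /thom /shom /=. by [].
have [v [Tv Hv Dv]] := tder_H3 hk d2' T (fun i => homog_thom _ _ _) D Hpi.
have v_van i : vanish d.+1 (v i) by move=> w wd; apply: (homog_val (Hv i)); rewrite neq_ltn wd.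
have Wv : teq d.+1 (tadd W v) W by move=> i; rewrite /tadd addrC addKr.
have w0 := tder_nilfree HW; have f0 := tder_nilfree Hphi; have v0 := tder_nilfree Tv.
exists (tadd W v); split=> //; split.
- exact: tder_tadd.
- by apply: teq_trans HW0; exact: teqW d2' Wv.
- move=> i; rewrite (_ : _ - _ = assocA phi (tadd W v) i - assocB (tadd W v) i
      - (assocA phi W i - assocB W i - dT2 v i) + (assocA phi W i - assocB W i - psi i)); last first.
    by rewrite (Dv i); sring.
  apply: vanishD; first exact: assoc_tadd.
  by apply: (thom_close (u := fun i => assocA phi W i - assocB W i)); exact: HAB.
Qed.

Lemma existence : exists W, [/\ tder W, teq 2 W W0 & assocA phi W = assocB W].
Proof.
(* Dependent choice: step [d] solves the equation below degree [d.+2], and the next one keeps the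
   components there. So the coefficient at [t] is stationary from step [size t] on, which defines
   [W]. *)
pose S d := {W | sol_upto d.+2 W}.
pose next d (x : S d) : S d.+1 :=
  let E := cid (sol_step (isT : (2 <= d.+2)%N) (svalP x)) in exist _ (sval E) (svalP E).1.
pose seqW := nat_rect S (exist _ W0 sol_upto2) next.
have seqS d : teq d.+2 (sval (seqW d.+1)) (sval (seqW d)).
  by rewrite /= /next /=; case: cid => W' [].
have seqE d e : teq d.+2 (sval (seqW (e + d)%N)) (sval (seqW d)).
  elim: e => [|e IH]; first exact: teq_refl.
  by apply: teq_trans IH; apply: (teqW _ (seqS (e + d)%N)); rewrite !ltnS leq_addl.
pose W : tder_el k 2 := fun i t => sval (seqW (size t)) i t.
have WE d : teq d.+2 W (sval (seqW d)).
  move=> i t td; rewrite addsE oppsE; apply/eqP; rewrite subr_eq0; apply/eqP.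
  rewrite /W; case: (leqP (size t) d) => [le|lt].
    have := seqE (size t) (d - size t)%N i; rewrite subnK // => /(vanish_eq (w := t)) => -> //.
  have -> : size t = d.+1 by apply/eqP; rewrite eqn_leq -ltnS td.
  by apply: (vanish_eq (seqS d i)).
have HW : tder W.
  split=> i.
    move=> d; rewrite (eq_shom (g := sval (seqW d) i)); last by apply: vanishW (WE d i).
    by have [[L _] _ _] := svalP (seqW d); apply: L.
  rewrite (vanish_eq (WE 0%N i)) //; by have [[_ N] _ _] := svalP (seqW 0%N).
exists W; split=> //.
apply: teq_eq => d; apply: (@teqW _ _ _ d.+2); first by lia.
have [HWd _ Hd] := svalP (seqW d).
have w0 := tder_nilfree HW; have wd0 := tder_nilfree HWd; have f0 := tder_nilfree Hphi.
have N u (p : 'I_3 -> option 'I_2) : nilfree u -> nilfree (coface p u) by exact: nilfree_coface.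
apply: teq_trans (teq_trans _ Hd) _.
  rewrite /assocA; apply: bch_congr => //; try (apply: nilfree_bch; exact: N).
    apply: bch_congr => //; try exact: N; apply: teq_coface; exact: WE.
  exact: teq_refl.
apply: teq_sym; rewrite /assocB; apply: bch_congr => //; try exact: N; apply: teq_coface; exact: WE.
Qed.
End Existence.

(** * The value of the twist on x + y *)

Section Substitution.
Context (k : fieldType) (hk : [pchar k] =i pred0).

Section Leibniz.
Context (n : nat) (u : tder_el k n) (u0 : nilfree u).
Implicit Types f g : series k n.

Lemma iter_leibniz f g m : iter m (der u) (f * g) =
  \sum_(i < m.+1) (iter i (der u) f * iter (m - i) (der u) g) *+ 'C(m, i).
Proof.
have Du := derivation_der u0.
elim: m => [|m IH]; first by rewrite big_ord1 subn0.
have dMn x j : der u (x *+ j) = der u x *+ j.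
  by rewrite -!scaler_nat (derZ Du).
rewrite iterS IH (der_sum Du).
rewrite (eq_bigr (fun i : 'I_m.+1 => (iter i.+1 (der u) f * iter (m - i) (der u) g) *+ 'C(m, i)
    + (iter i (der u) f * iter (m.+1 - i) (der u) g) *+ 'C(m, i))); last first.
  by move=> [i im] _ /=; rewrite dMn der_mul // mulrnDl subSn.
rewrite big_split /=.
transitivity (\sum_(i < m.+2) ((iter i (der u) f * iter (m.+1 - i) (der u) g) *+ 'C(m, i)
    + if (i : nat) is i'.+1 then (iter i (der u) f * iter (m.+1 - i) (der u) g) *+ 'C(m, i') else 0)).
  rewrite big_split /= addrC; congr (_ + _).
    by rewrite [RHS]big_ord_recr /= bin_small // mulr0n addr0.
  by rewrite [RHS]big_ord_recl add0r; apply: eq_bigr => i _; rewrite lift0 subSS.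
apply: eq_bigr => -[[|i] im] _ /=; first by rewrite !bin0 addr0.
by rewrite -mulrnDr binS.
Qed.

(** [iter_leibniz] and a Cauchy product, since the exponential of a derivation is an
    automorphism. *)
Lemma expD_mul f g : expD u (f * g) = expD u f * expD u g.
Proof.
have Ru := raising_der u0.
apply: eq_vanish => N; apply: (vanishW (leqnSn N)); rewrite !expD_oexp.
have Tr h : vanish N.+1 (oexp (der u) h - \sum_(j < N.+1) ifact k j *: iter j (der u) h).
  exact: oser_trunc.
set S := fun h => \sum_(j < N.+1) ifact k j *: iter j (der u) h in Tr.
set G := fun i j : nat => (ifact k i *: iter i (der u) f) * (ifact k j *: iter j (der u) g).
have E1 : S (f * g) = \sum_(m < N.+1) \sum_(i < m.+1) G i (m - i)%N.
  apply: eq_bigr => -[m mN] _; rewrite iter_leibniz scaler_sumr; apply: eq_bigr => -[i im] _ /=.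
  by rewrite -scaler_nat scalerA ifact_bin // /G -scalerAl -scalerAr scalerA.
have E2 : S f * S g = \sum_(i < N.+1) \sum_(j < N.+1) G i j.
  by rewrite mulr_suml; apply: eq_bigr => i _; rewrite mulr_sumr.
have H3 : vanish N.+1 (S (f * g) - S f * S g).
  rewrite E1 E2; apply: triangle_square => i j; apply: vanish_mul; apply: vanishZ.
    by have := rais_iter Ru (j := i) (@vanish0 k n f).
  by have := rais_iter Ru (j := j) (@vanish0 k n g).
have -> : oexp (der u) (f * g) - oexp (der u) f * oexp (der u) g =
  (oexp (der u) (f * g) - S (f * g)) + (S (f * g) - S f * S g)
  - ((oexp (der u) f - S f) * oexp (der u) g + S f * (oexp (der u) g - S g)).
  by rewrite mulrBl mulrBr; sring.
apply: vanishB; [apply: vanishD; [exact: (Tr (f * g)) | exact: H3] | apply: vanishD].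
  by rewrite -[N.+1]addn0; apply: vanish_mul; [exact: (Tr f) | exact: vanish0].
by rewrite -[N.+1]add0n; apply: vanish_mul; [exact: vanish0 | exact: (Tr g)].
Qed.
Lemma expD1 : expD u 1 = 1.
Proof. by rewrite expD_oexp oexp_id ?der1 //; exact: raising_der. Qed.
Lemma expDD f g : expD u (f + g) = expD u f + expD u g.
Proof.
by have := linear_oexp (raising_der u0) 1 f g; rewrite !scale1r -!expD_oexp.
Qed.
Lemma expDZ a f : expD u (a *: f) = a *: expD u f.
Proof.
have := linear_oexp (raising_der u0) a f 0; rewrite !addr0 -!expD_oexp => ->.
suff -> : expD u 0 = 0 by rewrite addr0.
have := linear_oexp (raising_der u0) (-1) 0 0; rewrite scaler0 addr0 scaleN1r addNr.
by rewrite expD_oexp.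
Qed.
Lemma expDB f g : expD u (f - g) = expD u f - expD u g.
Proof. by rewrite -scaleN1r expDD expDZ scaleN1r. Qed.
Lemma expD_sum I (r : seq I) (P : pred I) (F : I -> series k n) :
  expD u (\sum_(i <- r | P i) F i) = \sum_(i <- r | P i) expD u (F i).
Proof.
elim/big_rec2: _ => [|i x y _ <-]; last by rewrite expDD.
by have := expDZ 0 0; rewrite !scale0r.
Qed.
Lemma expDX f m : expD u (f ^+ m) = expD u f ^+ m.
Proof. by elim: m => [|m IH]; rewrite ?expr0 ?expD1 // !exprS expD_mul IH. Qed.
Lemma expD_fix f : der u f = 0 -> expD u f = f.
Proof. by move=> H; rewrite expD_oexp oexp_id //; exact: raising_der. Qed.
End Leibniz.

Section SeriesComposition.
Context (n m : nat).
Implicit Types (a b : 'I_n -> series k m) (f g : series k n).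
(** The composite $f(a_1,\dots,a_n)$, taken as an evaluation at left multiplications so that the
    lemmas on [ev] apply. *)
Definition scomp a f : series k m := ev (fun i => GRing.mul (a i)) f 1.

Lemma scomp_uniq a (G : series k n -> series k m) : (forall i, a i [::] = 0) ->
  (forall f, G f = f [::] *: 1 + \sum_i a i * G (lq i f)) -> forall f, G f = scomp a f.
Proof. by move=> a0 HG; apply: ev_uniq => // i; apply: raising_mull. Qed.
Lemma scomp_rec a f : (forall i, a i [::] = 0) ->
  scomp a f = f [::] *: 1 + \sum_i a i * scomp a (lq i f).
Proof. by move=> a0; rewrite {1}/scomp ev_rec // => i; apply: raising_mull. Qed.
Lemma ev_scomp a f h : (forall i, a i [::] = 0) ->
  ev (fun i => GRing.mul (a i)) f h = scomp a f * h.
Proof.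
move=> a0; symmetry; apply: (ev_uniq (G := fun f => scomp a f * h)) => [i|g].
  exact: raising_mull.
rewrite scomp_rec // mulrDl -scalerAl mul1r mulr_suml; congr (_ + _).
by apply: eq_bigr => i _; rewrite mulrA.
Qed.
Lemma scomp_mul a f g : (forall i, a i [::] = 0) -> scomp a (f * g) = scomp a f * scomp a g.
Proof.
by move=> a0; rewrite {1}/scomp ev_mul ?ev_scomp ?mulr1 // => i; apply: raising_mull.
Qed.
Lemma scomp_var a i : (forall i, a i [::] = 0) -> scomp a (var i) = a i.
Proof. by move=> a0; rewrite /scomp ev_var ?mulr1 // => j; apply: raising_mull. Qed.
Lemma scomp_nil a f : (forall i, a i [::] = 0) -> scomp a f [::] = f [::].
Proof.
move=> a0; rewrite scomp_rec // addsE scalesE mulr1 sumsE big1 ?addr0 // => i _.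
by rewrite mul_nil a0 mul0r.
Qed.
Lemma scomp_sexp a f : (forall i, a i [::] = 0) -> f [::] = 0 -> scomp a (sexp f) = sexp (scomp a f).
Proof.
move=> a0 f0; rewrite /scomp ev_sexp // => [|i]; last exact: raising_mull.
rewrite sexp_oexp; congr (oexp _ _); apply/funext=> h; exact: ev_scomp.
Qed.
Lemma subst_scomp (p : 'I_m -> option 'I_n) f : subst p f = scomp (fun i => subst p (var i)) f.
Proof.
apply: scomp_uniq => [i|g]; first by rewrite subst_nil.
rewrite {1}(series_dec g) substD substZ subst1 subst_sum; congr (_ + _).
by apply: eq_bigr => i _; rewrite subst_mul.
Qed.
Lemma subst_sexp (p : 'I_m -> option 'I_n) f : f [::] = 0 -> subst p (sexp f) = sexp (subst p f).
Proof. by move=> f0; rewrite !subst_scomp scomp_sexp // => i; rewrite subst_nil. Qed.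
Lemma subst_exp (p : 'I_m -> option 'I_n) f j : subst p (f ^+ j) = subst p f ^+ j.
Proof. by elim: j => [|j IH]; rewrite ?expr0 ?subst1 // !exprS subst_mul IH. Qed.
Lemma expD_subst_scomp (p : 'I_m -> option 'I_n) (u : tder_el k m) f : nilfree u ->
  expD u (subst p f) = scomp (fun i => expD u (subst p (var i))) f.
Proof.
move=> u0; apply: (scomp_uniq (G := fun f => expD u (subst p f))) => [i|g].
  by rewrite expD_oexp oexp_nil subst_nil.
rewrite {1}(series_dec g) substD substZ subst1 subst_sum expDD // expDZ // expD1 // expD_sum //.
by congr (_ + _); apply: eq_bigr => i _; rewrite subst_mul expD_mul.
Qed.

Lemma scomp_pert a b f d : (forall i, a i [::] = 0) -> (forall i, b i [::] = 0) ->
  (forall i, vanish d (a i - b i)) ->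
  vanish d.+1 (scomp a f - scomp b f - \sum_i f [:: i] *: (a i - b i)).
Proof.
move=> a0 b0 H.
have := @ev_pert k n m (fun i => GRing.mul (a i)) (fun i => GRing.mul (b i)) f 1 0 d _ _ _ (vanish0 _).
rewrite add0n; under eq_bigr do rewrite !mulr1.
apply; try by move=> i; apply: raising_mull.
by move=> i c h Hh; rewrite -mulrBl addnC; apply: vanish_mul.
Qed.
Lemma scomp_lead a b f d : (forall i, a i [::] = 0) -> (forall i, b i [::] = 0) ->
  (forall i, vanish 2 (a i - b i)) -> vanish d f -> vanish d.+1 (scomp a f - scomp b f).
Proof.
move=> a0 b0 H; elim: d f => [|d IH] f Hf.
  by apply: vanish1P; rewrite addsE oppsE !scomp_nil // subrr.
rewrite !scomp_rec // opprD addrACA subrr add0r -sumrB; apply: vanish_sum => i _.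
have -> : a i * scomp a (lq i f) - b i * scomp b (lq i f) =
  (a i - b i) * scomp a (lq i f) + b i * (scomp a (lq i f) - scomp b (lq i f)).
  by rewrite mulrBl mulrBr addrA subrK.
apply: vanishD; last first.
  by rewrite -[d.+2]add1n; apply: vanish_mul; [exact: vanish1P | apply/IH/vanish_lq].
rewrite -[d.+2]add2n; apply: vanish_mul => //.
have R i' : raising (GRing.mul (a i')) by exact: raising_mull.
by rewrite -[d]add0n; apply: ev_van => //; apply: vanish_lq.
Qed.
End SeriesComposition.

Definition scale_size n (s : k) (f : series k n) : series k n := fun w => s ^+ size w * f w.
(** For $s\ne0$ and [f] without constant term this is $f(sx)/s$, written so as to include $s=0$;
    [ch_s s] is [scale_pred s] of [ch]. *)
Definition scale_pred n (s : k) (f : series k n) : series k n := fun w => s ^+ (size w).-1 * f w.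
Lemma scale_size_mul n s (f g : series k n) : scale_size s (f * g) = scale_size s f * scale_size s g.
Proof.
apply/funext=> w; rewrite /scale_size [(f * g) w]/(smul f g w) [RHS]/(smul _ _ w) /smul mulr_sumr.
apply: eq_bigr => -[i iw] _ /=; rewrite size_takel // size_drop.
by rewrite -{1}(subnKC (iw : (i <= size w)%N)) exprD; ring.
Qed.
Lemma scale_pred_mul n s (f g : series k n) : f [::] = 0 -> scale_pred s (f * g) = scale_pred s f * scale_size s g.
Proof.
move=> f0; apply/funext=> w; rewrite /scale_pred /scale_size [(f * g) w]/(smul f g w) [RHS]/(smul _ _ w) /smul mulr_sumr.
apply: eq_bigr => -[[|i] iw] _ /=; first by rewrite take0 f0 !(mul0r, mulr0).
rewrite size_takel // size_drop /=.
have -> : (size w).-1 = (i + (size w - i.+1))%N by move: iw; rewrite ltnS => iw; lia.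
by rewrite exprD; ring.
Qed.
Lemma scale_pred_subst m n (p : 'I_m -> option 'I_n) s (f : series k n) : scale_pred s (subst p f) = subst p (scale_pred s f).
Proof.
apply/funext=> w; rewrite /scale_pred !substE; case: ifP => A; last by rewrite mulr0.
by rewrite size_pmap (eqP (_ : count _ w == size w)) // -all_count.
Qed.
Lemma scale_pred_var n s (i : 'I_n) : scale_pred s (var i) = var i.
Proof.
apply/funext=> -[|c [|e w]]; rewrite /scale_pred ?mul1r ?mulr0 //.
by rewrite /var /xvar eqseq_cons andbF mulr0.
Qed.

(** Formally, the scaling in the outer series cancels the division by $s$ in the inner ones:
    $f(s\cdot a(sx)/s)/s=f(a(sx))/s$. *)
Lemma scomp_scale_pred n m s (a : 'I_n -> series k m) f : (forall i, a i [::] = 0) -> f [::] = 0 ->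
  scomp (fun i => scale_pred s (a i)) (scale_pred s f) = scale_pred s (scomp a f).
Proof.
move=> a0 f0; have s0 i : scale_pred s (a i) [::] = 0 by rewrite /scale_pred a0 mulr0.
have ssD (x y : series k m) : scale_pred s (x + y) = scale_pred s x + scale_pred s y.
  by apply/funext=> w; rewrite /scale_pred !addsE mulrDr.
have sgD (x y : series k m) : scale_size s (x + y) = scale_size s x + scale_size s y.
  by apply/funext=> w; rewrite /scale_size !addsE mulrDr.
have ss0 : scale_pred s (0 : series k m) = 0 by apply/funext=> w; rewrite /scale_pred zerosE mulr0.
have sg0 : scale_size s (0 : series k m) = 0 by apply/funext=> w; rewrite /scale_size zerosE mulr0.
have sgZ c (x : series k m) : scale_size s (c *: x) = c *: scale_size s x.
  by apply/funext=> w; rewrite /scale_size !scalesE; ring.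
have sg1 : scale_size s (1 : series k m) = 1.
  apply/funext=> -[|c w]; rewrite /scale_size ?mul1r // -[(1 : series k m) _]/(0 : k); by rewrite mulr0.
have g0 i : scale_size s (a i) [::] = 0 by rewrite /scale_size a0 mulr0.
have H1 g : scomp (fun i => scale_pred s (a i)) (scale_size s g) = scomp (fun i => scale_size s (a i)) g.
  apply: (scomp_uniq (G := fun g => scomp (fun i => scale_pred s (a i)) (scale_size s g))) => // {}g.
  rewrite scomp_rec //; congr (_ + _); first by rewrite /scale_size expr0 mul1r.
  apply: eq_bigr => i _.
  have -> : lq i (scale_size s g) = s *: scale_size s (lq i g).
    by apply/funext=> w; rewrite scalesE /lq /scale_size /= exprS mulrA.
  have R i' : raising (GRing.mul (scale_pred s (a i'))) by exact: raising_mull.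
  rewrite {1}/scomp evZl // -scalerAr scalerAl; congr (_ * _).
  apply/funext=> -[|c w]; rewrite scalesE /scale_pred /scale_size /=; first by rewrite a0 !mulr0.
  by rewrite exprS mulrA.
have H2 g : scale_size s (scomp a g) = scomp (fun i => scale_size s (a i)) g.
  apply: (scomp_uniq (G := fun g => scale_size s (scomp a g))) => // {}g.
  rewrite {1}scomp_rec // sgD sgZ sg1; congr (_ + _).
  by elim/big_rec2: _ => [|i x y _ <-]; rewrite ?sg0 // sgD scale_size_mul.
rewrite scomp_rec // [scomp a f]scomp_rec // ssD f0 {1}/scale_pred f0 mulr0 !scale0r ss0 !add0r.
elim/big_rec2: _ => [|i x y _ ->]; first by rewrite ss0.
rewrite ssD scale_pred_mul // H2 -H1; congr (_ * _ + _).
Qed.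
End Substitution.

(** * Series satisfying the associativity law *)

Section Associativity.
Context (k : fieldType) (hk : [pchar k] =i pred0).

Lemma subst_blk_var n m (l : seq nat) (i : 'I_n) :
  subst (@blk n m l) (var i : series k n) = \sum_(j < m | nth n l j == i) var j.
Proof. by rewrite subst_var; apply: eq_bigl => j; rewrite blk_eqSome. Qed.
Lemma sum3 (P : pred 'I_3) (F : 'I_3 -> series k 3) :
  \sum_(j < 3 | P j) F j = (if P l0 then F l0 else 0) + (if P l1 then F l1 else 0)
    + (if P l2 then F l2 else 0).
Proof.
rewrite big_mkcond !big_ord_recl big_ord0 /= addr0 addrA.
have -> : lift ord0 ord0 = l1 by exact: val_inj.
have -> : lift ord0 (lift ord0 ord0) = l2 by exact: val_inj.
have -> : ord0 = l0 by exact: val_inj.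
by [].
Qed.
Lemma s1_2x : subst p1_2 (var vx : series k 2) = var l0.
Proof. by rewrite subst_blk_var sum3 val_vx /= !addr0. Qed.
Lemma s1_2y : subst p1_2 (var vy : series k 2) = var l1.
Proof. by rewrite subst_blk_var sum3 val_vy /= add0r addr0. Qed.
Lemma s2_3x : subst p2_3 (var vx : series k 2) = var l1.
Proof. by rewrite subst_blk_var sum3 val_vx /= add0r addr0. Qed.
Lemma s2_3y : subst p2_3 (var vy : series k 2) = var l2.
Proof. by rewrite subst_blk_var sum3 val_vy /= !add0r. Qed.
Lemma s12_3x : subst p12_3 (var vx : series k 2) = var l0 + var l1.
Proof. by rewrite subst_blk_var sum3 val_vx /= addr0. Qed.
Lemma s12_3y : subst p12_3 (var vy : series k 2) = var l2.
Proof. by rewrite subst_blk_var sum3 val_vy /= !add0r. Qed.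
Lemma s1_23x : subst p1_23 (var vx : series k 2) = var l0.
Proof. by rewrite subst_blk_var sum3 val_vx /= !addr0. Qed.
Lemma s1_23y : subst p1_23 (var vy : series k 2) = var l1 + var l2.
Proof. by rewrite subst_blk_var sum3 val_vy /= add0r. Qed.

(* the arguments of c(c(x,y),z), resp. c(x,c(y,z)): the block [i0] of [q] is
   filled with [c] *)
Definition plug (p q : 'I_3 -> option 'I_2) i0 (c : series k 2) : 'I_2 -> series k 3 :=
  fun i => if i == i0 then subst p c else subst q (var i).
Definition assoc_law c := scomp (plug p1_2 p12_3 vx c) c = scomp (plug p2_3 p1_23 vy c) c.

Lemma plug_nil p q i0 (c : series k 2) i : c [::] = 0 -> plug p q i0 c i [::] = 0.
Proof. by move=> c0; rewrite /plug; case: ifP; rewrite subst_nil. Qed.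

(** The series [c] occurs twice. The inner occurrence enters with coefficient [c [:: i0] = 1] and
    gives the [p] term; in the outer one the inner series may be replaced by its linear part, which
    gives the [q] term. *)
Lemma scomp_plug_pert p q i0 (c e : series k 2) d : c [::] = 0 -> e [::] = 0 -> vanish d (c - e) ->
  c [:: i0] = 1 -> subst q (var i0) = subst p (var vx + var vy : series k 2) ->
  vanish 2 (e - (var vx + var vy)) ->
  vanish d.+1 (scomp (plug p q i0 c) c - scomp (plug p q i0 e) e
     - (subst p (c - e) + subst q (c - e))).
Proof.
move=> c0 e0 Hd c1 Eq He.
have C0 i := plug_nil p q i0 i c0; have E0 i := plug_nil p q i0 i e0.
have H1 : vanish d.+1 (scomp (plug p q i0 c) c - scomp (plug p q i0 e) c - subst p (c - e)).
  have <- : \sum_i c [:: i] *: (plug p q i0 c i - plug p q i0 e i) = subst p (c - e).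
    rewrite (bigD1 i0) //= big1 => [|i ne]; last by rewrite /plug (negPf ne) subrr scaler0.
    by rewrite addr0 c1 scale1r /plug eqxx substB.
  apply: scomp_pert => // i; rewrite /plug; case: ifP => _; last by rewrite subrr.
  by rewrite -substB; apply: subst_van.
have H2 : vanish d.+1 (scomp (plug p q i0 e) (c - e) - subst q (c - e)).
  rewrite [subst q _]subst_scomp; apply: scomp_lead => // i; first by rewrite subst_nil.
  rewrite /plug; case: eqP => [->|_]; last by rewrite subrr.
  by rewrite Eq -substB; apply: subst_van.
have := vanishD H1 H2; rewrite [scomp _ (c - e)]evBl; last by move=> i; apply: raising_mull.
rewrite -/(scomp (plug p q i0 e) c) -/(scomp (plug p q i0 e) e).
set a := scomp _ c; set b := scomp _ c; set e' := scomp _ e => H.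
suff -> : a - e' - (subst p (c - e) + subst q (c - e)) =
  a - b - subst p (c - e) + (b - e' - subst q (c - e)) by [].
by sring.
Qed.

Lemma assoc_law_uniq (c e : series k 2) : lie_series c -> lie_series e -> assoc_law c -> assoc_law e ->
  vanish 2 (e - (var vx + var vy)) -> vanish 3 (c - e) -> c = e.
Proof.
move=> Lc Le Ac Ae He H3; have c0 := lie_nil Lc; have e0 := lie_nil Le.
have c1 i : c [:: i] = 1.
  rewrite (vanish_eq H3) // (vanish_eq He) // addsE /var /xvar.
  by case: (ord2 i) => ->; rewrite !eqseq_cons !andbT ?eqxx ?vx_vy ?vy_vx ?addr0 ?add0r.
suff H d : vanish d.+3 (c - e) by apply: eq_vanish => d; apply: (vanishW _ (H d)); lia.
elim: d => [//|d IH] w; rewrite ltnS leq_eqVlt => /orP[/eqP wd|/IH //].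
apply: (lie_H2 hk _ (lie_seriesB Lc Le) _ wd) => // t td.
have HL := scomp_plug_pert (p := p1_2) (q := p12_3) c0 e0 IH (c1 vx).
have HR := scomp_plug_pert (p := p2_3) (q := p1_23) c0 e0 IH (c1 vy).
rewrite substD s1_2x s1_2y s12_3x in HL.
rewrite substD s2_3x s2_3y s1_23y in HR.
have {HL HR} := vanishB (HL erefl He) (HR erefl He).
rewrite Ac Ae; move=> /(_ t); rewrite td ltnSn => /(_ isT).
rewrite /d2 !(addsE, oppsE) => H; rewrite -[RHS]H.
by ring.
Qed.

(** Both sides exponentiate to $e^xe^ye^z$. *)
Lemma assoc_law_ch : assoc_law (ch k).
Proof.
have c0 := ch_nil k; have C0 p q i0 i := plug_nil p q i0 i c0.
have v0 n (i : 'I_n) : (var i : series k n) [::] = 0 by [].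
apply: sexp_inj; try by rewrite scomp_nil.
rewrite -!scomp_sexp // sexp_ch // !scomp_mul // !scomp_sexp // !scomp_var //.
rewrite /plug !eqxx vx_vy vy_vx s12_3y s1_23x -!subst_sexp // sexp_ch // !subst_mul !subst_sexp //.
by rewrite s1_2x s1_2y s2_3x s2_3y mulrA.
Qed.

Lemma assoc_law_ch_s s : assoc_law (ch_s s).
Proof.
have c0 := ch_nil k; have C0 p q i0 i := plug_nil p q i0 i c0.
have E p q i0 : scomp (plug p q i0 (ch_s s)) (ch_s s) = scale_pred s (scomp (plug p q i0 (ch k)) (ch k)).
  rewrite -scomp_scale_pred //; congr (scomp _ _); apply/funext=> i; rewrite /plug -[ch_s s]/(scale_pred s (ch k)).
  by case: ifP => _; rewrite scale_pred_subst // scale_pred_var.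
by rewrite /assoc_law !E assoc_law_ch.
Qed.
Lemma lie_ch_s s : lie_series (ch_s (k := k) s).
Proof.
move=> d; have -> : shom d (ch_s s) = s ^+ d.-1 *: shom d (ch k).
  by apply/funext=> w; rewrite scalesE /shom /ch_s; case: eqP => [->|]; rewrite ?mulr0.
exact: LPscale (lie_ch hk d).
Qed.

Section Sum.
Context (phi : tder_el k 3) (Hphi : tder phi) (Sphi : sder phi).
Context (s : k) (W : tder_el k 2) (HW : tder W) (HW0 : teq 2 W (W0 s)).
Hypothesis HAB : assocA phi W = assocB W.
Let w0 : nilfree W := tder_nilfree HW.
Definition chW : series k 2 := expD W (var vx + var vy).

Lemma expD_plug p q i0 : subst q (var i0) = subst p (var vx + var vy : series k 2) ->
  (forall i, i != i0 -> expD (coface p W) (subst q (var i)) = subst q (var i)) ->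
  forall f, expD (coface p W) (subst q f) = scomp (plug p q i0 chW) f.
Proof.
move=> Eq Hq f; have N := nilfree_coface p w0.
rewrite expD_subst_scomp //; congr (scomp _ _); apply/funext=> i; rewrite /plug.
case: eqP => [->|/eqP]; last exact: Hq.
by rewrite Eq expD_coface.
Qed.

Lemma expD_free (p : 'I_3 -> option 'I_2) j : p j = None -> expD (coface p W) (var j) = var j.
Proof.
move=> Ej; have N := nilfree_coface p w0; apply: expD_fix => //.
by rewrite der_var // coface_None // /br mulr0 mul0r subrr.
Qed.

Lemma blk_out l (j : 'I_3) : (2 <= nth 2%N l j)%N -> @blk 2 3 l j = None.
Proof. by move=> H; have := blkE 2 l j; rewrite ltnNge H; case: (blk 2 l j). Qed.

Lemma expD_12 f : expD (coface p1_2 W) (subst p12_3 f) = scomp (plug p1_2 p12_3 vx chW) f.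
Proof.
apply: expD_plug; first by rewrite substD s1_2x s1_2y s12_3x.
by move=> i; case: (ord2 i) => ->; rewrite ?eqxx // s12_3y expD_free //; apply: blk_out.
Qed.
Lemma expD_23 f : expD (coface p2_3 W) (subst p1_23 f) = scomp (plug p2_3 p1_23 vy chW) f.
Proof.
apply: expD_plug; first by rewrite substD s2_3x s2_3y s1_23y.
by move=> i; case: (ord2 i) => ->; rewrite ?eqxx // s1_23x expD_free //; apply: blk_out.
Qed.

Lemma assoc_law_chW : assoc_law chW.
Proof.
have f0 := tder_nilfree Hphi; have N p := nilfree_coface p w0 : nilfree (coface p W : tder_el k 3).
have E := sum3 predT (fun j => var j).
rewrite /assoc_law -expD_12 -expD_23 -!expD_coface // !substD.
rewrite s12_3x s12_3y s1_23x s1_23y addrA.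
rewrite -expD_bch // -[RHS]expD_bch // -/(assocB W) -HAB /assocA [RHS]expD_bch //; last exact: nilfree_bch.
by congr (expD _ _); rewrite -[LHS]E [RHS]expD_fix -?E // sum_var_kill.
Qed.

Lemma lie_chW : lie_series chW.
Proof.
have Ru := raising_der w0; have Lv : lie_series (var vx + var vy : series k 2).
  by apply: lie_seriesD; exact: lie_series_var.
apply: lie_series_eq => d; rewrite /chW expD_oexp.
exists (\sum_(j < d.+1) ifact k j *: iter j (der W) (var vx + var vy)); last exact: oser_trunc.
apply: lie_series_sum => j _; apply: lie_seriesZ.
by elim: (j : nat) => //= m IH; apply: lie_der => //; have [] := HW.
Qed.

(** [assoc_law_uniq] starts from agreement up to degree two because [lie_H2] begins in degree three.
    In degree two the term $sr/2$ of [W] gives $\frac s2[x,y]$, the same as [ch_s]. *)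
Lemma chW_low : vanish 3 (chW - ch_s s).
Proof.
have Ru := raising_der w0.
have R0 : raising (fun=> 0 : series k 2).
  by split=> [a f g|d f _ //]; rewrite scaler0 addr0.
have v1 : vanish 1 (var vx + var vy : series k 2) by apply: vanishD; exact: vanish_var.
have := oexp_pert (d := 1) (e := 1) Ru R0 _ v1.
rewrite (oexp_id R0) // -expD_oexp subr0 -/chW => H.
have {}H : vanish 3 (chW - (var vx + var vy) - der W (var vx + var vy)).
  by apply: H => c g Hg; rewrite subr0 addn1; apply: (rais_van Ru).
have HE : chW - ch_s s = (chW - (var vx + var vy) - der W (var vx + var vy))
   + ((var vx + var vy) + der W (var vx + var vy) - ch_s s) by sring.
rewrite HE; apply: vanishD => // -[|a [|b [|//]]] _.
- rewrite !(addsE, oppsE) /ch_s ch_nil // mulr0 oppr0 addr0.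
  by rewrite (vanish_nil (rais_van Ru v1)) !addr0.
- rewrite !(addsE, oppsE) /ch_s ch1 // mul1r (rais_van Ru v1) // addr0 /var /xvar.
  by case: (ord2 a) => ->; rewrite !eqseq_cons !andbT ?eqxx ?vx_vy ?vy_vx ?addr0 ?add0r subrr.
rewrite !(addsE, oppsE) der2 /ch_s ch2 // expr1 !(W_deg1 HW0) !addsE /var /xvar !eqseq_cons !andbF !addr0 !andbT.
by case: (ord2 a) => ->; case: (ord2 b) => ->; rewrite ?eqxx ?vx_vy ?vy_vx ?val_vx ?val_vy /=; ring.
Qed.

Lemma chW_eq : chW = ch_s s.
Proof.
apply: assoc_law_uniq => //; [exact: lie_chW | exact: lie_ch_s | exact: assoc_law_chW
 | exact: assoc_law_ch_s | | exact: chW_low].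
move=> [|a [|//]] _; rewrite !(addsE, oppsE) /ch_s.
  by rewrite ch_nil // mulr0 /var /xvar /=; ring.
rewrite ch1 // mul1r /var /xvar.
by case: (ord2 a) => ->; rewrite !eqseq_cons !andbT ?eqxx ?vx_vy ?vy_vx ?addr0 ?add0r subrr.
Qed.
End Sum.
End Associativity.

(** * The divergence condition *)

Section Divergence.
Context (k : fieldType) (hk : [pchar k] =i pred0).
Context (phi : tder_el k 3) (Hphi : tder phi) (Sphi : sder phi) (Dphi : tr_eq (divS phi) (@szero k 3)).
Context (W : tder_el k 2) (HW : tder W) (HAB : assocA phi W = assocB W).
Let w0 : nilfree W := tder_nilfree HW.
Let chi : series k 2 := chW W.
Hypothesis chi1 : forall i, chi [:: i] = 1.
Let chi0 : chi [::] = 0.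
Proof. by rewrite /chi /chW expD_oexp oexp_nil addsE; exact: addr0. Qed.

(* The twist equation makes [tdelta] of [Jser W] trace-zero; [hpow m] below are
   the solutions of this equation coming from delta-tilde of [x^m]. *)
Definition tdelta (f : series k 2) : series k 3 :=
  subst p1_2 f + expD (coface p1_2 W) (subst p12_3 f)
  - (subst p2_3 f + expD (coface p2_3 W) (subst p1_23 f)).

Lemma tdelta_lin a f g : tdelta (a *: f + g) = a *: tdelta f + tdelta g.
Proof.
have N p := nilfree_coface p w0 : nilfree (coface p W : tder_el k 3).
rewrite /tdelta !substD !substZ !expDD // !expDZ // !scalerBr !scalerDr.
by sring.
Qed.

(** The cocycle rule [Jser_bch] is applied to both sides of the twist equation; the contribution of
    $\Phi$ is trace-zero since its divergence is. *)
Lemma trz_tdelta_Jser : trz (tdelta (Jser W)).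
Proof.
have N p := nilfree_coface p w0 : nilfree (coface p W : tder_el k 3).
have f0 := tder_nilfree Hphi.
have Tphi : trz (Jser phi).
  apply: trz_Jser => // w; have := (tr_eqP hk _ _).1 Dphi w; rewrite subr0.
  by case: w => [_|c w /(_ isT)] //; rewrite /cyc big_ord0.
have HA := Jser_bch hk (nilfree_bch (N p1_2) (N p12_3)) f0.
have HA2 := Jser_bch hk (N p1_2) (N p12_3).
have HB := Jser_bch hk (N p2_3) (N p1_23).
have HC := trz_expD hk (nilfree_bch (N p1_2) (N p12_3)) Tphi.
rewrite -/(assocA phi W) HAB /assocB in HA.
have := trzD (trzD (trzB HB HA) (trzN HA2)) (trzN HC).
rewrite !Jser_coface // => H w; apply: etrans (H w).
by congr (cyc _ w); rewrite /tdelta; sring.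
Qed.

Definition hpow m : series k 2 := var vx ^+ m - chi ^+ m + var vy ^+ m.

(** Both halves of [tdelta] telescope to $x^m+y^m+z^m$ minus the $m$-th power of the threefold
    composite, which is the same by the associativity law. *)
Lemma tdelta_hpow m : tdelta (hpow m) = 0.
Proof.
have N p := nilfree_coface p w0 : nilfree (coface p W : tder_el k 3).
have C0 p q i0 i := plug_nil p q i0 i chi0.
rewrite /tdelta /hpow ![subst _ (_ - _ + _)]substD !substB ![expD _ (_ - _ + _)]expDD // ![expD _ (_ - _)]expDB // !subst_exp !expDX //.
rewrite !(expD_12 hk HW) !(expD_23 hk HW) -/chi !scomp_var // (assoc_law_chW hk Hphi Sphi HW HAB).
rewrite /plug !eqxx vx_vy vy_vx s1_2x s1_2y s2_3x s2_3y s12_3y s1_23x -/chi.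
by sring.
Qed.

Lemma var_exp n (i : 'I_n) m w : (var i ^+ m : series k n) w = (w == nseq m i)%:R.
Proof.
elim: m w => [|m IH] [|c w]; rewrite ?expr0 ?exprS //.
  by rewrite mul_nil mul0r.
rewrite mul_cons [var i [::]]/(0 : k) mul0r add0r lq_var eqseq_cons.
by case: eqP => _ /=; [rewrite mulr1n mul1r; exact: IH | rewrite mulr0n mul0r].
Qed.

Lemma chi_exp m v : size v = m -> (chi ^+ m) v = 1.
Proof.
elim: m v => [|m IH] [|c v] //= [vm]; rewrite exprS mul_cons chi0 mul0r add0r.
have -> : lq c chi = 1 + (lq c chi - 1) by sring.
rewrite mulrDl mul1r addsE IH // [X in _ + X](_ : _ = 0) ?addr0 //.
have chiv : vanish m (chi ^+ m) by apply/vanish_exp/vanish1P.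
have : vanish (1 + m) ((lq c chi - 1) * chi ^+ m).
  by apply: vanish_mul => //; apply: vanish1P; rewrite addsE oppsE [lq _ _ _]chi1 subrr.
by apply; rewrite vm.
Qed.

Lemma hpow_van m : vanish m (hpow m).
Proof.
by apply: vanishD; [apply: vanishB|]; apply: vanish_exp; [exact: vanish_var | exact: vanish1P | exact: vanish_var].
Qed.

(** The lowest-degree part is $x^m+y^m-(x+y)^m$, and every word of length $m$ occurs once in
    $(x+y)^m$. *)
Lemma hpow_lead m v : (0 < m)%N -> size v = m -> hpow m v = - ((vx \in v) && (vy \in v))%:R.
Proof.
move=> m0 vm; rewrite /hpow !(addsE, oppsE) !var_exp chi_exp //.
have V i : (v == nseq m i) = all (pred1 i) v by rewrite -vm; apply/eqP/all_pred1P.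
have A i j : i != j -> all (pred1 i) v = (j \notin v).
  move=> ij; apply/allP/idP => [H|jv c cv]; first by apply/negP => /H /=; rewrite eq_sym (negPf ij).
  move: ij jv; case: (ord2 i) => ->; case: (ord2 j) => ->; rewrite ?eqxx //= => _ jv;
  by case: (ord2 c) => cE; rewrite cE ?eqxx //= in cv *; rewrite cv in jv.
rewrite !V (A vx vy) ?vx_vy // (A vy vx) ?vy_vx //.
have : (vx \in v) || (vy \in v).
  by case: v vm {V A} => [E|c v _]; [rewrite -E in m0 | case: (ord2 c) => ->; rewrite !inE eqxx ?orbT].
case: (vx \in v); case: (vy \in v) => //= _; rewrite !(mulr0n, mulr1n) ?sub0r ?subrr ?addr0 ?oppr0 //.
by rewrite addNr.
Qed.

Lemma cyc_hpow m v : (0 < m)%N -> size v = m ->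
  cyc (hpow m) v = - (if (vx \in v) && (vy \in v) then m%:R else 0).
Proof.
move=> m0 vm; rewrite /cyc.
under eq_bigr do rewrite hpow_lead ?size_rot // !mem_rot.
rewrite vm; case: ifP => _; last by rewrite big1 ?oppr0.
by rewrite sumr_const card_ord /= mulr1n mulNrn.
Qed.

(** The lowest cyclic sums of [f] take one value on mixed words, sampled at $xy^{n-1}$; those of
    [hpow n] are $-n$ there, hence the sign and the denominator. *)
Definition cut n (f : series k 2) := f + (cyc f (vx :: nseq n.-1 vy) / n%:R) *: hpow n.

Lemma cut_trzb n f : trz (tdelta f) -> trzb n f -> trzb n.+1 (cut n f).
Proof.
have N p := nilfree_coface p w0 : nilfree (coface p W : tder_el k 3).
move=> Tf Bf v; rewrite ltnS leq_eqVlt /cut cycD cycZ => /orP[/eqP vn|vn]; last first.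
  by rewrite Bf // (cyc_van (hpow_van (m := n)) vn) mulr0 addr0.
case: n => [|n] in Bf vn *; first by case: v vn => // _; rewrite /cyc !big_ord0 mulr0 addr0.
rewrite cyc_hpow //.
(* In the lowest degree the automorphisms in [tdelta] act trivially on traces, so the equation
   becomes linear and says that the cyclic sums form a cocycle. *)
have HP w : size w = n.+1 -> d2 (cyc f) w = 0.
  move=> wn; have := trzb_expD hk (N p1_2) (trzb_subst p12_3 Bf).
  move=> /(_ w); rewrite wn ltnSn cycB !cyc_subst => /(_ isT) E1.
  have := trzb_expD hk (N p2_3) (trzb_subst p1_23 Bf).
  move=> /(_ w); rewrite wn ltnSn cycB !cyc_subst => /(_ isT) E2.
  have := Tf w; rewrite /tdelta cycB !cycD !cyc_subst => E3.
  rewrite /d2 !(addsE, oppsE) !substE.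
  move/eqP: E1; rewrite subr_eq0 => /eqP E1; move/eqP: E2; rewrite subr_eq0 => /eqP E2.
  by rewrite E1 E2 in E3; rewrite -[RHS]oppr0 -[in RHS]E3; ring.
have n0 : n.+1%:R != 0 :> k := natS_neq0 hk n.
case: ifP => [/andP[xv yv]|nv]; last first.
  rewrite oppr0 mulr0 addr0.
  suff [c ->] : exists c, v = nseq n.+1 c by exact: (d2_pure HP).
  exists (if vx \in v then vx else vy); rewrite -vn; apply/all_pred1P/allP => c cv /=.
  by case: (ord2 c) cv nv => -> cv; rewrite cv /= ?andbT ?eqxx // => ->.
suff -> : cyc f v = cyc f (vx :: nseq n vy) by rewrite mulrN divfK // subrr.
(* [d2_const] needs length three. In length one no word is mixed, and in length two $xy$ and $yx$
   are rotations of each other. *)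
case: n => [|[|n]] in HP vn n0 {Bf} *; last exact: (d2_const HP).
  case: v xv yv vn => [|c [|//]] //; rewrite !inE => /eqP <- /eqP E.
  by have := vx_vy; rewrite E eqxx.
case: v xv yv vn => [|a [|b [|//]]] //; rewrite !inE => xv yv _.
move: xv yv; case: (ord2 a) => ->; case: (ord2 b) => ->; rewrite ?eqxx ?vx_vy ?vy_vx //= => _ _.
by rewrite -(cyc_rot f 1).
Qed.

(** [g m] is the multiple removed at stage [m], and later stages leave it alone, so one sequence
    serves every [n]. *)
Lemma tr_Jser : exists g : nat -> k, forall n,
  trzb n (Jser W - \sum_(m < n) g m *: hpow m).
Proof.
pose F := nat_rect (fun=> series k 2) (Jser W) cut.
have FS n : F n.+1 = cut n (F n) by [].
have HF n : trz (tdelta (F n)) /\ trzb n (F n).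
  elim: n => [|n [T B]]; first by split=> //; exact: trz_tdelta_Jser.
  rewrite FS; split; last exact: cut_trzb.
  by rewrite /cut addrC tdelta_lin tdelta_hpow scaler0 add0r.
exists (fun n => - (cyc (F n) (vx :: nseq n.-1 vy) / n%:R)) => n.
suff <- : F n = Jser W - \sum_(m < n) - (cyc (F m) (vx :: nseq m.-1 vy) / m%:R) *: hpow m by have [] := HF n.
elim: n => [|n IH]; first by rewrite big_ord0 subr0.
by rewrite FS big_ord_recr /= /cut {1}IH scaleNr; sring.
Qed.
End Divergence.

(** * Translation to automorphisms, and uniqueness *)

Section Solutions.
Context (k : fieldType) (hk : [pchar k] =i pred0).
Context (phi : tder_el k 3) (Hphi : tder phi) (Sphi : sder phi).
Context (s : k).

Lemma expD_toppK n (u : tder_el k n) f : nilfree u -> expD (topp u) (expD u f) = f.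
Proof.
by move=> u0; rewrite -(expD_bch hk _ (nilfree_topp u0) u0) bch_Nu // expD_zero.
Qed.

Lemma assoc_eqP (W : tder_el k 2) : tder W ->
  (forall f t, expD phi f t =
      expD (tneg (coface p12_3 W)) (expD (tneg (coface p1_2 W))
        (expD (coface p2_3 W) (expD (coface p1_23 W) f))) t) <->
  assocA phi W = assocB W.
Proof.
move=> HW; have w0 := tder_nilfree HW; have f0 := tder_nilfree Hphi.
have N p := nilfree_coface p w0 : nilfree (coface p W : tder_el k 3).
have N2 p q : nilfree (bch (coface p W : tder_el k 3) (coface q W)) := nilfree_bch (N p) (N q).
have EA f : expD (assocA phi W) f = expD (coface p1_2 W) (expD (coface p12_3 W) (expD phi f)).
  by rewrite /assocA !expD_bch.
have EB f : expD (assocB W) f = expD (coface p2_3 W) (expD (coface p1_23 W) f).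
  by rewrite /assocB expD_bch.
split=> [H|H f t]; last by rewrite -EB -H EA !tneg_topp !expD_toppK.
apply: expD_inj; [exact: tder_assocA | exact: tder_assocB |] => i.
rewrite EA EB (funext (H (var i))).
have K (u : tder_el k 3) f : nilfree u -> expD u (expD (topp u) f) = f.
  by move=> u0; rewrite -(expD_bch hk _ u0 (nilfree_topp u0)) bch_uN // expD_zero.
by rewrite !tneg_topp !K.
Qed.

(** By [assoc_tadd] the lowest-degree difference of two solutions is annihilated by [dT2]. The
    common linear part [W0 s] puts that difference in degree at least two, where [dT2] is
    injective. *)
Lemma assoc_uniq (W V : tder_el k 2) : tder W -> tder V -> teq 2 W (W0 s) -> teq 2 V (W0 s) ->
  assocA phi W = assocB W -> assocA phi V = assocB V -> V = W.
Proof.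
move=> HW HV W2 V2 AW AV; pose v : tder_el k 2 := fun i => V i - W i.
have VE : V = tadd W v by apply/funext=> i; rewrite /tadd /v addrC subrK.
have Hv : tder v by exact: tder_tsub.
have v0 := tder_nilfree Hv; have w0 := tder_nilfree HW.
suff H d i : vanish d.+2 (v i).
  by apply/funext=> i; apply: eq_vanish => d; apply: (vanishW _ (H d i)); lia.
elim: d i => [|d IH] i; first by apply: (teq_trans V2 (teq_sym W2)).
move=> w; rewrite ltnS leq_eqVlt => /orP[/eqP wd|/IH -> //].
apply: (@dT2_inj k v d.+2 Hv isT) wd => j t td.
have := assoc_tadd hk Hphi w0 v0 IH j (w := t); rewrite td => /(_ (ltnSn _)).
rewrite -VE AV AW !subrr !(addsE, oppsE) => H.
by rewrite -H; ring.
Qed.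

Lemma tr_delta (W : tder_el k 2) : tr_eq (divS phi) (@szero k 3) -> tder W -> assocA phi W = assocB W ->
  chW W = ch_s s -> exists g, tr_eq (Jser W) (delta_s s g).
Proof.
move=> Dphi HW AW Echi.
have chi1 i : chW W [:: i] = 1 by rewrite Echi /ch_s ch1 // mul1r.
have [g Hg] := tr_Jser hk Hphi Sphi Dphi HW AW chi1.
exists g; apply/(tr_eqP hk) => w w0; rewrite -[RHS](Hg (size w).+1 w (ltnSn _)).
apply: eq_bigr => i _; rewrite !(addsE, oppsE); congr (_ - _).
have {w0} : size (rot i w) != 0%N by rewrite size_rot; case: w w0 i.
move: (rot i w) (size_rot i w) => v <- {i w} v0.
have P j c : (v == nseq j c) = (size v == j) && all (pred1 c) v.
  apply/eqP/andP => [->|[/eqP <-] /all_pred1P //]; by rewrite size_nseq eqxx all_nseq /= eqxx orbT.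
have PS c : (if (0 < size v)%N && all (fun e => e == c) v then g (size v) else 0) =
    \sum_(1 <= m < (size v).+1) g m * (v == nseq m c)%:R.
  case: (size v) P => [|m] P; first by rewrite big_geq.
  rewrite big_nat_recr // big_nat big1 => [|j /andP[_ jm]]; last by rewrite P (gtn_eqF jm) mulr0.
  by rewrite P eqxx /= add0r; case: ifP => _; rewrite ?mulr1 ?mulr0.
rewrite /delta_s !PS sumsE [RHS](_ : _ = \sum_(0 <= m < (size v).+1) (g m *: hpow W m) v); last by rewrite big_mkord.
rewrite [RHS]big_ltn //.
(* The index $0$ is absent from [delta_s]: [hpow W 0] is $1$, supported on the empty word. *)
have -> : (g 0%N *: hpow W 0) v = 0.
    rewrite scalesE /hpow !expr0 subrr add0r [(1 : series k 2) v]/((v == [::])%:R) -size_eq0.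
  by rewrite (negPf v0) mulr0.
rewrite add0r -sumrB -big_split /=; apply: eq_bigr => m _.
rewrite scalesE /hpow !(addsE, oppsE) !var_exp spowE Echi; ring.
Qed.
End Solutions.

Theorem theorem7p5 (k : fieldType) (hk : [pchar k] =i pred0)
  (phi : tder_el k 3) (hphi : kv phi) (hpent : pentagon phi)
  (s : k) (hs : s ^+ 2 / 8%:R = pi2 phi) :
  exists! F : series k 2 -> series k 2,
    (exists u : tder_el k 2,
        tder u /\ (forall i v, (size v <= 1)%N -> u i v = 0) /\
        F = (fun f => expD u (expD (tscale (s / 2%:R) (rder k)) f)))
    /\ SolKV s F /\ assoc_eq phi F.
Proof.
have [Hphi [Sphi Dphi]] := hphi.
have [W [HW W2 AW]] := existence hk Hphi Sphi hpent hs.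
have T0 := tder_W0 s; have t0 := tder_nilfree T0; have w0 := tder_nilfree HW.
have n0 := nilfree_topp t0.
have Echi := chW_eq hk Hphi Sphi HW W2 AW.
exists (expD W); split.
  split; [|split].
  (* The factor $\exp(u)$ is $F\exp(-sr/2)$; its logarithm starts in degree two because [W] and
     [W0 s] agree in degree one. *)
  - exists (bch W (topp (W0 s))); split; [|split].
    + by apply: tder_bch => //; apply: tder_topp.
    + move=> i v vs; have H : teq 2 (bch W (topp (W0 s))) (bch (W0 s) (topp (W0 s))).
        by apply: bch_congr => //; exact: teq_refl.
      by rewrite (vanish_eq (H i)) // bch_uN.
    + apply/funext=> f; rewrite -/(W0 s) -expD_bch //; last exact: nilfree_bch.
      by rewrite -bchA // bch_Nu // bchu0.
  - exists W; split=> //; split=> //; split; last exact: (tr_delta hk Hphi Sphi).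
    by move=> t; rewrite -Echi.
  - by exists W; split=> //; split=> //; apply/(assoc_eqP hk Hphi HW).
move=> F [[u [Hu [u1 FE]]] [_ [V [HV [FV AV]]]]].
have u0 := tder_nilfree Hu.
(* Two logarithms of [F] coincide, so the prescribed shape of [F] fixes the linear part of [V] to be
   that of [W0 s]. *)
have VE : V = bch u (W0 s).
  apply: expD_inj => // [|i]; first exact: tder_bch.
  by rewrite expD_bch // -FV FE.
rewrite FV; congr expD; symmetry.
apply: (assoc_uniq hk Hphi (s := s)) => //; last exact/(assoc_eqP hk Hphi HV).
have z0 := @nilfree0 k 2; rewrite VE -[X in teq _ _ X](bch0u hk t0).
apply: bch_congr => //; last exact: teq_refl.
by move=> i w wd; rewrite addsE oppsE u1 // subr0.
Qed.
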